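(* Let $\mathbf{k}$ be a field and let $q\in\mathbf{k}\setminus\{0\}$ have finite quantum characteristic $e$. The even part of $\mathrm{HH}^{\ast}(A_e)$ is given by $$\mathrm{HH}^{\mathrm{ev}}(A_e)\cong\mathbf{k}[z_1,\dots,z_{e-1},y]/\langle z_iz_j,\ z_ky,\ y^e\mid 1\le i,j,k\le e-1\rangle,$$ where $\deg z_i=0$ and $\deg y=2$.
   Context: For a $\mathbf{k}$-algebra $R$ put $R^{\mathrm{en}} = R\otimes_{\mathbf{k}} R^{\mathrm{op}}$, $\mathrm{HH}^i(R)=\mathrm{Ext}^i_{R^{\mathrm{en}}}(R,R)$ and $\mathrm{HH}^{\ast}(R)=\bigoplus_{i\ge 0}\mathrm{HH}^i(R)$, a graded algebra under the Yoneda product; its even part is the commutative subalgebra $\mathrm{HH}^{\mathrm{ev}}(R)=\bigoplus_{i\ge0}\mathrm{HH}^{2i}(R)$. The quantum characteristic is $e=\inf\{i\in\mathbb{Z}_{\ge1}\mid 1+q+\cdots+q^{i-1}=0\text{ in }\mathbf{k}\}$ (so $e\ge2$). $A_e$ is the $\mathbf{k}$-algebra given by the quiver with vertices $1,\dots,e$ and arrows $\alpha(i):i\to i+1$, $\alpha^-(i):i+1\to i$ for $1\le i\le e-1$, with relations $\alpha(i)\alpha(i-1)=0$, $\alpha^-(i-1)\alpha^-(i)=0$, $\alpha(i-1)\alpha^-(i-1)=\alpha^-(i)\alpha(i)$ for $2\le i\le e-1$, and $\alpha(e-1)\alpha^-(e-1)=0$ (paths are composed from right to left). *)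

(* Defs.v *)
From HB Require Import structures.
From mathcomp Require Import all_boot all_order all_algebra.
From mathcomp Require Import boolp functions.
From mathcomp Require Import finmap.
From mathcomp Require Import -(notations) monalg.
From mathcomp Require Import mpoly.

Set Implicit Arguments.
Unset Strict Implicit.
Unset Printing Implicit Defensive.

Import GRing.Theory.
Import Quotient.
Local Open Scope ring_scope.
Local Open Scope quotient_scope.

(* A k-algebra is a ring with a central ring morphism from k.  The library's
   [algType] also requires 1 != 0, which is not asked of quotients and tensor
   products here. *)
HB.mixin Record PzRing_isKAlgebra (k : fieldType) A of GRing.PzRing A := {
  kin : k -> A;
  kin1 : kin 1 = 1;
  kinD : forall c d, kin (c + d) = kin c + kin d;
  kinM : forall c d, kin (c * d) = kin c * kin d;
  kinC : forall c x, kin c * x = x * kin c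
}.

#[short(type="kalgType")]
HB.structure Definition KAlgebra (k : fieldType) :=
  {A of PzRing_isKAlgebra k A & GRing.PzRing A}.

Notation "c *k: x" := (kin c * x) (at level 40) : ring_scope.

Section PolynomialAlgebra.
Variables (k : fieldType) (n : nat).

Fact mpoly_kinC (c : k) (x : {mpoly k[n]}) : c%:MP * x = x * c%:MP.
Proof. exact: mulrC. Qed.

HB.instance Definition _ := @PzRing_isKAlgebra.Build k {mpoly k[n]}
  (fun c => c%:MP) (mpolyC1 n k) (@mpolyCD n k) (@mpolyCM n k) mpoly_kinC.

End PolynomialAlgebra.

Section OppositeAlgebra.
Variables (k : fieldType) (R : kalgType k).

Fact opp_kinM (c d : k) : kin (c * d) = (kin c : R^c) * kin d.
Proof. by rewrite mulrC kinM. Qed.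

Fact opp_kinC (c : k) (x : R^c) : (kin c : R^c) * x = x * (kin c : R^c).
Proof. by symmetry; apply: (kinC c (x : R)). Qed.

HB.instance Definition _ := @PzRing_isKAlgebra.Build k R^c
  (fun c => kin c : R) kin1 kinD opp_kinM opp_kinC.

End OppositeAlgebra.

Record submodule (R : pzRingType) (V : lmodType R) := Submodule {
  sm_mem :> V -> Prop;
  sm0 : sm_mem 0;
  smD : forall x y, sm_mem x -> sm_mem y -> sm_mem (x + y);
  smZ : forall a x, sm_mem x -> sm_mem (a *: x)
}.

Section SubQuotientModules.
Variables (R : pzRingType) (V : lmodType R) (S : submodule V).

Lemma smN x : S x -> S (- x).
Proof. by rewrite -scaleN1r; apply: smZ. Qed.

Definition sm_pred : {pred V} := fun x => `[< S x >].

Lemma sm_predP x : reflect (S x) (x \in sm_pred).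
Proof. exact: asboolP. Qed.

Fact sm_pred_closed : submod_closed sm_pred.
Proof.
split=> [|a x y /sm_predP Sx /sm_predP Sy]; apply/sm_predP; first exact: sm0.
by apply: smD => //; apply: smZ.
Qed.

HB.instance Definition _ := GRing.isSubmodClosed.Build R V sm_pred sm_pred_closed.

Fact sm_pred_oppr_closed : oppr_closed sm_pred.
Proof. by move=> x /sm_predP Sx; apply/sm_predP/smN. Qed.

HB.instance Definition _ := GRing.isOppClosed.Build V sm_pred sm_pred_oppr_closed.

Definition submod_of := {x : V | x \in sm_pred}.
HB.instance Definition _ := SubChoice.on submod_of.
HB.instance Definition _ := [SubChoice_isSubLmodule of submod_of by <:].

Definition quot_mod := {quot (sm_pred : zmodClosed V)}.
HB.instance Definition _ := GRing.Zmodule.on quot_mod.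

Definition qclass (x : V) : quot_mod := \pi_({quot (sm_pred : zmodClosed V)}) x.
Definition qrepr (u : quot_mod) : V := repr u.

Lemma qreprK u : qclass (qrepr u) = u.
Proof. exact: reprK. Qed.

Lemma qclass_eqP x y : qclass x = qclass y <-> S (x - y).
Proof.
split=> [exy|Sxy].
  by apply/sm_predP; rewrite (idealrBE (sm_pred : zmodClosed V)); apply/eqP.
by apply/eqP; rewrite -(idealrBE (sm_pred : zmodClosed V)); apply/sm_predP.
Qed.

Lemma qclassD x y : qclass (x + y) = qclass x + qclass y.
Proof. exact: (pi_add (sm_pred : zmodClosed V)). Qed.

Lemma qreprB x : S (qrepr (qclass x) - x).
Proof. by apply/qclass_eqP/qreprK. Qed.

Definition qscale (a : R) (u : quot_mod) : quot_mod := qclass (a *: qrepr u).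

Lemma qclassZ_subproof a x : qscale a (qclass x) = qclass (a *: x).
Proof. by apply/qclass_eqP; rewrite -scalerBr; apply/smZ/qreprB. Qed.

Fact qscaleA a b u : qscale a (qscale b u) = qscale (a * b) u.
Proof. by rewrite -(qreprK u) !qclassZ_subproof scalerA. Qed.

Fact qscale1 : left_id 1 qscale.
Proof. by move=> u; rewrite -(qreprK u) qclassZ_subproof scale1r. Qed.

Fact qscaleDr : right_distributive qscale +%R.
Proof.
move=> a u v; rewrite -(qreprK u) -(qreprK v) -qclassD !qclassZ_subproof.
by rewrite -qclassD scalerDr.
Qed.

Fact qscaleDl u : {morph qscale^~ u : a b / a + b}.
Proof.
by move=> a b; rewrite -(qreprK u) !qclassZ_subproof -qclassD scalerDl.
Qed.

HB.instance Definition _ := GRing.Zmodule_isLmodule.Build R quot_mod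
  qscaleA qscale1 qscaleDr qscaleDl.

Fact qclass_linear : linear qclass.
Proof. by move=> a x y; rewrite qclassD -qclassZ_subproof. Qed.

HB.instance Definition _ := GRing.isLinear.Build R V quot_mod *:%R qclass
  qclass_linear.

End SubQuotientModules.

Section QuotientAlgebra.
Variables (k : fieldType) (A : kalgType k) (S : A -> Prop).

Inductive ideal_gen : A -> Prop :=
  | IdealGen a s b of S s : ideal_gen (a * s * b)
  | Ideal0 : ideal_gen 0
  | IdealD x y of ideal_gen x & ideal_gen y : ideal_gen (x + y).

Lemma ideal_genMl a x : ideal_gen x -> ideal_gen (a * x).
Proof.
elim=> [c s b Ss||y z _ IHy _ IHz]; last by rewrite mulrDr; apply: IdealD.
  by rewrite !mulrA; apply: IdealGen.
by rewrite mulr0; apply: Ideal0.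
Qed.

Lemma ideal_genMr a x : ideal_gen x -> ideal_gen (x * a).
Proof.
elim=> [c s b Ss||y z _ IHy _ IHz]; last by rewrite mulrDl; apply: IdealD.
  by rewrite -mulrA; apply: IdealGen.
by rewrite mul0r; apply: Ideal0.
Qed.

Definition ideal : submodule A^o := @Submodule A A^o ideal_gen Ideal0 IdealD ideal_genMl.

Definition quot_alg := quot_mod ideal.
HB.instance Definition _ := GRing.Zmodule.on quot_alg.

Definition qa_class (x : A) : quot_alg := @qclass A A^o ideal x.
Definition qa_repr (u : quot_alg) : A := qrepr u.

Lemma qa_reprK u : qa_class (qa_repr u) = u.
Proof. exact: qreprK. Qed.

Lemma qa_eqP x y : qa_class x = qa_class y <-> ideal_gen (x - y).
Proof. exact: (@qclass_eqP A A^o ideal). Qed.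

Lemma qa_classD x y : qa_class (x + y) = qa_class x + qa_class y.
Proof. exact: (@qclassD A A^o ideal). Qed.

Definition qa_mul (u v : quot_alg) : quot_alg := qa_class (qa_repr u * qa_repr v).

Lemma qa_classM_subproof x y : qa_mul (qa_class x) (qa_class y) = qa_class (x * y).
Proof.
apply/qa_eqP; set x' := qa_repr _; set y' := qa_repr _.
have -> : x' * y' - x * y = x' * (y' - y) + (x' - x) * y.
  by rewrite mulrBr mulrBl addrA subrK.
by apply: IdealD; [apply: ideal_genMl|apply: ideal_genMr]; apply/qa_eqP/qa_reprK.
Qed.

Fact qa_mulA : associative qa_mul.
Proof.
move=> u v w; rewrite -(qa_reprK u) -(qa_reprK v) -(qa_reprK w).
by rewrite !qa_classM_subproof mulrA.
Qed.

Fact qa_mul1 : left_id (qa_class 1) qa_mul.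
Proof. by move=> u; rewrite -(qa_reprK u) qa_classM_subproof mul1r. Qed.

Fact qa_mulr1 : right_id (qa_class 1) qa_mul.
Proof. by move=> u; rewrite -(qa_reprK u) qa_classM_subproof mulr1. Qed.

Fact qa_mulDl : left_distributive qa_mul +%R.
Proof.
move=> u v w; rewrite -(qa_reprK u) -(qa_reprK v) -(qa_reprK w).
by rewrite -qa_classD !qa_classM_subproof -qa_classD mulrDl.
Qed.

Fact qa_mulDr : right_distributive qa_mul +%R.
Proof.
move=> u v w; rewrite -(qa_reprK u) -(qa_reprK v) -(qa_reprK w).
by rewrite -qa_classD !qa_classM_subproof -qa_classD mulrDr.
Qed.

HB.instance Definition _ := GRing.Zmodule_isPzRing.Build quot_alg
  qa_mulA qa_mul1 qa_mulr1 qa_mulDl qa_mulDr.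

Lemma qa_classM x y : qa_class (x * y) = qa_class x * qa_class y.
Proof. by rewrite -qa_classM_subproof. Qed.

Fact qa_kin1 : qa_class (kin 1) = 1 :> quot_alg.
Proof. by rewrite kin1. Qed.

Fact qa_kinD c d : qa_class (kin (c + d)) = qa_class (kin c) + qa_class (kin d).
Proof. by rewrite kinD qa_classD. Qed.

Fact qa_kinM c d : qa_class (kin (c * d)) = qa_class (kin c) * qa_class (kin d).
Proof. by rewrite kinM qa_classM. Qed.

Fact qa_kinC c (u : quot_alg) : qa_class (kin c) * u = u * qa_class (kin c).
Proof. by rewrite -(qa_reprK u) -!qa_classM kinC. Qed.

HB.instance Definition _ := @PzRing_isKAlgebra.Build k quot_alg
  (fun c => qa_class (kin c)) qa_kin1 qa_kinD qa_kinM qa_kinC.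

End QuotientAlgebra.

Section RestrictionOfScalars.
Variables (k : fieldType) (A : kalgType k) (M : lmodType A).

Definition resk : Type := M.
HB.instance Definition _ := GRing.Zmodule.on resk.

Definition resk_scale (c : k) (m : resk) : resk := (kin c : A) *: (m : M).

Fact resk_scaleA c d m : resk_scale c (resk_scale d m) = resk_scale (c * d) m.
Proof. by rewrite /resk_scale scalerA kinM. Qed.

Fact resk_scale1 : left_id 1 resk_scale.
Proof. by move=> m; rewrite /resk_scale kin1 scale1r. Qed.

Fact resk_scaleDr : right_distributive resk_scale +%R.
Proof. by move=> c m n; rewrite /resk_scale scalerDr. Qed.

Fact resk_scaleDl m : {morph resk_scale^~ m : c d / c + d}.
Proof. by move=> c d; rewrite /resk_scale kinD scalerDl. Qed.

HB.instance Definition _ := GRing.Zmodule_isLmodule.Build k resk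
  resk_scaleA resk_scale1 resk_scaleDr resk_scaleDl.

End RestrictionOfScalars.

Section LinearExtension.
Variables (E : nzRingType) (B : choiceType) (V : lmodType E).
Implicit Types (f : B -> V) (x : malg B E).

Definition mlin f x : V := \sum_(b <- monalg.msupp x) monalg.mcoeff b x *: f b.

Lemma mlinEw (d : {fset B}) f x : fsubset (monalg.msupp x) d ->
  mlin f x = \sum_(b <- d) monalg.mcoeff b x *: f b.
Proof.
move=> sxd; rewrite /mlin (big_fset_incl _ sxd) // => b _ bx.
by rewrite (monalg.mcoeff_outdom bx) scale0r.
Qed.

Fact mlin_linear f : linear (mlin f).
Proof.
move=> a x y; set d := fsetU (monalg.msupp x) (monalg.msupp y).
have sx : fsubset (monalg.msupp x) d by apply: fsubsetUl.
have sy : fsubset (monalg.msupp y) d by apply: fsubsetUr.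
have sxy : fsubset (monalg.msupp (a *: x + y)) d.
  apply: fsubset_trans (monalg.msuppD_le _ _) _.
  by rewrite fsetSU // monalg.msuppZ_le.
rewrite (mlinEw _ sx) (mlinEw _ sy) (mlinEw _ sxy) scaler_sumr -big_split /=.
by apply: eq_bigr => b _; rewrite monalg.mcoeffD monalg.mcoeffZ scalerDl scalerA.
Qed.

HB.instance Definition _ f :=
  GRing.isLinear.Build E (malg B E) V *:%R (mlin f) (mlin_linear f).

Lemma mlinU f b : mlin f (mkmalgU b 1) = f b.
Proof.
by rewrite (@mlinEw [fset b]%fset) ?monalg.msuppU_le // big_seq_fset1 monalg.mcoeffUU scale1r.
Qed.

Lemma mlin_ext (g : {linear malg B E -> V}) x :
  g x = mlin (fun b => g (mkmalgU b 1)) x.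
Proof.
rewrite {1}[x]monalgE linear_sum; apply: eq_bigr => b _; rewrite -linearZ.
by congr (g _); apply/malgP => b'; rewrite monalg.mcoeffZ !monalg.mcoeffU mulr_natr.
Qed.

Lemma eq_mlin f f' x : f =1 f' -> mlin f x = mlin f' x.
Proof. by move=> eqf; apply: eq_bigr => b _; rewrite eqf. Qed.

End LinearExtension.

(* [lsg_op a b = None] stands for a product that is zero; the identity of the
   algebra spanned by the basis [B] is the sum of [lsg_units]. *)
Record semigroup_basis := SemigroupBasis {
  lsg_sort :> choiceType;
  lsg_op : lsg_sort -> lsg_sort -> option lsg_sort;
  lsg_units : seq lsg_sort;
  lsg_opA : forall a b c,
    obind (fun bc => lsg_op a bc) (lsg_op b c) = obind (fun ab => lsg_op ab c) (lsg_op a b);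
  lsg_unitl : forall b, pmap (fun u => lsg_op u b) lsg_units = [:: b];
  lsg_unitr : forall b, pmap (fun u => lsg_op b u) lsg_units = [:: b]
}.

Section SemigroupAlgebra.
Variables (k : fieldType) (B : semigroup_basis).

Definition salg := malg B k.
HB.instance Definition _ := GRing.Lmodule.on salg.

Definition sbase (b : B) : salg := mkmalgU b 1.
Definition sbaseo (o : option B) : salg := if o is Some b then sbase b else 0.

Definition salg_one : salg := \sum_(u <- lsg_units B) sbase u.
Definition salg_mul (x y : salg) : salg :=
  mlin (fun a => mlin (fun b => sbaseo (lsg_op a b)) y) x.

Fact salg_mul_linearl y : linear (salg_mul^~ y).
Proof. by move=> c x x'; rewrite /salg_mul (mlin_linear _ c x x'). Qed.

Fact salg_mul_linearr x : linear (salg_mul x).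
Proof.
have smE t : salg_mul x t = \sum_(a <- monalg.msupp x)
    monalg.mcoeff a x *: mlin (fun b => sbaseo (lsg_op a b)) t by [].
move=> c y y'; rewrite !smE scaler_sumr -big_split /=.
apply: eq_bigr => a _; rewrite (mlin_linear _ c y y') scalerDr !scalerA.
by rewrite [c * _]mulrC.
Qed.

Definition salg_mulr y x := salg_mul x y.
HB.instance Definition _ y :=
  GRing.isLinear.Build k salg salg *:%R (salg_mulr y) (salg_mul_linearl y).
HB.instance Definition _ x :=
  GRing.isLinear.Build k salg salg *:%R (salg_mul x) (salg_mul_linearr x).

Lemma salg_ind (K : salg -> Prop) :
    (forall b, K (sbase b)) -> (forall c x, K x -> K (c *: x)) -> K 0 ->
    (forall x y, K x -> K y -> K (x + y)) ->
  forall x, K x.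
Proof.
move=> Kb KZ K0 KD x; rewrite [x]monalgE; elim/big_ind: _ => // b _.
have -> : mkmalgU b (monalg.mcoeff b x) = monalg.mcoeff b x *: sbase b; last exact: KZ.
by apply/malgP => b'; rewrite monalg.mcoeffZ !monalg.mcoeffU mulr_natr.
Qed.

Lemma salg_mulU a b : salg_mul (sbase a) (sbase b) = sbaseo (lsg_op a b).
Proof. by rewrite /salg_mul !mlinU. Qed.

Fact salg_mulDl : left_distributive salg_mul +%R.
Proof. by move=> x y z; exact: (linearD (salg_mulr z)). Qed.

Fact salg_mulDr : right_distributive salg_mul +%R.
Proof. by move=> x y z; rewrite linearD. Qed.

Lemma salg_mulZl c x y : salg_mul (c *: x) y = c *: salg_mul x y.
Proof. exact: (linearZ_LR (salg_mulr y)). Qed.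

Lemma salg_mulZr c x y : salg_mul x (c *: y) = c *: salg_mul x y.
Proof. by rewrite linearZ. Qed.

Lemma salg_mul0l y : salg_mul 0 y = 0.
Proof. exact: (linear0 (salg_mulr y)). Qed.

Lemma salg_mul0r y : salg_mul y 0 = 0.
Proof. by rewrite linear0. Qed.

Fact salg_mulA : associative salg_mul.
Proof.
move=> x y z; move: x; apply: salg_ind.
- move=> a; move: y; apply: salg_ind.
  + move=> b; move: z; apply: salg_ind.
    * move=> c; rewrite !salg_mulU.
      have := lsg_opA a b c.
      case: (lsg_op b c) => [bc|]; case: (lsg_op a b) => [ab|] /=;
        rewrite ?salg_mul0l ?salg_mul0r ?salg_mulU //=;
        by [move=> ->|move=> <-].
    * by move=> c z IH; rewrite !salg_mulZr IH.
    * by rewrite !salg_mul0r.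
    * by move=> z z' IH IH'; rewrite !salg_mulDr IH IH'.
  + by move=> c y IH; rewrite !(salg_mulZr, salg_mulZl) IH.
  + by rewrite !(salg_mul0r, salg_mul0l).
  + by move=> y y' IH IH'; rewrite !(salg_mulDr, salg_mulDl) IH IH'.
- by move=> c x IH; rewrite !(salg_mulZr, salg_mulZl) IH.
- by rewrite !(salg_mul0r, salg_mul0l).
- by move=> y' y'' IH IH'; rewrite !(salg_mulDr, salg_mulDl) IH IH'.
Qed.

Lemma sum_sbaseo (F : B -> option B) (s : seq B) :
  \sum_(u <- s) sbaseo (F u) = \sum_(b <- pmap F s) sbase b.
Proof.
elim: s => [|u s IH] /=; first by rewrite !big_nil.
by rewrite big_cons IH; case: (F u) => [b|] /=; rewrite ?big_cons ?add0r.
Qed.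

Fact salg_mul1 : left_id salg_one salg_mul.
Proof.
apply: salg_ind.
- move=> b; rewrite [LHS](linear_sum (salg_mulr (sbase b))) /=.
  under eq_bigr do rewrite [salg_mulr _ _]salg_mulU.
  by rewrite (sum_sbaseo (fun u => lsg_op u b)) lsg_unitl big_seq1.
- by move=> c x IH; rewrite salg_mulZr IH.
- by rewrite salg_mul0r.
- by move=> x y IH IH'; rewrite salg_mulDr IH IH'.
Qed.

Fact salg_mulr1 : right_id salg_one salg_mul.
Proof.
apply: salg_ind.
- move=> b; rewrite linear_sum /=.
  under eq_bigr do rewrite salg_mulU.
  by rewrite (sum_sbaseo (fun u => lsg_op b u)) lsg_unitr big_seq1.
- by move=> c x IH; rewrite salg_mulZl IH.
- by rewrite salg_mul0l.
- by move=> x y IH IH'; rewrite salg_mulDl IH IH'.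
Qed.

HB.instance Definition _ := GRing.Zmodule_isPzRing.Build salg
  salg_mulA salg_mul1 salg_mulr1 salg_mulDl salg_mulDr.

Definition salg_kin (c : k) : salg := c *: (1 : salg).

Fact salg_kin1 : salg_kin 1 = 1.
Proof. exact: scale1r. Qed.

Fact salg_kinD c d : salg_kin (c + d) = salg_kin c + salg_kin d.
Proof. exact: scalerDl. Qed.

Lemma salg_kinE c (x : salg) : salg_kin c * x = c *: x.
Proof. by rewrite [LHS]salg_mulZl; congr (_ *: _); apply: mul1r. Qed.

Fact salg_kinM c d : salg_kin (c * d) = salg_kin c * salg_kin d.
Proof. by rewrite salg_kinE /salg_kin scalerA. Qed.

Fact salg_kinC c (x : salg) : salg_kin c * x = x * salg_kin c.
Proof. by rewrite salg_kinE [RHS]salg_mulZr; congr (_ *: _); apply/esym/mulr1. Qed.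

HB.instance Definition _ := @PzRing_isKAlgebra.Build k salg
  salg_kin salg_kin1 salg_kinD salg_kinM salg_kinC.

End SemigroupAlgebra.

Record quiver := Quiver {
  vertex : finType;
  arrow : choiceType;
  src : arrow -> vertex;
  tgt : arrow -> vertex
}.

Section Paths.
Variable Q : quiver.

(* [(v, [:: a_r; ...; a_1])] is the path a_r ... a_1 with source v, which
   traverses a_1 first: paths compose from right to left. *)
Definition ptgt (p : vertex Q * seq (arrow Q)) := if p.2 is a :: _ then tgt a else p.1.

Fixpoint composable (v : vertex Q) (s : seq (arrow Q)) : bool :=
  if s is a :: s' then (src a == ptgt (v, s')) && composable v s' else true.

Definition qpath := {p : vertex Q * seq (arrow Q) | composable p.1 p.2}.
HB.instance Definition _ := SubChoice.on qpath.

Lemma qpath_inj (p q : qpath) : sval p = sval q -> p = q.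
Proof. exact: val_inj. Qed.

Lemma composable_cat v s t : composable v t ->
  composable v (s ++ t) = composable (ptgt (v, t)) s.
Proof.
move=> ct; elim: s => //= a s ->; congr (_ && _).
by case: s.
Qed.

Definition pcomp (p q : qpath) : option qpath :=
  if (val p).1 == ptgt (val q) then (insub ((val q).1, (val p).2 ++ (val q).2) : option qpath)
  else None.

Definition vpath (v : vertex Q) : qpath := exist _ (v, [::]) isT.

Lemma ptgt_cat v s t : ptgt (v, s ++ t) = ptgt (ptgt (v, t), s).
Proof. by case: s. Qed.

Variant pcomp_spec (p q : qpath) : option qpath -> Type :=
  | PcompSome r of (val p).1 = ptgt (val q) & val r = ((val q).1, (val p).2 ++ (val q).2) :
      pcomp_spec p q (Some r)
  | PcompNone of (val p).1 != ptgt (val q) : pcomp_spec p q None.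

Lemma pcompP p q : pcomp_spec p q (pcomp p q).
Proof.
rewrite /pcomp; case: eqP => [e|/eqP ne]; last exact: PcompNone.
case: insubP => [r _ er|]; first exact: PcompSome.
case: p q e => [[u s] /= cs] [[v t] /= ct] e.
by rewrite composable_cat // -e cs.
Qed.

Fact pcompA (p q r : qpath) :
  obind (fun qr => pcomp p qr) (pcomp q r) = obind (fun pq => pcomp pq r) (pcomp p q).
Proof.
have tgt_comp (x y z : qpath) :
    (val x).1 = ptgt (val y) -> val z = ((val y).1, (val x).2 ++ (val y).2) ->
    ptgt (val z) = ptgt (val x).
  move=> e ->; rewrite ptgt_cat; have -> : ((val y).1, (val y).2) = val y by case: (val y).
  by rewrite -e; case: (val x).
case: (pcompP q r) => [qr eqr vqr|nqr]; case: (pcompP p q) => [pq epq vpq|npq] //=.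
- case: pcompP => [x ex vx|/negP[]]; last by rewrite (tgt_comp _ _ _ eqr vqr) epq.
  case: pcompP => [y ey vy|/negP[]]; last by rewrite vpq eqr.
  by congr Some; apply: qpath_inj; rewrite vx vy vqr vpq /= catA.
- by case: pcompP => // x; rewrite (tgt_comp _ _ _ eqr vqr) => e; case/eqP: npq.
- by case: pcompP => // x; rewrite vpq => e; case/eqP: nqr.
Qed.

Lemma pmap_enum_pick (T : finType) (U V : Type) (g : T -> V) (F : V -> option U)
    (t : T) (u : U) :
  (forall v, F (g v) = if v == t then Some u else None) ->
  pmap F [seq g v | v <- enum T] = [:: u].
Proof.
move=> E; have -> s : pmap F [seq g v | v <- s] = nseq (count_mem t s) u.
  by elim: s => //= v s ->; rewrite E; case: eqP.
by rewrite count_uniq_mem ?enum_uniq // mem_enum.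
Qed.

Fact pcomp_unitl (p : qpath) :
  pmap (fun u => pcomp u p) [seq vpath v | v <- enum (vertex Q)] = [:: p].
Proof.
apply: (@pmap_enum_pick _ _ _ _ _ (ptgt (val p))) => v.
case: pcompP => /= [r -> er|/negbTE -> //]; rewrite eqxx; congr Some.
by apply/qpath_inj; rewrite er -surjective_pairing.
Qed.

Fact pcomp_unitr (p : qpath) :
  pmap (fun u => pcomp p u) [seq vpath v | v <- enum (vertex Q)] = [:: p].
Proof.
apply: (@pmap_enum_pick _ _ _ _ _ (val p).1) => v.
case: pcompP => /= [r e er|]; last by rewrite /ptgt /= eq_sym => /negbTE ->.
rewrite e /ptgt /= eqxx; congr Some.
by apply/qpath_inj; rewrite er /= cats0 -(e : (val p).1 = v) -surjective_pairing.
Qed.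

Definition path_basis := SemigroupBasis pcompA pcomp_unitl pcomp_unitr.

Fact apath_subproof (a : arrow Q) : composable (src a) [:: a].
Proof. by rewrite /= eqxx. Qed.

Definition apath (a : arrow Q) : qpath := exist _ (src a, [:: a]) (apath_subproof a).

End Paths.

Definition path_alg (k : fieldType) (Q : quiver) := salg k (path_basis Q).
HB.instance Definition _ k Q := KAlgebra.on (path_alg k Q).

Definition arr (k : fieldType) (Q : quiver) (a : arrow Q) : path_alg k Q :=
  sbase k (apath a : path_basis Q).

Section TensorProduct.
Variables (k : fieldType) (R S : kalgType k).

Definition pmul (x y : R * S) : option (R * S)%type := Some (x.1 * y.1, x.2 * y.2).

Fact pmulA (a b c : R * S) :
  obind (fun bc => pmul a bc) (pmul b c) = obind (fun ab => pmul ab c) (pmul a b).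
Proof. by rewrite /pmul /= !mulrA. Qed.

Fact pmul_unitl (b : R * S) : pmap (fun u => pmul u b) [:: (1, 1)] = [:: b].
Proof. by case: b => r s; rewrite /= !mul1r. Qed.

Fact pmul_unitr (b : R * S) : pmap (fun u => pmul b u) [:: (1, 1)] = [:: b].
Proof. by case: b => r s; rewrite /= !mulr1. Qed.

Definition pair_basis := @SemigroupBasis (R * S)%type pmul [:: (1, 1)] pmulA pmul_unitl pmul_unitr.

Definition pure (r : R) (s : S) : salg k pair_basis := sbase k ((r, s) : pair_basis).

Inductive bilinear_rel : salg k pair_basis -> Prop :=
  | BilinDl r r' s : bilinear_rel (pure (r + r') s - (pure r s + pure r' s))
  | BilinDr r s s' : bilinear_rel (pure r (s + s') - (pure r s + pure r s'))
  | BilinZl c r s : bilinear_rel (pure (c *k: r) s - c *k: pure r s)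
  | BilinZr c r s : bilinear_rel (pure r (c *k: s) - c *k: pure r s).

(* The vector space R (x) S is the quotient of the free one on [R * S] by the
   span of the bilinearity relations; multiplying such a relation by a pair
   gives again such a relation, so that this span is a two-sided ideal. *)
Definition tensor := quot_alg bilinear_rel.
HB.instance Definition _ := KAlgebra.on tensor.

Definition tens (r : R) (s : S) : tensor := qa_class bilinear_rel (pure r s).

End TensorProduct.

Definition enveloping (k : fieldType) (R : kalgType k) := tensor R R^c.
HB.instance Definition _ k (R : kalgType k) := KAlgebra.on (enveloping R).

Section RegularBimodule.
Variables (k : fieldType) (R : kalgType k).
Local Notation P := (salg k (pair_basis R R^c)).

Definition bact (t : P) (x : R) : R :=
  @mlin k (R * R^c)%type (resk R^o) (fun p => (p.1 : R) * x * (p.2 : R)) t.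

Lemma bact_pure r s x : bact (pure r s) x = r * x * (s : R).
Proof. exact: (@mlinU k (R * R^c)%type (resk R^o) _ (r, s)). Qed.

Lemma bactD t t' x : bact (t + t') x = bact t x + bact t' x.
Proof. by rewrite -[t]scale1r [LHS]mlin_linear !scale1r. Qed.

Lemma bact0 x : bact 0 x = 0.
Proof. by apply: (addrI (bact 0 x)); rewrite -bactD !addr0. Qed.

Lemma bactZ c t x : bact (c *: t) x = kin c * bact t x.
Proof. by rewrite -[c *: t]addr0 [LHS]mlin_linear -/(bact 0 x) bact0 addr0. Qed.

Lemma bactN t x : bact (- t) x = - bact t x.
Proof. by apply: (addrI (bact t x)); rewrite -bactD !subrr bact0. Qed.

Lemma bactDr t x y : bact t (x + y) = bact t x + bact t y.
Proof.
move: t; apply: salg_ind.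
- by case=> r s; rewrite !bact_pure mulrDr mulrDl.
- by move=> c t IH; rewrite !bactZ IH mulrDr.
- by rewrite !bact0 addr0.
- by move=> t t' IH IH'; rewrite !bactD IH IH' addrACA.
Qed.

Lemma bact0r t : bact t 0 = 0.
Proof. by apply: (addrI (bact t 0)); rewrite -bactDr !addr0. Qed.

Lemma bactZr c t x : bact t (kin c * x) = kin c * bact t x.
Proof.
move: t; apply: salg_ind.
- by case=> r s; rewrite !bact_pure !mulrA (kinC c r).
- by move=> d t IH; rewrite !bactZ IH !mulrA (kinC d (kin c)).
- by rewrite !bact0 mulr0.
- by move=> t t' IH IH'; rewrite !bactD IH IH' mulrDr.
Qed.

Lemma bactM t t' x : bact (t * t') x = bact t (bact t' x).
Proof.
move: t; apply: salg_ind.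
- move=> [r s]; move: t'; apply: salg_ind.
  + move=> [r' s']; rewrite [_ * _]salg_mulU.
    by rewrite [sbaseo _ _]/(pure (r * r') (s * s')) !bact_pure !mulrA.
  + by move=> c t IH; rewrite [_ * _]salg_mulZr !bactZ bactZr IH.
  + by rewrite mulr0 !bact0 bact0r.
  + by move=> t t' IH IH'; rewrite mulrDr !bactD bactDr IH IH'.
- by move=> c t IH; rewrite [_ * _]salg_mulZl !bactZ IH.
- by rewrite mul0r !bact0.
- by move=> t1 t2 IH IH'; rewrite mulrDl !bactD IH IH'.
Qed.

Lemma bact1 x : bact 1 x = x.
Proof. by rewrite [1]big_seq1 bact_pure mul1r mulr1. Qed.

Lemma bact_kin c t x : bact (c *k: t) x = kin c * bact t x.
Proof. by rewrite [_ * t]salg_kinE bactZ. Qed.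

Lemma bact_ideal t x : ideal_gen (@bilinear_rel k R R^c) t -> bact t x = 0.
Proof.
move=> I; elim: I x => {t}[a s b rs||t t' _ IH _ IH'] x; last 2 first.
- by rewrite bact0.
- by rewrite bactD IH IH' addr0.
rewrite !bactM; move: (bact b x) => y; suff -> : bact s y = 0 by rewrite bact0r.
case: rs => [r r' z|r z z'|c r z|c r z];
  rewrite bactD bactN ?bactD ?bact_kin !bact_pure; apply/eqP; rewrite subr_eq0; apply/eqP.
- by rewrite !mulrDl.
- by rewrite mulrDr.
- by rewrite !mulrA.
- by rewrite [RHS]kinC -!mulrA; congr (_ * (_ * _)).
Qed.

Definition bimod : Type := R.
HB.instance Definition _ := GRing.Zmodule.on bimod.

Definition bscale (u : enveloping R) (x : bimod) : bimod := bact (qa_repr u) x.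

Lemma bscale_class t x : bscale (qa_class _ t) x = bact t x.
Proof.
apply/eqP; rewrite -subr_eq0 -bactN -bactD; apply/eqP/bact_ideal.
by apply/qa_eqP/qa_reprK.
Qed.

Lemma bscale_tens r s x : bscale (tens r s) x = r * x * (s : R).
Proof. by rewrite bscale_class bact_pure. Qed.

Fact bscaleA u v x : bscale u (bscale v x) = bscale (u * v) x.
Proof. by rewrite -(qa_reprK u) -(qa_reprK v) -qa_classM !bscale_class bactM. Qed.

Fact bscale1 : left_id 1 bscale.
Proof. by move=> x; rewrite [1]/(qa_class _ 1) bscale_class bact1. Qed.

Fact bscaleDr : right_distributive bscale +%R.
Proof. by move=> u x y; apply: bactDr. Qed.

Fact bscaleDl x : {morph bscale^~ x : u v / u + v}.
Proof.
by move=> u v; rewrite -(qa_reprK u) -(qa_reprK v) -qa_classD !bscale_class bactD.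
Qed.

HB.instance Definition _ := GRing.Zmodule_isLmodule.Build (enveloping R) bimod
  bscaleA bscale1 bscaleDr bscaleDl.

End RegularBimodule.

Definition projective (E : pzRingType) (P : lmodType E) : Prop :=
  forall (A B : lmodType E) (f : {linear A -> B}) (g : {linear P -> B}),
    (forall b, exists a, f a = b) ->
  exists h : {linear P -> A}, forall x, f (h x) = g x.

Record proj_resolution (E : pzRingType) (M : lmodType E) := ProjResolution {
  res :> nat -> lmodType E;
  res_d : forall n, {linear res n.+1 -> res n};
  res_aug : {linear res 0 -> M};
  res_proj : forall n, projective (res n);
  res_aug_surj : forall m, exists x, res_aug x = m;
  res_aug_exact : forall x, res_aug x = 0 <-> exists y, res_d 0 y = x;
  res_exact : forall n x, res_d n x = 0 <-> exists y, res_d n.+1 y = x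
}.

Section Ext.
Variables (k : fieldType) (E : kalgType k) (M : lmodType E) (P : proj_resolution M).
Variable N : lmodType E.

(* Cochains of degree i are the E-linear maps P_i -> N. *)
Definition is_cocycle i (f : P i -> resk N) : Prop :=
  linear (f : P i -> N) /\ forall x, f (res_d P i x) = 0.

Definition is_coboundary i : (P i -> resk N) -> Prop :=
  match i with
  | 0 => fun f => f = 0
  | j.+1 => fun f => exists2 h : P j -> N, linear h & forall x, f x = h (res_d P j x)
  end.

Lemma hom0 (U : lmodType E) : linear (0 : U -> resk N).
Proof. by move=> a x y; rewrite [RHS]addr0 [RHS](@scaler0 E N). Qed.

Lemma homD (U : lmodType E) (f g : U -> resk N) :
  linear (f : U -> N) -> linear (g : U -> N) -> linear (f + g : U -> N).
Proof.
move=> lf lg a x y; have : (a *: (f x : N) + f y) + (a *: (g x : N) + g y)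
  = a *: ((f x : N) + g x) + ((f y : N) + g y) by rewrite scalerDr addrACA.
by rewrite -lf -lg.
Qed.

Lemma homZ (U : lmodType E) c (f : U -> resk N) :
  linear (f : U -> N) -> linear (c *: f : U -> N).
Proof.
move=> lf a x y; have : (kin c : E) *: (a *: (f x : N) + f y)
  = a *: ((kin c : E) *: (f x : N)) + (kin c : E) *: (f y : N).
  by rewrite scalerDr !scalerA kinC.
by rewrite -lf.
Qed.

Fact is_cocycle0 i : @is_cocycle i 0.
Proof. by split=> //; apply: hom0. Qed.

Fact is_cocycleD i f g : @is_cocycle i f -> @is_cocycle i g -> is_cocycle (f + g).
Proof.
move=> [lf df] [lg dg]; split=> [|x]; first exact: homD.
by rewrite fctE df dg addr0.
Qed.

Fact is_cocycleZ i c f : @is_cocycle i f -> is_cocycle (c *: f).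
Proof.
move=> [lf df]; split=> [|x]; first exact: homZ.
by rewrite fctE df scaler0.
Qed.

Definition cocycle i : submodule (P i -> resk N) :=
  Submodule (@is_cocycle0 i) (@is_cocycleD i) (@is_cocycleZ i).

Definition cocycles i := submod_of (cocycle i).
HB.instance Definition _ i := GRing.Lmodule.on (cocycles i).

Fact is_coboundary0 i : @is_coboundary i 0.
Proof. by case: i => [//|i]; exists (0 : P i -> resk N) => //; apply: hom0. Qed.

Fact is_coboundaryD i f g :
  @is_coboundary i f -> @is_coboundary i g -> is_coboundary (f + g).
Proof.
case: i f g => [f g -> -> /=|i f g [h lh fE] [h' lh' gE]]; first by rewrite addr0.
exists ((h : P i -> resk N) + (h' : P i -> resk N)) => [|x]; first exact: homD.
by rewrite fctE fE gE.
Qed.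

Fact is_coboundaryZ i c f : @is_coboundary i f -> is_coboundary (c *: f).
Proof.
case: i f => [f -> /=|i f [h lh fE]]; first by rewrite scaler0.
exists (c *: (h : P i -> resk N)) => [|x]; first exact: homZ.
by rewrite fctE fE.
Qed.

Definition coboundary i : submodule (cocycles i) :=
  @Submodule k (cocycles i) (fun f => is_coboundary (val f))
    (@is_coboundary0 i)
    (fun f g => @is_coboundaryD i (val f) (val g))
    (fun c f => @is_coboundaryZ i c (val f)).

Definition Ext i := quot_mod (coboundary i).
HB.instance Definition _ i := GRing.Lmodule.on (Ext i).

Definition mk_cocycle i (f : P i -> N) (lf : linear f)
    (df : forall x, f (res_d P i x) = 0) : cocycles i :=
  exist _ (f : P i -> resk N) (introT (sm_predP (cocycle i) f) (conj lf df)).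

Definition ext_class i (f : cocycles i) : Ext i := qclass (coboundary i) f.
Definition ext_repr i (u : Ext i) : cocycles i := qrepr u.

Lemma cocycle_linear i (f : cocycles i) : linear (val f : P i -> N).
Proof. by case: f => f /= /sm_predP[]. Qed.

Lemma cocycle_d i (f : cocycles i) x : val f (res_d P i x) = 0.
Proof. by case: f => f /= /sm_predP[]. Qed.

End Ext.

Section ProjectiveLifting.
Variables (E : pzRingType) (P A B : lmodType E).
Variables (f : {linear A -> B}) (g : {linear P -> B}).
Hypothesis P_proj : projective P.
Hypothesis fg : forall x, exists a, f a = g x.

Let im (b : B) := exists a, f a = b.

Let im0 : im 0. Proof. by exists 0; rewrite linear0. Qed.

Let imD x y : im x -> im y -> im (x + y).
Proof. by move=> [a <-] [b <-]; exists (a + b); rewrite linearD. Qed.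

Let imZ c x : im x -> im (c *: x).
Proof. by move=> [a <-]; exists (c *: a); rewrite linearZ. Qed.

Let I := Submodule im0 imD imZ.

Let f' (a : A) : submod_of I :=
  exist _ (f a) (introT (sm_predP I (f a)) (ex_intro _ a erefl)).
Let g' (x : P) : submod_of I := exist _ (g x) (introT (sm_predP I (g x)) (fg x)).

Let f'_linear : linear f'.
Proof. by move=> c x y; apply: val_inj; apply: (linearP f). Qed.

Let g'_linear : linear g'.
Proof. by move=> c x y; apply: val_inj; apply: (linearP g). Qed.

Lemma projective_lift : exists h : {linear P -> A}, forall x, f (h x) = g x.
Proof.
pose f1 : {linear A -> submod_of I} :=
  HB.pack f' (GRing.isLinear.Build E A (submod_of I) *:%R f' f'_linear).
pose g1 : {linear P -> submod_of I} :=
  HB.pack g' (GRing.isLinear.Build E P (submod_of I) *:%R g' g'_linear).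
have [|h hE] := P_proj (f := f1) g1; last by exists h => x; have /(congr1 val) := hE x.
by case=> b Ib; have /sm_predP[a ab] := Ib; exists a; apply: val_inj.
Qed.

End ProjectiveLifting.

Section YonedaProduct.
Variables (k : fieldType) (E : kalgType k) (M : lmodType E) (P : proj_resolution M).
Local Notation d := (res_d P).
Local Notation aug := (res_aug P).

Lemma res_dd n x : d n (d n.+1 x) = 0.
Proof. by apply/res_exact; exists x. Qed.

Lemma res_aug_d x : aug (d 0 x) = 0.
Proof. by apply/res_aug_exact; exists x. Qed.

Record lifting j (g : P j -> M) := Lifting {
  lf : forall n, {linear P (n + j)%N -> P n};
  lf_aug : forall x, aug (lf 0 x) = g x;
  lf_d : forall n x, d n (lf n.+1 x) = lf n (d (n + j) x)
}.

Section LiftingExists.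
Variables (j : nat) (g : {linear P j -> M}).
Hypothesis gd : forall x, g (d j x) = 0.

Let good n := {p : {linear P (n + j)%N -> P n} | forall y, exists x, d n x = p (d (n + j) y)}.

Let good0 : {p : good 0 | forall x, aug (sval p x) = g x}.
Proof.
have [h hE] := cid (projective_lift (f := aug) (g := g) (@res_proj _ _ P j)
  (fun x => res_aug_surj P (g x))).
have hgood y : exists x, d 0 x = h (d (0 + j) y).
  by apply/res_aug_exact; rewrite hE gd.
by exists (exist _ h hgood).
Qed.

Let goodS n (p : good n) :
  {q : good n.+1 | forall x, d n (sval q x) = sval p (d (n + j) x)}.
Proof.
case: p => p pgood /=.
have [h hE] := cid (projective_lift (f := d n) (g := p \o d (n + j))
  (@res_proj _ _ P (n.+1 + j)) pgood).
have hgood y : exists x, d n.+1 x = h (d (n.+1 + j) y).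
  by apply/res_exact; rewrite hE /= res_dd linear0.
by exists (exist _ h hgood).
Qed.

Let Fixpoint goods n : good n :=
  if n is m.+1 return good n then sval (goodS (goods m)) else sval good0.

Lemma some_lifting : lifting g.
Proof.
exists (fun n => sval (goods n)) => [x|n x].
  exact: (svalP good0).
exact: (svalP (goodS (goods n))).
Qed.

End LiftingExists.

Section NullHomotopy.
Variables (j : nat) (p : forall n, {linear P (n + j)%N -> P n}) (r : {linear P j -> P 0%N}).
Hypothesis pd : forall n x, d n (p n.+1 x) = p n (d (n + j) x).
Hypothesis pr : forall x, aug (p 0 x) = aug (r x).
Hypothesis rd : forall x, r (d j x) = 0.

Let good n := {s : {linear P (n + j)%N -> P n.+1} |
  forall y, d n (s (d (n + j) y)) = p n (d (n + j) y)}.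

Let good0 : {s : good 0 | forall x, d 0 (sval s x) = p 0 x - r x}.
Proof.
have ex x : exists y, d 0 y = (p 0 \- r) x.
  by apply/res_aug_exact; rewrite linearB /= pr subrr.
have [h hE] := cid (projective_lift (f := d 0) (g := p 0 \- r) (@res_proj _ _ P j) ex).
have hgood y : d 0 (h (d (0 + j) y)) = p 0 (d (0 + j) y) by rewrite hE /= rd subr0.
by exists (exist _ h hgood).
Qed.

Let goodS n (s : good n) :
  {t : good n.+1 | forall x, d n.+1 (sval t x) = p n.+1 x - sval s (d (n + j) x)}.
Proof.
case: s => s sgood /=.
have ex x : exists y, d n.+1 y = (p n.+1 \- (s \o d (n + j))) x.
  by apply/res_exact; rewrite linearB /= pd sgood subrr.
have [h hE] := cid (projective_lift (f := d n.+1) (g := p n.+1 \- (s \o d (n + j)))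
  (@res_proj _ _ P (n.+1 + j)) ex).
have hgood y : d n.+1 (h (d (n.+1 + j) y)) = p n.+1 (d (n.+1 + j) y).
  by rewrite hE /= res_dd linear0 subr0.
by exists (exist _ h hgood).
Qed.

Let Fixpoint goods n : good n :=
  if n is m.+1 return good n then sval (goodS (goods m)) else sval good0.

Lemma null_homotopy : exists s : forall n, {linear P (n + j)%N -> P n.+1},
  (forall x, p 0 x = d 0 (s 0 x) + r x) /\
  (forall n x, p n.+1 x = d n.+1 (s n.+1 x) + s n (d (n + j) x)).
Proof.
exists (fun n => sval (goods n)); split=> [x|n x].
  by rewrite (svalP good0) subrK.
by rewrite (svalP (goodS (goods n))) subrK.
Qed.

End NullHomotopy.

Variable N : lmodType E.

Definition hom_of_cocycle (L : lmodType E) j (g : cocycles P L j) : {linear P j -> L} :=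
  HB.pack (val g : P j -> L)
    (GRing.isLinear.Build E (P j) L *:%R (val g : P j -> L) (cocycle_linear g)).

Definition lifting_of j (g : cocycles P M j) : lifting (val g : P j -> M) :=
  some_lifting (g := hom_of_cocycle g) (cocycle_d g).

Section Composite.
Variables (i j : nat) (f : cocycles P N i) (g : P j -> M) (p : lifting g).

Fact comp_linear : linear (fun x => (val f (lf p i x) : N)).
Proof. by move=> a x y; rewrite linearP [val f _]cocycle_linear. Qed.

Fact comp_d x : val f (lf p i (d (i + j) x)) = 0.
Proof. by rewrite -lf_d cocycle_d. Qed.

Definition comp_lifting : cocycles P N (i + j) := mk_cocycle comp_linear comp_d.

End Composite.

(* The product of the classes of f : P_i -> N and g : P_j -> M is the class of
   f \o p_i, where the chain map p : P_(n + j) -> P_n lifts g. *)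
Definition yoneda i j (u : Ext P N i) (v : Ext P M j) : Ext P N (i + j) :=
  ext_class (comp_lifting (ext_repr u) (lifting_of (ext_repr v))).

Lemma ext_classP (L : lmodType E) i (f g : cocycles P L i) :
  ext_class f = ext_class g <-> is_coboundary (val f - val g).
Proof. exact: (qclass_eqP (coboundary P L i)). Qed.

Lemma is_coboundaryN (L : lmodType E) i (f : P i -> resk L) :
  is_coboundary f -> is_coboundary (- f).
Proof. by rewrite -scaleN1r; apply: is_coboundaryZ. Qed.

Lemma comp_liftingP i j (f : cocycles P N i) (g g' : cocycles P M j)
    (p : lifting (val g : P j -> M)) (p' : lifting (val g' : P j -> M)) :
    ext_class g = ext_class g' ->
  ext_class (comp_lifting f p) = ext_class (comp_lifting f p').
Proof.
move=> /ext_classP gg'; apply/ext_classP.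
have [r [rd rE rcob]] : exists r : {linear P j -> P 0%N}, [/\
    forall x, r (d j x) = 0, forall x, aug (r x) = val g x - val g' x
  & forall f' : {linear P 0 -> N}, @is_coboundary _ _ _ P N j (f' \o r)].
  case: j g g' p p' gg' => [|j] g g' p p' /=.
    move=> e; exists \0; split=> // [x|f'].
      by rewrite linear0; apply/esym; apply: (congr1 (fun h : P 0 -> resk M => h x) e).
    by apply: funext => x /=; rewrite linear0.
  move=> [h lh hE].
  pose h1 : {linear P j -> M} := HB.pack h (GRing.isLinear.Build E (P j) M *:%R h lh).
  have [t tE] := projective_lift (f := aug) (g := h1) (@res_proj _ _ P j)
    (fun x => res_aug_surj P (h x)).
  exists (t \o d j); split=> [x|x|f'] /=; first by rewrite res_dd linear0.
    by rewrite tE; apply/esym; apply: hE.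
  by exists (f' \o t) => [|x //]; apply: linearP.
have [||//|s [s0 sS]] := null_homotopy (p := fun n => lf p n \- lf p' n) (r := r).
- by move=> n x; rewrite /= linearB !lf_d.
- by move=> x; rewrite /= linearB !lf_aug rE.
case: i f => [|i] f.
  have := rcob (hom_of_cocycle f); congr (@is_coboundary _ _ _ P N j _).
  apply: funext => x /=; rewrite !fctE /=.
  rewrite -[RHS](linearB (hom_of_cocycle f)) [X in _ = _ X]s0.
  by rewrite linearD [X in _ = X + _]cocycle_d add0r.
exists (hom_of_cocycle f \o s i) => [|x]; first exact: linearP.
rewrite !fctE /= -[LHS](linearB (hom_of_cocycle f)) [X in _ X = _]sS.
by rewrite linearD [X in X + _ = _]cocycle_d add0r.
Qed.

Lemma yonedaE i j (f : cocycles P N i) (g : cocycles P M j)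
    (p : lifting (val g : P j -> M)) :
  yoneda (ext_class f) (ext_class g) = ext_class (comp_lifting f p).
Proof.
rewrite /yoneda; set f' := ext_repr (ext_class f); set g' := ext_repr (ext_class g).
have -> : ext_class (comp_lifting f p) = ext_class (comp_lifting f (lifting_of g')).
  by apply: comp_liftingP; rewrite [RHS]qreprK.
have /ext_classP : ext_class f' = ext_class f by apply: qreprK.
move=> ff'; apply/ext_classP; case: i f @f' ff' => [|i] f f' /=.
  move=> e; suff -> : val (comp_lifting f' (lifting_of g')) - val (comp_lifting f (lifting_of g')) = 0.
    exact: is_coboundary0.
  by apply: funext => x; apply: (congr1 (fun h : P 0 -> resk N => h (lf (lifting_of g') 0 x)) e).
move=> [h lh hE].
pose h1 : {linear P i -> N} := HB.pack h (GRing.isLinear.Build E (P i) N *:%R h lh).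
exists (h1 \o lf (lifting_of g') i) => [|x]; first exact: linearP.
by rewrite /= -lf_d; apply: (hE (lf (lifting_of g') i.+1 x)).
Qed.

End YonedaProduct.

Section FreeModule.
Variables (E : pzRingType) (B : choiceType).

Definition finsupp (x : B -> E^o) := exists s : seq B, forall b, b \notin s -> x b = 0.

Fact finsupp0 : finsupp 0. Proof. by exists [::]. Qed.

Fact finsuppD x y : finsupp x -> finsupp y -> finsupp (x + y).
Proof.
move=> [s sx] [t ty]; exists (s ++ t) => b; rewrite mem_cat negb_or => /andP[bs bt].
by rewrite fctE sx // ty // addr0.
Qed.

Fact finsuppZ a x : finsupp x -> finsupp (a *: x).
Proof. by move=> [s sx]; exists s => b bs; rewrite fctE sx // scaler0. Qed.

Definition free_mod := submod_of (Submodule finsupp0 finsuppD finsuppZ).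
HB.instance Definition _ := GRing.Lmodule.on free_mod.

Lemma free_modP (x : free_mod) : finsupp (val x).
Proof. by case: x => x /= /sm_predP. Qed.

Fact delta_finsupp b : finsupp (fun b' => (b' == b)%:R).
Proof. by exists [:: b] => b'; rewrite inE => /negbTE ->. Qed.

Definition delta b : free_mod :=
  exist _ (fun b' => (b' == b)%:R : E^o)
    (introT (sm_predP (Submodule finsupp0 finsuppD finsuppZ) _) (delta_finsupp b)).

Variables (V : lmodType E) (f : B -> V).

Definition free_ext (x : free_mod) : V :=
  \sum_(b <- undup (sval (cid (free_modP x)))) (val x b : E) *: f b.

Lemma free_extE s (x : free_mod) : uniq s -> (forall b, b \notin s -> val x b = 0) ->
  free_ext x = \sum_(b <- s) (val x b : E) *: f b.
Proof.
move=> us xs; rewrite /free_ext; case: cid => t /= xt.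
rewrite (bigID (mem s)) /= [X in _ + X]big1 ?addr0 => [|b /xs ->]; last by rewrite scale0r.
rewrite [RHS](bigID (mem t)) /= [X in _ = _ + X]big1 ?addr0 => [|b /xt ->]; last by rewrite scale0r.
rewrite -big_filter -[RHS]big_filter; apply: perm_big.
apply: uniq_perm => [||b]; rewrite ?filter_uniq ?undup_uniq //.
by rewrite !mem_filter mem_undup /= andbC.
Qed.

Lemma free_ext_delta b : free_ext (delta b) = f b.
Proof.
rewrite (@free_extE [:: b]) // => [|b'].
  by rewrite big_seq1 /= eqxx scale1r.
by rewrite inE /= => /negbTE ->.
Qed.

Fact free_ext_linear : linear free_ext.
Proof.
move=> a x y; have [s sx] := free_modP x; have [t ty] := free_modP y.
pose u := undup (s ++ t).
have uP b : b \notin u -> val x b = 0 /\ val y b = 0.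
  by rewrite mem_undup mem_cat negb_or => /andP[/sx -> /ty ->].
rewrite !(@free_extE u) ?undup_uniq // => [|b /uP[]//|b /uP[]//|b /uP[xb yb]].
  rewrite scaler_sumr -big_split; apply: eq_bigr => b _ /=.
  by rewrite !fctE scalerDl scalerA.
by rewrite /= !fctE xb yb scaler0 addr0.
Qed.

HB.instance Definition _ := GRing.isLinear.Build E free_mod V *:%R free_ext free_ext_linear.

End FreeModule.

Section FreeModuleProjective.
Variables (E : pzRingType) (B : choiceType).

Lemma val_free_sum (r : seq B) (F : B -> free_mod E B) b :
  val (\sum_(i <- r) F i) b = \sum_(i <- r) val (F i) b.
Proof.
elim: r => [|i r IH]; first by rewrite !big_nil.
by rewrite !big_cons -IH.
Qed.

Lemma val_freeZ a (x : free_mod E B) b : val (a *: x) b = a *: val x b.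
Proof. by []. Qed.

Lemma free_mod_sum (x : free_mod E B) :
  x = free_ext (@delta E B) x.
Proof.
have [s sx] := free_modP x.
have xs b : b \notin undup s -> val x b = 0 by rewrite mem_undup; apply: sx.
rewrite (free_extE (delta E (B:=B)) (undup_uniq s) xs); apply: val_inj.
apply: funext => b; rewrite [RHS]val_free_sum.
have [bs|bs] := boolP (b \in undup s); last first.
  rewrite xs // big_seq big1 // => b' b's; rewrite val_freeZ /=.
  by case: eqP bs => [->|_ _]; [rewrite b's | rewrite scaler0].
rewrite (bigD1_seq b) ?undup_uniq //= big1 ?addr0 => [|b' nb]; rewrite fctE.
  by rewrite eqxx [RHS]mulr1.
by rewrite eq_sym (negbTE nb) scaler0.
Qed.

Lemma free_mod_projective : projective (free_mod E B).
Proof.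
move=> X Y f g fsurj.
pose l b := sval (cid (fsurj (g (delta E b)))).
exists (free_ext l) => x.
have [s sx] := free_modP x.
have xs b : b \notin undup s -> val x b = 0 by rewrite mem_undup; apply: sx.
rewrite [in RHS](free_mod_sum x) /= (free_extE l (undup_uniq s) xs).
rewrite (free_extE (delta E (B:=B)) (undup_uniq s) xs) !linear_sum.
by apply: eq_bigr => b _; rewrite !linearZ /l; case: cid => a /= ->.
Qed.

End FreeModuleProjective.

Section FreeResolution.
Variables (E : pzRingType) (M : lmodType E).

Fact kernelD (U L : lmodType E) (f : {linear U -> L}) x y :
  f x = 0 -> f y = 0 -> f (x + y) = 0.
Proof. by rewrite linearD => -> ->; rewrite addr0. Qed.

Fact kernelZ (U L : lmodType E) (f : {linear U -> L}) a x : f x = 0 -> f (a *: x) = 0.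
Proof. by rewrite linearZ /= => ->; rewrite scaler0. Qed.

Definition kernel (U L : lmodType E) (f : {linear U -> L}) : submodule U :=
  @Submodule E U (fun x => f x = 0) (linear0 f) (kernelD (f := f)) (kernelZ (f := f)).

Fixpoint syzygy n : lmodType E :=
  if n is m.+1 then submod_of (kernel (free_ext (@id (syzygy m)))) else M.

Definition free_res n : lmodType E := free_mod E (syzygy n).

Definition free_d n : {linear free_res n.+1 -> free_res n} :=
  (val : submod_of (kernel (free_ext (@id (syzygy n)))) -> free_res n)
  \o free_ext (@id (syzygy n.+1)).

Lemma free_cover_surj (L : lmodType E) (m : L) : exists x, free_ext (@id L) x = m.
Proof. by exists (delta E m); rewrite free_ext_delta. Qed.

Lemma free_d_image n x :
  free_ext (@id (syzygy n)) x = 0 <-> exists y, free_d n y = x.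
Proof.
split=> [x0|[y <-]].
  have [y yE] := free_cover_surj
    (exist _ x (introT (sm_predP (kernel (free_ext (@id (syzygy n)))) x) x0) : syzygy n.+1).
  by exists y; rewrite /free_d /= yE.
by rewrite /free_d /=; case: (free_ext _ y) => z /= /sm_predP.
Qed.

(* Statements about all projective resolutions of a module are thus not
   vacuous. *)
Definition free_resolution : proj_resolution M.
Proof.
exists free_res free_d (free_ext (@id M)).
- by move=> n; apply: free_mod_projective.
- exact: free_cover_surj.
- exact: (@free_d_image 0).
- move=> n x; rewrite -free_d_image; split=> [|x0]; last by rewrite /free_d /= x0.
  by move=> e; apply: val_inj.
Defined.

End FreeResolution.

Section DirectSum.
Variables (R : pzRingType) (V : nat -> lmodType R).

Definition dprod : Type := forall i, V i.
HB.instance Definition _ := Choice.copy dprod (forall i, V i).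

Definition dprod_add (x y : dprod) : dprod := fun i => x i + y i.
Definition dprod_opp (x : dprod) : dprod := fun i => - x i.
Definition dprod_scale a (x : dprod) : dprod := fun i => a *: x i.

Fact dprod_addA : associative dprod_add.
Proof. by move=> x y z; apply: functional_extensionality_dep => i; apply: addrA. Qed.

Fact dprod_addC : commutative dprod_add.
Proof. by move=> x y; apply: functional_extensionality_dep => i; apply: addrC. Qed.

Fact dprod_add0 : left_id (fun i => 0) dprod_add.
Proof. by move=> x; apply: functional_extensionality_dep => i; apply: add0r. Qed.

Fact dprod_addN : left_inverse (fun i => 0) dprod_opp dprod_add.
Proof. by move=> x; apply: functional_extensionality_dep => i; apply: addNr. Qed.

HB.instance Definition _ :=
  GRing.isZmodule.Build dprod dprod_addA dprod_addC dprod_add0 dprod_addN.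

Fact dprod_scaleA a b x : dprod_scale a (dprod_scale b x) = dprod_scale (a * b) x.
Proof. by apply: functional_extensionality_dep => i; apply: scalerA. Qed.

Fact dprod_scale1 : left_id 1 dprod_scale.
Proof. by move=> x; apply: functional_extensionality_dep => i; apply: scale1r. Qed.

Fact dprod_scaleDr : right_distributive dprod_scale +%R.
Proof. by move=> a x y; apply: functional_extensionality_dep => i; apply: scalerDr. Qed.

Fact dprod_scaleDl x : {morph dprod_scale^~ x : a b / a + b}.
Proof. by move=> a b; apply: functional_extensionality_dep => i; apply: scalerDl. Qed.

HB.instance Definition _ := GRing.Zmodule_isLmodule.Build R dprod
  dprod_scaleA dprod_scale1 dprod_scaleDr dprod_scaleDl.

Definition bounded (x : dprod) := exists n, forall i, (n <= i)%N -> x i = 0.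

Fact bounded0 : bounded 0. Proof. by exists 0%N. Qed.

Fact boundedD x y : bounded x -> bounded y -> bounded (x + y).
Proof.
move=> [m xm] [n yn]; exists (maxn m n) => i; rewrite geq_max => /andP[mi ni].
by rewrite [LHS](f_equal2 +%R (xm i mi) (yn i ni)) addr0.
Qed.

Fact boundedZ a x : bounded x -> bounded (a *: x).
Proof. by move=> [n xn]; exists n => i ni; rewrite [LHS](f_equal _ (xn i ni)) scaler0. Qed.

Definition dsum := submod_of (Submodule bounded0 boundedD boundedZ).
HB.instance Definition _ := GRing.Lmodule.on dsum.

Definition mk_dsum (x : dprod) (bx : bounded x) : dsum :=
  exist _ x (introT (sm_predP (Submodule bounded0 boundedD boundedZ) x) bx).

Definition component (x : dsum) i : V i := sval x i.

Lemma component_bounded (x : dsum) : bounded (component x).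
Proof. exact: (sm_predP _ _ (svalP x)). Qed.

End DirectSum.

Section ExtAlgebra.
Variables (k : fieldType) (E : kalgType k) (M : lmodType E) (P : proj_resolution M).

Lemma ext_class0 (N : lmodType E) i : ext_class (0 : cocycles P N i) = 0.
Proof. exact: (linear0 (qclass (coboundary P N i))). Qed.

Lemma ext_reprK (N : lmodType E) i (u : Ext P N i) : ext_class (ext_repr u) = u.
Proof. exact: qreprK. Qed.

Lemma yoneda0l (N : lmodType E) i j (v : Ext P M j) : yoneda (0 : Ext P N i) v = 0.
Proof.
rewrite -(ext_reprK v) -(ext_class0 N i) (yonedaE _ (lifting_of (ext_repr v))).
rewrite -(ext_class0 N (i + j)); congr ext_class; exact: val_inj.
Qed.

Definition zero_lifting j : lifting (val (0 : cocycles P M j) : P j -> M).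
Proof. by exists (fun n => \0) => [x|n x] /=; rewrite linear0. Defined.

Lemma yoneda0r (N : lmodType E) i j (u : Ext P N i) : yoneda u (0 : Ext P M j) = 0.
Proof.
rewrite -(ext_reprK u) -(ext_class0 M j) (yonedaE _ (zero_lifting j)).
rewrite -(ext_class0 N (i + j)); congr ext_class; apply: val_inj.
by apply: funext => x; apply: (linear0 (hom_of_cocycle (ext_repr u))).
Qed.

Definition ext_total := dsum (fun i => Ext P M i).
HB.instance Definition _ := GRing.Lmodule.on ext_total.

(* In degree n the product of x and y is the sum over i <= n of the Yoneda
   products of their components of degrees i and n - i. *)
Definition ext_mul_comp (x y : ext_total) : dprod (fun i => Ext P M i) := fun n =>
  \sum_(i < n.+1) ecast m (Ext P M m) (subnKC (leq_ord i))
                    (yoneda (component x i) (component y (n - i))).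

Lemma ecast_ext0 m n (e : m = n) : ecast m (Ext P M m) e 0 = 0.
Proof. by case: _ / e. Qed.

Fact ext_mul_bounded x y : bounded (ext_mul_comp x y).
Proof.
have [m xm] := component_bounded x; have [n yn] := component_bounded y.
exists (m + n)%N => l mnl; apply: big1 => i _.
have [mi|im] := leqP m i; first by rewrite (xm i mi) yoneda0l ecast_ext0.
rewrite (yn (l - i)%N) ?yoneda0r ?ecast_ext0 //.
by rewrite leq_subRL ?leq_ord // (leq_trans _ mnl) // leq_add2r ltnW.
Qed.

Definition ext_mul (x y : ext_total) : ext_total := mk_dsum (ext_mul_bounded x y).

Definition ext_unit : Ext P M 0 :=
  ext_class (@mk_cocycle _ _ _ P M 0 (res_aug P) (linearP (res_aug P)) (@res_aug_d _ _ _ P)).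

Definition ext_one_comp : dprod (fun i => Ext P M i) :=
  fun n => if n is 0 then ext_unit else 0.

Fact ext_one_bounded : bounded ext_one_comp.
Proof. by exists 1%N; case. Qed.

Definition ext_one : ext_total := mk_dsum ext_one_bounded.

Definition ext_homog (d : nat) (x : ext_total) : Prop :=
  forall i, i != d -> component x i = 0.

Definition is_even (x : ext_total) : Prop := forall i, odd i -> component x i = 0.

Fact is_even0 : is_even 0. Proof. by []. Qed.

Fact is_evenD x y : is_even x -> is_even y -> is_even (x + y).
Proof. by move=> ex ey i oi; rewrite [LHS](f_equal2 +%R (ex i oi) (ey i oi)) addr0. Qed.

Fact is_evenZ a x : is_even x -> is_even (a *: x).
Proof. by move=> ex i oi; rewrite [LHS](f_equal _ (ex i oi)) scaler0. Qed.

Definition even_sub := Submodule is_even0 is_evenD is_evenZ.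
Definition ext_ev := submod_of even_sub.
HB.instance Definition _ := GRing.Lmodule.on ext_ev.

Lemma ext_evP (x : ext_ev) : is_even (val x).
Proof. exact: (sm_predP _ _ (svalP x)). Qed.

Definition mk_even (x : ext_total) (ex : is_even x) : ext_ev :=
  exist _ x (introT (sm_predP even_sub x) ex).

Fact ext_mul_even (x y : ext_ev) : is_even (ext_mul (val x) (val y)).
Proof.
move=> n on; apply: big1 => i _.
have [oi|ei] := boolP (odd i); first by rewrite (ext_evP x oi) yoneda0l ecast_ext0.
rewrite (ext_evP y (i := (n - i)%N)) ?yoneda0r ?ecast_ext0 //.
by rewrite oddB ?leq_ord // on (negbTE ei).
Qed.

Fact ext_one_even : is_even ext_one.
Proof. by case. Qed.

Definition ev_mul (x y : ext_ev) : ext_ev := mk_even (ext_mul_even x y).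
Definition ev_one : ext_ev := mk_even ext_one_even.

End ExtAlgebra.

(* HH^*(R) = Ext^*(R, R) over the enveloping algebra R^en is [ext_total P], where
   P is any projective resolution of R as a left R^en-module; [yonedaE] and
   [comp_liftingP] show that the product does not depend on any choice of
   representatives or liftings. *)
Definition HHev (k : fieldType) (R : kalgType k) (P : proj_resolution (bimod R)) :=
  ext_ev P.
HB.instance Definition _ k R P := GRing.Lmodule.on (@HHev k R P).

Definition quantum_char (k : fieldType) (q : k) (e : nat) : Prop :=
  [/\ (0 < e)%N, \sum_(j < e) q ^+ j = 0
    & forall i, (0 < i < e)%N -> \sum_(j < i) q ^+ j != 0].

(* The quiver with vertices 0, ..., n and arrows [inl i : i -> i + 1] and
   [inr i : i + 1 -> i] for i < n. *)
Definition line_quiver (n : nat) : quiver := {|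
  vertex := 'I_n.+1;
  arrow := ('I_n + 'I_n)%type;
  src := fun a => match a with inl i => lift ord_max i | inr i => lift ord0 i end;
  tgt := fun a => match a with inl i => lift ord0 i | inr i => lift ord_max i end
|}.

Section AlgebraA.
Variables (k : fieldType) (e : nat).

(* Vertices and arrows are numbered from 0: the vertex v is the vertex v + 1 of
   the usual description, [al i] is alpha(i + 1) and [al' i] is alpha^-(i + 1). *)
Definition al (i : 'I_e.-1) : path_alg k (line_quiver e.-1) :=
  arr k (inl i : arrow (line_quiver e.-1)).
Definition al' (i : 'I_e.-1) : path_alg k (line_quiver e.-1) :=
  arr k (inr i : arrow (line_quiver e.-1)).

Inductive A_rel : path_alg k (line_quiver e.-1) -> Prop :=
  | A_rel_up (i j : 'I_e.-1) of j = i.+1 :> nat : A_rel (al j * al i)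
  | A_rel_down (i j : 'I_e.-1) of j = i.+1 :> nat : A_rel (al' i * al' j)
  | A_rel_loop (i j : 'I_e.-1) of j = i.+1 :> nat : A_rel (al i * al' i - al' j * al j)
  | A_rel_end (i : 'I_e.-1) of i.+1 = e.-1 : A_rel (al i * al' i).

Definition A_ := quot_alg A_rel.
HB.instance Definition _ := KAlgebra.on A_.

End AlgebraA.

Section PolynomialQuotient.
Variables (k : fieldType) (e : nat).

(* The variables of {mpoly k[(e - 1) + 1]} are z_1, ..., z_(e-1), y. *)
Definition z_ (i : 'I_e.-1) : {mpoly k[e.-1.+1]} := 'X_(lift ord_max i).
Definition y_ : {mpoly k[e.-1.+1]} := 'X_ord_max.

Inductive zy_rel : {mpoly k[e.-1.+1]} -> Prop :=
  | zy_rel_zz i j : zy_rel (z_ i * z_ j)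
  | zy_rel_zy i : zy_rel (z_ i * y_)
  | zy_rel_y : zy_rel (y_ ^+ e).

Definition zy_alg := quot_alg zy_rel.
HB.instance Definition _ := KAlgebra.on zy_alg.

(* The classes of polynomials that are homogeneous of degree d for the grading
   with deg z_i = 0 and deg y = 2 *)
Definition zy_homog (d : nat) (u : zy_alg) : Prop :=
  exists2 p : {mpoly k[e.-1.+1]}, qa_class zy_rel p = u &
    forall m : 'X_{1..e.-1.+1}, m \in msupp p -> (2 * m ord_max)%N = d.

End PolynomialQuotient.

(* Main.v *)
(** With e = N + 1, A_e is a zigzag algebra: it has the basis v_i (i <= N), up_i,
    dn_i and loop_i = dn_i up_i (i < N).  It is Koszul, and its minimal bimodule
    resolution consists of left ideals of the enveloping algebra E: its n-th term
    is E p_n, where p_n is the sum of the idempotents v_i (x) v_j over all i, j with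
    |i - j| <= n <= i + j and n = i + j mod 2 (the Clebsch-Gordan condition), and its
    differential is right multiplication by p_(n+1) (X (x) 1 -+ 1 (x) X) p_n, where
    X = sum_i ((-1)^i up_i + dn_i).  Right multiplication by p_n maps E p_(n+2) to
    E p_n and commutes with the differentials; this is the cocycle y.  Up to
    the factor p_(2m), the cocycles of degree 2m are the central elements of A_e that
    are combinations of 1 and the z_i = loop_i.  The loops become coboundaries in
    positive degrees, while 1 represents y^m, which is 0 for m > N because p_(2m)
    is, and nonzero for m <= N because the character of A_e at the last vertex
    kills all coboundaries. *)

Require Import Defs.
From HB Require Import structures.
From mathcomp Require Import all_boot all_order all_algebra.
From mathcomp Require Import boolp functions.
From mathcomp Require Import -(notations) monalg.
From mathcomp Require Import mpoly zify.

Set Implicit Arguments.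
Unset Strict Implicit.
Unset Printing Implicit Defensive.

Import GRing.Theory.
Local Open Scope ring_scope.

(** The Clebsch-Gordan condition records the nonzero pieces of the Koszul dual, which is the double
    quiver of type A with the preprojective relation at every vertex but the last: there [up dn = 0]
    in A_e, so the dual has no relation. Between two vertices the dual has dimension at most 1 in
    each degree. This is why each term is a left ideal generated by one idempotent: bimodule maps
    between terms are right multiplications by elements of E, cochains are elements of A_e, and
    supports are decided by linear arithmetic on indices. The obstacle is that the theorem speaks of
    an arbitrary projective resolution P. The ideals are never made into modules: a chain map from P
    to them is a family of linear maps into E, a chain map back is a family of elements of P, and
    the homotopy on the side of the ideals consists of elements of E. *)

Lemma mulrBrl (R : pzRingType) (a x y b : R) : a * (x - y) * b = a * x * b - a * y * b.
Proof. by rewrite mulrBr mulrBl. Qed.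

(** * Linear maps tested on a spanning set *)

Section KLinear.
Variables (k : fieldType) (R : kalgType k).

Lemma kin0 : kin 0 = 0 :> R.
Proof. by apply: (addrI (kin 0)); rewrite -kinD !addr0. Qed.

End KLinear.

Section IdealVanishing.
Variables (k : fieldType) (R : kalgType k) (S : R -> Prop) (W : zmodType) (f : R -> W).
Hypotheses (fD : forall x y, f (x + y) = f x + f y)
  (fZ : forall c x, f x = 0 -> f (kin c * x) = 0).

Lemma vanish0 : f 0 = 0.
Proof. by apply: (addrI (f 0)); rewrite -fD !addr0. Qed.

(** [ind] says, as an induction principle, that [G] spans the algebra over k. Both outer factors of
    a generator of the ideal can be expanded over [G], so whether a linear map descends to the
    quotient need only be tested on relations multiplied by elements of [G]. *)
Lemma vanish_ideal (G : R -> Prop) :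
  (forall K : R -> Prop, (forall b, G b -> K b) -> (forall c x, K x -> K (kin c * x)) ->
     K 0 -> (forall x y, K x -> K y -> K (x + y)) -> forall x, K x) ->
  (forall a s b, G a -> S s -> G b -> f (a * s * b) = 0) ->
  forall x, ideal_gen S x -> f x = 0.
Proof.
move=> ind GS x; elim=> {x}[a s b Ss||x y _ IHx _ IHy]; last 2 first.
- exact: vanish0.
- by rewrite fD IHx IHy addr0.
move: a; apply: (ind) => [a Ga|c x IH||x y IHx IHy]; last 3 first.
- by rewrite -!mulrA fZ // mulrA.
- by rewrite !mul0r vanish0.
- by rewrite !mulrDl fD IHx IHy addr0.
move: b; apply: ind => [b Gb|c x IH||x y IHx IHy]; last 3 first.
- by rewrite mulrA -kinC -mulrA fZ.
- by rewrite mulr0 vanish0.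
- by rewrite !mulrDr fD IHx IHy addr0.
exact: GS.
Qed.

End IdealVanishing.

Lemma salg_kind (k : fieldType) (B : semigroup_basis) (K : salg k B -> Prop) :
  (forall b, (exists b0, b = sbase k b0) -> K b) -> (forall c x, K x -> K (kin c * x)) ->
  K 0 -> (forall x y, K x -> K y -> K (x + y)) -> forall x, K x.
Proof.
move=> Kb KZ K0 KD; apply: salg_ind => // [b|c x /(KZ c)]; last by rewrite [kin c * x]salg_kinE.
by apply: Kb; exists b.
Qed.

Lemma mult_on_span (k : fieldType) (R : kalgType k) (G : R -> Prop) (f : R -> k) :
  (forall K : R -> Prop, (forall b, G b -> K b) -> (forall c x, K x -> K (kin c * x)) ->
     K 0 -> (forall x y, K x -> K y -> K (x + y)) -> forall x, K x) ->
  (forall x y, f (x + y) = f x + f y) -> (forall c x, f (kin c * x) = c * f x) ->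
  (forall x y, G x -> G y -> f (x * y) = f x * f y) -> forall x y, f (x * y) = f x * f y.
Proof.
move=> ind fD fZ fM x y.
have f0 : f 0 = 0 by apply: (addrI (f 0)); rewrite -fD !addr0.
move: x; apply: (ind) => [x Gx|c x IH||x x' IH IH']; last 3 first.
- by rewrite -mulrA !fZ IH mulrA.
- by rewrite mul0r !f0 mul0r.
- by rewrite mulrDl !fD IH IH' mulrDl.
move: y; apply: ind => [y Gy|c y IH||y y' IH IH']; last 3 first.
- by rewrite mulrA -kinC -mulrA !fZ IH mulrCA.
- by rewrite mulr0 !f0 mulr0.
- by rewrite mulrDr !fD IH IH' mulrDr.
exact: fM.
Qed.

(** * The zigzag algebra *)

(* Vertices and arrows are indexed by all natural numbers and vanish outside the
   range, so that the last loop relation up_(N-1) dn_(N-1) = 0 is an instance of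
   [zz_ud]. *)
Record zigzag_relations (R : pzRingType) (v up dn : nat -> R) : Prop := ZigzagRelations {
  zz_vv : forall i j, v i * v j = if i == j then v i else 0;
  zz_vu : forall i, v i.+1 * up i = up i;
  zz_uv : forall i, up i * v i = up i;
  zz_vd : forall i, v i * dn i = dn i;
  zz_dv : forall i, dn i * v i.+1 = dn i;
  zz_uu : forall i, up i.+1 * up i = 0;
  zz_dd : forall i, dn i * dn i.+1 = 0;
  zz_ud : forall i, up i * dn i = dn i.+1 * up i.+1
}.

Section ZigzagRelations.
Variables (R : pzRingType) (v up dn : nat -> R) (zz : zigzag_relations v up dn).

Lemma up_v i j : up i * v j = if i == j then up i else 0.
Proof.
by rewrite -{1}[up i](zz_uv zz) -mulrA (zz_vv zz); case: eqP => [->|]; rewrite ?(zz_uv zz) ?mulr0.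
Qed.
Lemma v_up i j : v i * up j = if i == j.+1 then up j else 0.
Proof.
by rewrite -{1}[up j](zz_vu zz) mulrA (zz_vv zz); case: eqP => [->|]; rewrite ?(zz_vu zz) ?mul0r.
Qed.
Lemma dn_v i j : dn i * v j = if i.+1 == j then dn i else 0.
Proof.
by rewrite -{1}[dn i](zz_dv zz) -mulrA (zz_vv zz); case: eqP => [_|]; rewrite ?(zz_dv zz) ?mulr0.
Qed.
Lemma v_dn i j : v i * dn j = if i == j then dn j else 0.
Proof.
by rewrite -{1}[dn j](zz_vd zz) mulrA (zz_vv zz); case: eqP => [->|]; rewrite ?(zz_vd zz) ?mul0r.
Qed.
Lemma up_up i j : up i * up j = 0.
Proof.
by rewrite -[up j](zz_vu zz) mulrA up_v; case: eqP => [->|_]; rewrite ?mul0r // (zz_uu zz).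
Qed.
Lemma dn_dn i j : dn i * dn j = 0.
Proof.
by rewrite -[dn j](zz_vd zz) mulrA dn_v; case: eqP => [<-|_]; rewrite ?mul0r // (zz_dd zz).
Qed.
Lemma up_dn i j : up i * dn j = if i == j then dn i.+1 * up i.+1 else 0.
Proof.
by rewrite -[dn j](zz_vd zz) mulrA up_v; case: eqP => [->|_]; rewrite ?mul0r // (zz_ud zz).
Qed.
Lemma dn_up i j : dn i * up j = if i == j then dn i * up i else 0.
Proof.
by rewrite -[up j](zz_vu zz) mulrA dn_v eqSS; case: eqP => [->|_]; rewrite ?mul0r // (zz_ud zz).
Qed.

Definition zz_basis (x : R) : Prop :=
  x = 0 \/ exists i, x = v i \/ x = up i \/ x = dn i \/ x = dn i * up i.

Lemma zz_basis_up a x : zz_basis x -> zz_basis (up a * x).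
Proof.
have z0 y : y = 0 -> zz_basis y by left.
case=> [->|[i [->|[->|[->|->]]]]].
- by apply: z0; rewrite mulr0.
- by rewrite up_v; case: ifP => _; [right; exists a; right; left|apply: z0].
- by apply: z0; rewrite up_up.
- by rewrite up_dn; case: ifP => _; [right; exists a.+1; do 3 right|apply: z0].
- by apply: z0; rewrite mulrA up_dn; case: ifP => _; rewrite ?mul0r // -mulrA up_up mulr0.
Qed.

Lemma zz_basis_dn a x : zz_basis x -> zz_basis (dn a * x).
Proof.
have z0 y : y = 0 -> zz_basis y by left.
case=> [->|[i [->|[->|[->|->]]]]].
- by apply: z0; rewrite mulr0.
- by rewrite dn_v; case: ifP => _; [right; exists a; do 2 right; left|apply: z0].
- by rewrite dn_up; case: ifP => _; [right; exists a; do 3 right|apply: z0].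
- by apply: z0; rewrite dn_dn.
- by apply: z0; rewrite mulrA dn_dn mul0r.
Qed.

End ZigzagRelations.

(** * The quiver algebra: relations, spanning set and coordinates *)

HB.lock Definition pathb (k : fieldType) (Q : quiver) (p : qpath Q) : (path_alg k Q : pzRingType) :=
  sbase k (p : path_basis Q).

Section ZigzagAlgebra.
Variables (k : fieldType) (N : nat).
Local Notation Q := (line_quiver N).
Local Notation PA := (path_alg k Q : pzRingType).
Local Notation A := (A_ k N.+1).
Local Notation cl := (qa_class (@A_rel k N.+1)).

Definition v (i : nat) : A :=
  if insub i is Some o then cl (sbase k (vpath (o : vertex Q) : path_basis Q)) else 0.
Definition up (i : nat) : A := if insub i is Some o then cl (@al k N.+1 o) else 0.
Definition dn (i : nat) : A := if insub i is Some o then cl (@al' k N.+1 o) else 0.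

(* The lengths d for which a path from s to t is not forced to be 0 in [A]. *)
Definition valid s t d := match d with
  0 => s == t | 1 => (s == t.+1) || (t == s.+1) | 2 => (s == t) && (s < N)%N | _ => false end.

Definition psrc (p : qpath Q) : nat := ((val p).1 : 'I_N.+1).
Definition pend (p : qpath Q) : nat := (ptgt (val p) : 'I_N.+1).
Definition plen (p : qpath Q) : nat := size (val p).2.

(* The sum of the coefficients of all paths from s to t of length d; parallel
   paths of the same length agree in [A] up to the relations, so this vanishes on
   the ideal and gives the coordinates [phi] on [A]. *)
Definition pcoef s t d (x : PA) : k :=
  @mlin k (qpath Q) k^o (fun p => ([&& valid s t d, psrc p == s, pend p == t & plen p == d])%:R) x.

Lemma pcoefU s t d p : pcoef s t d (sbase k (p : path_basis Q)) =
  ([&& valid s t d, psrc p == s, pend p == t & plen p == d])%:R.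
Proof. exact: (@mlinU k (qpath Q) k^o). Qed.
Lemma pcoefD s t d x y : pcoef s t d (x + y) = pcoef s t d x + pcoef s t d y.
Proof. exact: (linearD (@mlin k (qpath Q) k^o _)). Qed.
Lemma pcoefZ s t d c x : pcoef s t d (c *: x) = c * pcoef s t d x.
Proof. exact: (linearZ_LR (@mlin k (qpath Q) k^o _)). Qed.
Lemma pcoef0 s t d : pcoef s t d 0 = 0.
Proof. exact: (linear0 (@mlin k (qpath Q) k^o _)). Qed.

Lemma mulbase (p q : path_basis Q) : sbase k p * sbase k q = sbaseo k (Defs.pcomp p q : option (path_basis Q)).
Proof. exact: salg_mulU. Qed.

Lemma pcomp_stl (p q r : qpath Q) : Defs.pcomp p q = Some r ->
  [/\ psrc r = psrc q, pend r = pend p & plen r = (plen p + plen q)%N].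
Proof.
case: pcompP => // r' e er [<-]; split.
- by rewrite /psrc er.
- rewrite /pend er ptgt_cat -[X in ptgt (ptgt X, _)]surjective_pairing in e *.
  by rewrite -e -surjective_pairing.
- by rewrite /plen er size_cat.
Qed.

Lemma plen0 (p : qpath Q) : plen p = 0%N -> psrc p = pend p.
Proof. by case: p => -[w [|a l]]. Qed.

Definition pprod (p : qpath Q) (o : option (qpath Q)) := obind (fun r => Defs.pcomp p r) o.
Definition pprodr (o : option (qpath Q)) (p : qpath Q) := obind (fun r => Defs.pcomp r p) o.
Local Notation pb := (@pathb k Q).
Definition pbo (o : option (qpath Q)) : PA := if o is Some p then pb p else 0.
Lemma pbE (p : path_basis Q) : pb p = sbase k p.
Proof. by rewrite pathb.unlock. Qed.

Lemma pbM p q : pb p * pb q = pbo (Defs.pcomp p q).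
Proof. by rewrite !pbE mulbase; case: Defs.pcomp => // r; rewrite /= pbE. Qed.
Lemma pbMo p o : pb p * pbo o = pbo (pprod p o).
Proof. case: o => [r|]; [exact: pbM|exact: mulr0]. Qed.
Lemma pboM p o : pbo o * pb p = pbo (pprodr o p).
Proof. case: o => [r|]; [exact: pbM|exact: mul0r]. Qed.

Lemma pcoef4 s t d (p a b q : qpath Q) :
  pcoef s t d (pb p * (pb a * pb b) * pb q) =
  ([&& psrc p == pend a, psrc a == pend b, psrc b == pend q, valid s t d,
     psrc q == s, pend p == t & (plen p + (plen a + plen b) + plen q)%N == d])%:R.
Proof.
have nd (x y : qpath Q) : psrc x == pend y -> Defs.pcomp x y <> None.
  by case: pcompP => // /negbTE n e; move: n; rewrite -val_eqE -[val _ == _]/(psrc x == pend y) e.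
have ns (x y : qpath Q) r : Defs.pcomp x y = Some r -> psrc x == pend y.
  by case: pcompP => // r' e _ _; rewrite /psrc e.
rewrite pbM pbMo pboM.
case ab: (Defs.pcomp a b) => [r|] /=; last first.
  rewrite pcoef0; case: (psrc a =P pend b) => [/eqP/nd //|_].
  by rewrite andbF.
have [rs rt rl] := pcomp_stl ab; rewrite (ns _ _ _ ab) /=.
case pr: (Defs.pcomp p r) => [u|] /=; last first.
  rewrite pcoef0; case: (psrc p =P pend a) => [/eqP e|//].
  by case: (nd p r) => //; rewrite rt.
have [us ut ul] := pcomp_stl pr; rewrite -rt (ns _ _ _ pr) /=.
case uq: (Defs.pcomp u q) => [w|] /=; last first.
  rewrite pcoef0; case: (psrc b =P pend q) => [/eqP e|//].
  by case: (nd u q) => //; rewrite us rs.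
have [ws wt wl] := pcomp_stl uq; rewrite -rs -us (ns _ _ _ uq) /=.
by rewrite pbE pcoefU ws wt wl ut ul rl.
Qed.

Lemma alE i : @al k N.+1 i = pb (apath (inl i : arrow Q)).
Proof. by rewrite pbE. Qed.
Lemma alE' i : @al' k N.+1 i = pb (apath (inr i : arrow Q)).
Proof. by rewrite pbE. Qed.

Lemma apath_inl (i : 'I_N) : (psrc (apath (inl i : arrow Q)) = i) *
  (pend (apath (inl i : arrow Q)) = i.+1)
   * (plen (apath (inl i : arrow Q)) = 1).
Proof. by rewrite /psrc /pend /= /bump [(N <= i)%N]leqNgt ltn_ord. Qed.
Lemma apath_inr (i : 'I_N) : (psrc (apath (inr i : arrow Q)) = i.+1) *
  (pend (apath (inr i : arrow Q)) = i)
   * (plen (apath (inr i : arrow Q)) = 1).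
Proof. by rewrite /psrc /pend /= /bump [(N <= i)%N]leqNgt ltn_ord. Qed.

Lemma pcoefB s t d x y : pcoef s t d (x - y) = pcoef s t d x - pcoef s t d y.
Proof. exact: (linearB (@mlin k (qpath Q) k^o _)). Qed.

Definition pu (i : 'I_N) : qpath Q := apath (inl i : arrow Q).
Definition pd (i : 'I_N) : qpath Q := apath (inr i : arrow Q).

Variant A_rel_spec (r : PA) : Prop :=
  | ARelUp (i j : 'I_N) of j = i.+1 :> nat & r = pb (pu j) * pb (pu i)
  | ARelDown (i j : 'I_N) of j = i.+1 :> nat & r = pb (pd i) * pb (pd j)
  | ARelLoop (i j : 'I_N) of j = i.+1 :> nat &
      r = pb (pu i) * pb (pd i) - pb (pd j) * pb (pu j)
  | ARelEnd (i : 'I_N) of i.+1 = N & r = pb (pu i) * pb (pd i).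

Lemma A_relP r : @A_rel k N.+1 r -> A_rel_spec r.
Proof.
by case=> [i j ij|i j ij|i j ij|i ij]; rewrite ?alE ?alE';
  [apply: ARelUp ij _|apply: ARelDown ij _|apply: ARelLoop ij _|apply: ARelEnd ij _].
Qed.

Lemma pcoef_rel s t d (p q : qpath Q) r : @A_rel k N.+1 r ->
  pcoef s t d (pb p * r * pb q) = 0.
Proof.
(* The relations have length 2 and [valid] allows no greater length, so only trivial outer paths
   matter; [plen0] identifies their ends. Then [valid] excludes the two-step paths, whose ends
   differ, and the loop at the last vertex, while the two terms of a loop relation share their ends
   and length. *)
move=> /A_relP rr; have := @plen0 p; have := @plen0 q.
have z (b : bool) : b = false -> b%:R = 0 :> k by move=> ->.
have zz (b b' : bool) : b = b' -> b%:R - b'%:R = 0 :> k by move=> ->; rewrite subrr.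
case: rr => [i j ij ->|i j ij ->|i j ij ->|i ij ->]; have := ltn_ord i.
- rewrite pcoef4 !apath_inl => *; apply: z.
  by case: d => [|[|[|d]]] /=; lia.
- rewrite pcoef4 !apath_inr => *; apply: z.
  by case: d => [|[|[|d]]] /=; lia.
- have := ltn_ord j.
  rewrite [X in pcoef _ _ _ X]mulrBrl pcoefB => *.
  apply: etrans (f_equal2 (fun a b : k => a - b) (pcoef4 _ _ _ _ _ _ _) (pcoef4 _ _ _ _ _ _ _)) _.
  rewrite !apath_inr !apath_inl; apply: zz.
  by case: d => [|[|[|d]]] /=; lia.
- move=> *; apply: etrans (pcoef4 _ _ _ _ _ _ _) _.
  rewrite !apath_inr !apath_inl; apply: z.
  by case: d => [|[|[|d]]] /=; lia.
Qed.

Lemma pcoef_kin s t d c x : pcoef s t d (kin c * x) = c * pcoef s t d x.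
Proof. by rewrite -pcoefZ; congr (pcoef s t d _); apply: salg_kinE. Qed.

Lemma pcoef_ideal s t d x : ideal_gen (@A_rel k N.+1) x -> pcoef s t d x = 0.
Proof.
apply: (vanish_ideal (@pcoefD s t d) _ (@salg_kind k (path_basis Q))) => [c y e|].
  by rewrite pcoef_kin e mulr0.
move=> _ r _ [a ->] rr [b ->]; rewrite -!pbE; exact: pcoef_rel.
Qed.

Definition phi s t d (x : A) : k := pcoef s t d (qa_repr x).
Lemma phiE s t d x : phi s t d (cl x) = pcoef s t d x.
Proof.
apply/eqP; rewrite -subr_eq0 -pcoefB; apply/eqP/pcoef_ideal.
by apply/qa_eqP/qa_reprK.
Qed.
Lemma phiD s t d x y : phi s t d (x + y) = phi s t d x + phi s t d y.
Proof. by rewrite -(qa_reprK x) -(qa_reprK y) -qa_classD !phiE pcoefD. Qed.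
Lemma phiZ s t d c x : phi s t d (kin c * x) = c * phi s t d x.
Proof. by rewrite -(qa_reprK x) -qa_classM !phiE (salg_kinE c) pcoefZ. Qed.

Definition pv (w : 'I_N.+1) : qpath Q := vpath (w : vertex Q).

Lemma vE (i : 'I_N.+1) : v i = cl (pb (pv i)).
Proof. by rewrite /v valK pbE. Qed.
Lemma upE (i : 'I_N) : up i = cl (pb (pu i)).
Proof. by rewrite /up valK alE. Qed.
Lemma dnE (i : 'I_N) : dn i = cl (pb (pd i)).
Proof. by rewrite /dn valK alE'. Qed.
Lemma v_out i : (N < i)%N -> v i = 0.
Proof. by move=> h; rewrite /v; case: insubP => // o; rewrite ltnNge h. Qed.
Lemma up_out i : (N <= i)%N -> up i = 0.
Proof. by move=> h; rewrite /up; case: insubP => // o; rewrite ltnNge h. Qed.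
Lemma dn_out i : (N <= i)%N -> dn i = 0.
Proof. by move=> h; rewrite /dn; case: insubP => // o; rewrite ltnNge h. Qed.

Lemma clM p q : cl (pb p) * cl (pb q) = cl (pbo (Defs.pcomp p q)).
Proof. by rewrite -qa_classM pbM. Qed.

Lemma pcomp_none p q : psrc p != pend q -> Defs.pcomp p q = None.
Proof. by case: pcompP => // r e _; rewrite /psrc e eqxx. Qed.

Lemma pcomp_some p q r : psrc p = pend q -> val r = ((val q).1, (val p).2 ++ (val q).2) ->
  Defs.pcomp p q = Some r.
Proof.
case: pcompP => [r' _ er' _ er|/negP n e]; first by congr Some; apply: qpath_inj; rewrite er' er.
by case: n; rewrite -val_eqE; apply/eqP.
Qed.

Lemma cl0 : cl 0 = 0.
Proof. by apply: (addrI (cl 0)); rewrite -qa_classD !addr0. Qed.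

Lemma rel_vv i j : v i * v j = if i == j then v i else 0.
Proof.
have [iN|/v_out->] := ltnP i N.+1; last by rewrite mul0r if_same.
have [jN|jN] := ltnP j N.+1; last first.
  by rewrite (v_out jN) mulr0; case: eqP => // e; move: jN; rewrite -e ltnNge -ltnS iN.
rewrite (vE (Ordinal iN)) (vE (Ordinal jN)) clM; case: eqP => [e|/eqP ne].
  by rewrite (pcomp_some (r := pv (Ordinal iN))) //; congr (_, _); apply: val_inj.
by rewrite pcomp_none // cl0.
Qed.

Lemma rel_vu i : v i.+1 * up i = up i.
Proof.
have [iN|/up_out->] := ltnP i N; last by rewrite mulr0.
rewrite (vE (Ordinal (iN : (i.+1 < N.+1)%N))) (upE (Ordinal iN)) clM.
by rewrite (pcomp_some (r := pu (Ordinal iN))).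
Qed.
Lemma rel_uv i : up i * v i = up i.
Proof.
have [iN|/up_out->] := ltnP i N; last by rewrite mul0r.
rewrite (vE (Ordinal (ltnW iN : (i < N.+1)%N))) (upE (Ordinal iN)) clM.
rewrite (pcomp_some (r := pu (Ordinal iN))) //=; first by rewrite apath_inl.
by congr (_, _); apply: val_inj; rewrite /= /bump leqNgt iN.
Qed.
Lemma rel_vd i : v i * dn i = dn i.
Proof.
have [iN|/dn_out->] := ltnP i N; last by rewrite mulr0.
rewrite (vE (Ordinal (ltnW iN : (i < N.+1)%N))) (dnE (Ordinal iN)) clM.
by rewrite (pcomp_some (r := pd (Ordinal iN))) // apath_inr.
Qed.
Lemma rel_dv i : dn i * v i.+1 = dn i.
Proof.
have [iN|/dn_out->] := ltnP i N; last by rewrite mul0r.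
rewrite (vE (Ordinal (iN : (i.+1 < N.+1)%N))) (dnE (Ordinal iN)) clM.
rewrite (pcomp_some (r := pd (Ordinal iN))) ?apath_inr //=.
by congr (_, _); apply: val_inj.
Qed.

Lemma cl_rel r : @A_rel k N.+1 r -> cl r = 0.
Proof.
move=> rr; rewrite -cl0; apply/qa_eqP; rewrite subr0 -[r]mul1r -[_ * r]mulr1; exact: IdealGen.
Qed.

Lemma rel_uu i : up i.+1 * up i = 0.
Proof.
have [iN|/up_out->] := ltnP i.+1 N; last by rewrite mul0r.
rewrite (upE (Ordinal iN)) (upE (Ordinal (ltnW iN))) -qa_classM -!alE.
exact/cl_rel/A_rel_up.
Qed.
Lemma rel_dd i : dn i * dn i.+1 = 0.
Proof.
have [iN|/dn_out->] := ltnP i.+1 N; last by rewrite mulr0.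
rewrite (dnE (Ordinal iN)) (dnE (Ordinal (ltnW iN))) -qa_classM -!alE'.
exact/cl_rel/A_rel_down.
Qed.
Lemma rel_ud i : up i * dn i = dn i.+1 * up i.+1.
Proof.
have [iN|iN] := ltnP i.+1 N.
  rewrite (dnE (Ordinal iN)) (dnE (Ordinal (ltnW iN))) (upE (Ordinal iN)) (upE (Ordinal (ltnW iN))).
  rewrite -!qa_classM -!alE -!alE'; apply/qa_eqP.
  rewrite -[X in ideal_gen _ X]mul1r -[X in ideal_gen _ X]mulr1; apply: IdealGen.
  exact: A_rel_loop.
transitivity (0 : A); last by rewrite (up_out iN) mulr0.
have [iN'|/up_out->] := ltnP i N; last by rewrite mul0r.
rewrite (upE (Ordinal iN')) (dnE (Ordinal iN')) -qa_classM -!alE -!alE'.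
by apply/cl_rel/A_rel_end => /=; lia.
Qed.

Lemma rel_sum : \sum_(0 <= i < N.+1) v i = 1.
Proof.
rewrite big_mkord; under eq_bigr do rewrite vE.
transitivity (cl (\sum_(i < N.+1) pb (pv i))).
  by apply/esym/(big_morph cl (@qa_classD _ _ _) cl0).
congr cl; transitivity (salg_one k (path_basis Q)) => //; rewrite /salg_one big_map big_enum /=.
by apply: eq_bigr => i _; rewrite pbE.
Qed.

Lemma pcoef2 s t d p q : pcoef s t d (pb p * pb q) =
  ([&& psrc p == pend q, valid s t d, psrc q == s, pend p == t & (plen p + plen q)%N == d])%:R.
Proof.
rewrite pbM; case: (psrc p =P pend q) => [e|/eqP ne] /=; last by rewrite pcomp_none ?pcoef0.
case pq: (Defs.pcomp p q) => [r|]; last first.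
  by move: pq e; case: pcompP => // /negP n _ e; case: n; rewrite -val_eqE; apply/eqP.
by have [rs rt rl] := pcomp_stl pq; rewrite /= pbE pcoefU rs rt rl.
Qed.

Lemma pcoef_pb s t d p : pcoef s t d (pb p) = ([&& valid s t d, psrc p == s, pend p == t & plen p == d])%:R.
Proof. by rewrite pbE pcoefU. Qed.

Lemma phi_pb s t d p : phi s t d (cl (pb p)) = ([&& valid s t d, psrc p == s, pend p == t & plen p == d])%:R.
Proof. by rewrite phiE pbE pcoefU. Qed.

Lemma phi_v s t d j : phi s t d (v j) = ([&& (j <= N)%N, s == j, t == j & d == 0%N])%:R.
Proof.
have [jN|jN] := ltnP j N.+1; last by rewrite v_out // -cl0 phiE pcoef0 leqNgt jN.
rewrite (vE (Ordinal jN)) phi_pb -[(j <= N)%N]/(j < N.+1)%N jN /=; congr (nat_of_bool _)%:R.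
by rewrite /psrc /pend /plen /=; case: d => [|[|[|d]]] /=; lia.
Qed.
Lemma phi_u s t d j : phi s t d (up j) = ([&& (j < N)%N, s == j, t == j.+1 & d == 1%N])%:R.
Proof.
have [jN|jN] := ltnP j N; last by rewrite up_out // -cl0 phiE pcoef0.
rewrite (upE (Ordinal jN)) phi_pb !apath_inl; congr (nat_of_bool _)%:R => /=.
by case: d => [|[|[|d]]] /=; lia.
Qed.
Lemma phi_d s t d j : phi s t d (dn j) = ([&& (j < N)%N, s == j.+1, t == j & d == 1%N])%:R.
Proof.
have [jN|jN] := ltnP j N; last by rewrite dn_out // -cl0 phiE pcoef0.
rewrite (dnE (Ordinal jN)) phi_pb !apath_inr; congr (nat_of_bool _)%:R => /=.
by case: d => [|[|[|d]]] /=; lia.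
Qed.
Lemma phi_c s t d j : phi s t d (dn j * up j) = ([&& (j < N)%N, s == j, t == j & d == 2%N])%:R.
Proof.
have [jN|jN] := ltnP j N; last by rewrite up_out // mulr0 -cl0 phiE pcoef0.
rewrite (dnE (Ordinal jN)) (upE (Ordinal jN)) -qa_classM phiE pcoef2 !apath_inr !apath_inl.
congr (nat_of_bool _)%:R => /=.
by case: d => [|[|[|d]]] /=; lia.
Qed.

(** A product of paths has length 0 only if both factors do, so this coordinate is the character of
    A at the vertex i. *)
Lemma phi_mul0 i x y : phi i i 0 (x * y) = phi i i 0 x * phi i i 0 y.
Proof.
rewrite -(qa_reprK x) -(qa_reprK y) -qa_classM !phiE.
apply: (mult_on_span (@salg_kind k (path_basis Q)) (@pcoefD i i 0) (@pcoef_kin i i 0)).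
move=> _ _ [p ->] [q ->]; rewrite -!pbE; apply: etrans (pcoef2 _ _ _ _ _) _.
rewrite !pcoef_pb -natrM mulnb.
congr (nat_of_bool _)%:R; have := @plen0 p; have := @plen0 q => /=; lia.
Qed.

Fact relations : zigzag_relations v up dn.
Proof. exact: ZigzagRelations rel_vv rel_vu rel_uv rel_vd rel_dv rel_uu rel_dd rel_ud. Qed.

Lemma zz_basis_path (p : qpath Q) : zz_basis v up dn (cl (pb p)).
Proof.
case: p => -[w s] /= ws; elim: s ws => [|a s IH] ws.
  by right; exists w; left; rewrite vE; congr (cl (pb _)); apply: val_inj.
have /andP[sa ws'] := ws.
have -> : cl (pb (exist _ (w, a :: s) ws)) = cl (pb (apath a)) * cl (pb (exist _ (w, s) ws')).
  rewrite clM; congr cl; rewrite (pcomp_some (r := exist _ (w, a :: s) ws)) //.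
  by have /(congr1 val) := eqP sa.
case: a {ws sa} => a; first by rewrite -(upE a); apply/(zz_basis_up relations)/IH.
by rewrite -(dnE a); apply/(zz_basis_dn relations)/IH.
Qed.

Lemma zz_ind (K : A -> Prop) : K 0 -> (forall x y, K x -> K y -> K (x + y)) ->
  (forall c x, zz_basis v up dn x -> K (kin c * x)) -> forall x, K x.
Proof.
move=> K0 KD Kb x.
rewrite -(qa_reprK x); suff : forall c, K (kin c * cl (qa_repr x)) by move/(_ 1); rewrite kin1 mul1r.
move: (qa_repr x); apply: salg_kind => [_ [p ->]|c {}x IH||{}x y IHx IHy] c'.
- by rewrite -pbE; apply/Kb/zz_basis_path.
- by rewrite qa_classM mulrA -kinM; apply: IH.
- by rewrite cl0 mulr0.
- by rewrite qa_classD mulrDr; apply: KD; [apply: IHx|apply: IHy].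
Qed.

End ZigzagAlgebra.

(** From here on the algebra is known only through these properties. The functionals [phi] read off
    coordinates in the basis v, up, dn, loop, and so encode its linear independence. *)
Record zigzag_algebra (k : fieldType) (N : nat) (A : kalgType k) (v up dn : nat -> A)
    (phi : nat -> nat -> nat -> A -> k) : Prop := ZigzagAlgebra {
  zz_rel :> zigzag_relations v up dn;
  zz_v_out : forall i, (N < i)%N -> v i = 0;
  zz_sum : \sum_(0 <= i < N.+1) v i = 1;
  zz_span : forall K : A -> Prop, K 0 -> (forall x y, K x -> K y -> K (x + y)) ->
    (forall c x, zz_basis v up dn x -> K (kin c * x)) -> forall x, K x;
  zz_phiD : forall s t d x y, phi s t d (x + y) = phi s t d x + phi s t d y;
  zz_phiZ : forall s t d c x, phi s t d (kin c * x) = c * phi s t d x;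
  zz_phi_v : forall s t d j, phi s t d (v j) = ([&& (j <= N)%N, s == j, t == j & d == 0%N])%:R;
  zz_phi_u : forall s t d j, phi s t d (up j) = ([&& (j < N)%N, s == j, t == j.+1 & d == 1%N])%:R;
  zz_phi_d : forall s t d j, phi s t d (dn j) = ([&& (j < N)%N, s == j.+1, t == j & d == 1%N])%:R;
  zz_phi_c : forall s t d j,
    phi s t d (dn j * up j) = ([&& (j < N)%N, s == j, t == j & d == 2%N])%:R;
  zz_phiM : forall i x y, phi i i 0 (x * y) = phi i i 0 x * phi i i 0 y
}.

Lemma A_zigzag (k : fieldType) (N : nat) :
  zigzag_algebra N (@v k N) (@up k N) (@dn k N) (@phi k N).
Proof.
split; [exact: relations|exact: v_out|exact: rel_sum|exact: zz_ind|exact: phiD|exact: phiZ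
  |exact: phi_v|exact: phi_u|exact: phi_d|exact: phi_c|exact: phi_mul0].
Qed.

(** * The enveloping algebra *)

(** [tens_lift] supplies additive maps that act on the left tensor factor alone. They need not be
    bimodule maps; the contraction behind exactness is built from them. *)
Record enveloping_algebra (k : fieldType) (A E : kalgType k) (tens : A -> A -> E)
    (act : E -> A -> A) : Prop := EnvelopingAlgebra {
  tensDl : forall a a' b, tens (a + a') b = tens a b + tens a' b;
  tensDr : forall a b b', tens a (b + b') = tens a b + tens a b';
  tensZl : forall c a b, tens (kin c * a) b = kin c * tens a b;
  tensZr : forall c a b, tens a (kin c * b) = kin c * tens a b;
  tensM : forall a b a' b', tens a b * tens a' b' = tens (a * a') (b' * b);
  tens1 : tens 1 1 = 1;
  tens_span : forall K : E -> Prop, K 0 -> (forall x y, K x -> K y -> K (x + y)) ->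
    (forall a b, K (tens a b)) -> forall x, K x;
  tens_lift : forall h : A -> A, (forall x y, h (x + y) = h x + h y) ->
    (forall c x, h (kin c * x) = kin c * h x) ->
    exists2 T : E -> E, (forall x y, T (x + y) = T x + T y) & forall a b, T (tens a b) = tens (h a) b;
  actDl : forall x y a, act (x + y) a = act x a + act y a;
  actDr : forall x a b, act x (a + b) = act x a + act x b;
  actM : forall x y a, act (x * y) a = act x (act y a);
  act_tens : forall a b x, act (tens a b) x = a * x * b
}.

Lemma sandwichD (R : pzRingType) (a x y b : R) : a * (x + y) * b = a * x * b + a * y * b.
Proof. by rewrite mulrDr mulrDl. Qed.

Lemma sandwichZ (k : fieldType) (R : kalgType k) c (a x b : R) :
  a * (kin c * x) * b = kin c * (a * x * b).
Proof. by rewrite mulrA -kinC -!mulrA. Qed.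

Section Enveloping.
Variables (k : fieldType) (A : kalgType k).
Local Notation E := (enveloping A).
Local Notation F := (salg k (pair_basis A A^c)).
Local Notation pur := (@pure k A A^c).
Local Notation cl := (qa_class (@bilinear_rel k A A^c)).

Definition etens (a b : A) : E := tens (a : A) (b : A^c).
Definition eact (x : E) (a : A) : A := bscale x a.

Lemma cl_eq x y : bilinear_rel (x - y) -> cl x = cl y.
Proof.
move=> r; apply/qa_eqP; rewrite -[X in ideal_gen _ X]mul1r -[X in ideal_gen _ X]mulr1.
exact: IdealGen.
Qed.

Lemma etensDl a a' b : etens (a + a') b = etens a b + etens a' b.
Proof. by rewrite -qa_classD; apply: cl_eq; apply: BilinDl. Qed.
Lemma etensDr a b b' : etens a (b + b') = etens a b + etens a b'.
Proof. by rewrite -qa_classD; apply: cl_eq; apply: BilinDr. Qed.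
Lemma etensZl c a b : etens (kin c * a) b = kin c * etens a b.
Proof. by rewrite -qa_classM; apply: cl_eq; apply: BilinZl. Qed.
Lemma etensZr c a b : etens a (kin c * b) = kin c * etens a b.
Proof. by rewrite -qa_classM kinC; apply: cl_eq; apply: (BilinZr c a (b : A^c)). Qed.
Lemma etensM a b a' b' : etens a b * etens a' b' = etens (a * a') (b' * b).
Proof. by rewrite -qa_classM; congr cl; apply: salg_mulU. Qed.
Lemma etens1 : etens 1 1 = 1.
Proof. congr cl; apply/esym; exact: big_seq1. Qed.

Lemma etens_span (K : E -> Prop) : K 0 -> (forall x y, K x -> K y -> K (x + y)) ->
    (forall a b, K (etens a b)) -> forall x, K x.
Proof.
move=> K0 KD Kt x; rewrite -(qa_reprK x).
suff : forall c, K (kin c * cl (qa_repr x)) by move/(_ 1); rewrite kin1 mul1r.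
move: (qa_repr x); apply: salg_kind => [_ [[a b] ->]|c {}x IH||{}x y IHx IHy] c'.
- by rewrite -[cl _]/(etens a b) -etensZl.
- by rewrite qa_classM mulrA -kinM; apply: IH.
- suff -> : cl 0 = 0 by rewrite mulr0.
  by apply: (addrI (cl 0)); rewrite -qa_classD !addr0.
- by rewrite qa_classD mulrDr; apply: KD; [apply: IHx|apply: IHy].
Qed.

Section TensorLift.
Variables (h : A -> A) (hD : forall x y, h (x + y) = h x + h y)
  (hZ : forall c x, h (kin c * x) = kin c * h x).

Definition lift_free (x : F) : E :=
  @mlin k (A * A^c)%type (resk E^o) (fun p => etens (h p.1) p.2) x.

Lemma lift_freeD x y : lift_free (x + y) = lift_free x + lift_free y.
Proof. exact: (linearD (@mlin k (A * A^c)%type (resk E^o) _)). Qed.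
Lemma lift_free_kin c x : lift_free (kin c * x) = kin c * lift_free x.
Proof.
rewrite [kin c * x]salg_kinE.
exact: (linearZ_LR (@mlin k (A * A^c)%type (resk E^o) _)).
Qed.
Lemma lift_free_pure a b : lift_free (pur a b) = etens (h a) b.
Proof. exact: (@mlinU k (A * A^c)%type (resk E^o)). Qed.
Lemma lift_freeB x y : lift_free (x - y) = lift_free x - lift_free y.
Proof. exact: (linearB (@mlin k (A * A^c)%type (resk E^o) _)). Qed.

Lemma pureM a b a' b' : pur a b * pur a' b' = pur (a * a') (b * b').
Proof. exact: salg_mulU. Qed.

Lemma pureMM a b a' b' a'' b'' : pur a b * pur a' b' * pur a'' b'' = pur (a * a' * a'') (b * b' * b'').
Proof. by rewrite !pureM. Qed.

Lemma free_sandwich (p q : F) x y : p * (x - y) * q = p * x * q - p * y * q.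
Proof. exact: mulrBrl. Qed.

Lemma lift_free_ideal x : ideal_gen (@bilinear_rel k A A^c) x -> lift_free x = 0.
Proof.
apply: (vanish_ideal lift_freeD _ (@salg_kind k (pair_basis A A^c))) => [c y e|].
  by rewrite lift_free_kin e mulr0.
move=> _ r _ [[a b] ->] rr [[a' b'] ->].
have lf3 x' y' : lift_free (pur a b * pur x' y' * pur a' b') = etens (h (a * x' * a')) ((b' : A) * ((y' : A) * (b : A))).
  by apply: (etrans (congr1 lift_free (pureMM a b x' y' a' b')) (lift_free_pure (a * x' * a') (b * y' * b'))).
rewrite -/(pur a b) -/(pur a' b').
have D x' y' : lift_free (pur a b * (x' + y') * pur a' b') =
    lift_free (pur a b * x' * pur a' b') + lift_free (pur a b * y' * pur a' b').
  by apply: (etrans (congr1 lift_free (sandwichD _ _ _ _)) (lift_freeD _ _)).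
have Z c x' : lift_free (pur a b * (c *k: x') * pur a' b') = kin c * lift_free (pur a b * x' * pur a' b').
  by apply: (etrans (congr1 lift_free (sandwichZ _ _ _ _)) (lift_free_kin _ _)).
have B x' y' : lift_free (pur a b * x' * pur a' b') = lift_free (pur a b * y' * pur a' b') ->
    lift_free (pur a b * (x' - y') * pur a' b') = 0.
  move=> e; transitivity (lift_free (pur a b * x' * pur a' b' - pur a b * y' * pur a' b')).
    by congr lift_free; apply: free_sandwich.
  by apply: etrans (lift_freeB _ _) _; apply/eqP; rewrite subr_eq0; apply/eqP.
case: rr => [r1 r2 s|r1 s1 s2|c r1 s|c r1 s]; apply: B; apply: etrans (lf3 _ _) _;
  apply/esym; first [apply: etrans (D _ _) _|apply: etrans (Z _ _) _];
  apply: etrans (f_equal2 +%R (lf3 _ _) (lf3 _ _)) _ || apply: etrans (f_equal _ (lf3 _ _)) _; apply/esym.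
- by rewrite mulrDr mulrDl hD etensDl.
- by rewrite (mulrDl (s1 : A)) (mulrDr (b' : A)) etensDr.
- by rewrite mulrA -kinC -!mulrA hZ etensZl.
- have E : (b' : A) * (((s : A) * kin c) * (b : A)) = kin c * ((b' : A) * ((s : A) * (b : A))).
    by rewrite -kinC -(mulrA (kin c)) mulrA -kinC -(mulrA (kin c)).
  by apply: (etrans (congr1 (etens (h (a * r1 * a'))) E)); apply: etensZr.
Qed.

Lemma etens_lift : exists2 T : E -> E, (forall x y, T (x + y) = T x + T y) &
  forall a b, T (etens a b) = etens (h a) b.
Proof.
pose T (x : E) : E := lift_free (qa_repr x).
have TE x : T (cl x) = lift_free x.
  apply/eqP; rewrite -subr_eq0 -lift_freeB; apply/eqP/lift_free_ideal.
  by apply/qa_eqP/qa_reprK.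
exists T => [x y|a b]; last by rewrite [T _]TE lift_free_pure.
by rewrite -(qa_reprK x) -(qa_reprK y) -qa_classD !TE lift_freeD.
Qed.

End TensorLift.

Lemma eact_tens a b x : eact (etens a b) x = a * x * b.
Proof. exact: bscale_tens. Qed.

Lemma A_enveloping : enveloping_algebra etens eact.
Proof.
split; [exact: etensDl|exact: etensDr|exact: etensZl|exact: etensZr|exact: etensM|exact: etens1
  |exact: etens_span|exact: etens_lift|move=> x y a; exact: bscaleDl|exact: bscaleDr
  |by move=> x y a; rewrite [RHS]bscaleA|exact: eact_tens].
Qed.

End Enveloping.

(** * Sums with one nonzero term, and additive maps *)

Lemma big_nat_pick (V : nmodType) (n i : nat) (F : nat -> V) :
  (forall j, j != i -> F j = 0) -> \sum_(0 <= j < n) F j = if (i < n)%N then F i else 0.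
Proof.
move=> F0; elim: n => [|n IH]; first by rewrite big_nil.
rewrite big_nat_recr //= IH ltnS; case: (ltngtP i n) => [ni|ni|->]; rewrite ?add0r //.
- by rewrite (F0 n) ?addr0 // neq_ltn ni orbT.
- by rewrite (F0 n) // neq_ltn ni.
Qed.

Section Additive.
Variables (U V : zmodType) (f : U -> V).
Hypothesis fD : forall x y, f (x + y) = f x + f y.

Lemma add_fun0 : f 0 = 0.
Proof. by apply: (addrI (f 0)); rewrite -fD !addr0. Qed.
Lemma add_funN x : f (- x) = - f x.
Proof. by apply: (addrI (f x)); rewrite -fD !subrr add_fun0. Qed.
Lemma add_funB x y : f (x - y) = f x - f y.
Proof. by rewrite fD add_funN. Qed.
Lemma add_fun_sum (I : Type) (r : seq I) (P : pred I) (F : I -> U) :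
  f (\sum_(i <- r | P i) F i) = \sum_(i <- r | P i) f (F i).
Proof. by apply: (big_morph f fD add_fun0). Qed.
Lemma add_fun_if (b : bool) x : f (if b then x else 0) = if b then f x else 0.
Proof. by case: b => //; apply: add_fun0. Qed.

End Additive.

Lemma add_fun_sign (U V : pzRingType) (f : U -> V) : (forall x y, f (x + y) = f x + f y) ->
  forall n x, f ((-1) ^+ n * x) = (-1) ^+ n * f x.
Proof.
move=> fD n x; rewrite -signr_odd -[in RHS]signr_odd.
by case: (odd n); rewrite ?expr0 ?expr1 ?mulN1r ?mul1r // add_funN.
Qed.

(** * The resolution *)

Section ZigzagResolution.
Variables (k : fieldType) (N : nat) (A E : kalgType k) (v up dn : nat -> A).
Variables (phi : nat -> nat -> nat -> A -> k) (tens : A -> A -> E) (act : E -> A -> A).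
Hypotheses (zz : zigzag_algebra N v up dn phi) (en : enveloping_algebra tens act).

Lemma up_outN i : (N <= i)%N -> up i = 0.
Proof. by move=> iN; rewrite -(zz_vu zz) (zz_v_out zz) ?mul0r. Qed.
Lemma dn_outN i : (N <= i)%N -> dn i = 0.
Proof. by move=> iN; rewrite -(zz_dv zz) (zz_v_out zz) ?mulr0. Qed.

(* With these signs X^2 is the loop at the vertex 0: the two loop terms cancel at
   every other vertex. *)
Definition X := \sum_(0 <= i < N) ((-1) ^+ i * up i + dn i).

Lemma X_suml (a : A) i : a * v i = a ->
  a * X = (if i is i'.+1 then (-1) ^+ i' * (a * up i') else 0) + a * dn i.
Proof.
move=> ai; rewrite -[in LHS]ai -mulrA mulr_sumr.
under eq_bigr => j _ do rewrite mulrDr mulrA commr_sign -mulrA (v_up zz) (v_dn zz).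
rewrite big_split /= mulrDr; congr (_ + _).
  case: i ai => [|i] ai; first by rewrite big1 ?mulr0 // => j _; rewrite mulr0.
  rewrite (@big_nat_pick _ _ i) => [|j ji]; last by rewrite eqSS eq_sym (negbTE ji) mulr0.
  rewrite eqxx; case: ltnP => [_|/up_outN->]; last by rewrite !mulr0.
  by rewrite mulrA commr_sign -mulrA.
rewrite (@big_nat_pick _ _ i) => [|j ji]; last by rewrite eq_sym (negbTE ji).
by rewrite eqxx; case: ltnP => [_|/dn_outN->] //; rewrite !mulr0.
Qed.

Lemma X_sumr (b : A) i : v i * b = b ->
  X * b = (-1) ^+ i * (up i * b) + (if i is i'.+1 then dn i' * b else 0).
Proof.
move=> bi; rewrite -[in LHS]bi mulrA mulr_suml.
under eq_bigr => j _ do rewrite mulrDl -mulrA (up_v zz) (dn_v zz).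
rewrite big_split /= mulrDl; congr (_ + _).
  rewrite (@big_nat_pick _ _ i) => [|j ji]; last by rewrite (negbTE ji) mulr0.
  rewrite eqxx; case: ltnP => [_|/up_outN->]; last by rewrite !(mul0r, mulr0).
  by rewrite mulrA.
case: i bi => [|i] bi; first by rewrite big1 ?mul0r.
rewrite (@big_nat_pick _ _ i) => [|j ji]; last by rewrite eqSS (negbTE ji).
by rewrite eqxx; case: ltnP => [_|/dn_outN->] //; rewrite !mul0r.
Qed.

Lemma tens0l b : tens 0 b = 0.
Proof. exact: (@add_fun0 _ _ (tens^~ b) (fun x y => tensDl en x y b)). Qed.
Lemma tens0r a : tens a 0 = 0.
Proof. exact: (@add_fun0 _ _ (tens a) (tensDr en a)). Qed.
Lemma tens_suml (I : Type) (r : seq I) (P : pred I) (F : I -> A) b :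
  tens (\sum_(i <- r | P i) F i) b = \sum_(i <- r | P i) tens (F i) b.
Proof. exact: (@add_fun_sum _ _ (tens^~ b) (fun x y => tensDl en x y b)). Qed.
Lemma tens_sumr (I : Type) (r : seq I) (P : pred I) (F : I -> A) a :
  tens a (\sum_(i <- r | P i) F i) = \sum_(i <- r | P i) tens a (F i).
Proof. exact: (@add_fun_sum _ _ (tens a) (tensDr en a)). Qed.
Lemma tens_signl n a b : tens ((-1) ^+ n * a) b = (-1) ^+ n * tens a b.
Proof. exact: (@add_fun_sign _ _ (tens^~ b) (fun x y => tensDl en x y b)). Qed.
Lemma tens_signr n a b : tens a ((-1) ^+ n * b) = (-1) ^+ n * tens a b.
Proof. exact: (@add_fun_sign _ _ (tens a) (tensDr en a)). Qed.

Lemma sum_vl a : a = \sum_(0 <= i < N.+1) a * v i.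
Proof. by rewrite -mulr_sumr (zz_sum zz) mulr1. Qed.
Lemma sum_vr b : b = \sum_(0 <= i < N.+1) v i * b.
Proof. by rewrite -mulr_suml (zz_sum zz) mul1r. Qed.

Lemma v_idem i : v i * v i = v i.
Proof. by rewrite (zz_vv zz) eqxx. Qed.

(** On a tensor with a in A v_i and b in v_j A, right multiplication by a sum of blocks v_i (x) v_j
    is 0 or the identity; after this reduction, identities in E become statements about pairs of
    indices. *)
Lemma tens_span_blocks (K : E -> Prop) : K 0 -> (forall x y, K x -> K y -> K (x + y)) ->
  (forall i j a b, (i <= N)%N -> (j <= N)%N -> a * v i = a -> v j * b = b -> K (tens a b)) ->
  forall x, K x.
Proof.
move=> K0 KD Kt; apply: (tens_span en) => // a b.
rewrite (sum_vl a) (sum_vr b) tens_suml !big_mkord; apply: (big_ind K) => // i _.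
rewrite tens_sumr; apply: (big_ind K) => // j _.
apply: (Kt i j); [by rewrite -ltnS|by rewrite -ltnS|by rewrite -mulrA v_idem|by rewrite mulrA v_idem].
Qed.

Lemma tens_span_basis (K : E -> Prop) : K 0 -> (forall x y, K x -> K y -> K (x + y)) ->
  (forall j b, v j * b = b -> [/\ forall i, K (tens (v i) b), forall i, K (tens (up i) b),
     forall i, K (tens (dn i) b) & forall i, K (tens (dn i * up i) b)]) ->
  forall x, K x.
Proof.
move=> K0 KD Kt; apply: tens_span_blocks => // i j a b _ _ _ bj.
move: a; apply: (zz_span zz) => [|x y Kx Ky|c x]; first by rewrite tens0l.
  by rewrite (tensDl en); apply: KD.
rewrite (tensZl en) -(tensZr en); have [|Kv Ku Kd Kc] := Kt j (kin c * b).
  by rewrite mulrA -kinC -mulrA bj.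
by case=> [->|[l [->|[->|[->|->]]]]]; rewrite ?tens0l.
Qed.

(** Since 1 is a sum of such tensors, elements of E can be compared through their right
    multiplications on single blocks. *)
Lemma tens_ext (x y : E) :
  (forall i j a b, (i <= N)%N -> (j <= N)%N -> a * v i = a -> v j * b = b ->
     tens a b * x = tens a b * y) -> x = y.
Proof.
move=> xy; rewrite -[x]mul1r -[y]mul1r; move: (1 : E); apply: tens_span_blocks => //.
  by rewrite !mul0r.
by move=> u w; rewrite !mulrDl => -> ->.
Qed.

(** * Idempotents cut out by pairs of vertices, and locality *)

Definition dg (f : nat -> nat -> bool) : E :=
  \sum_(0 <= i < N.+1) \sum_(0 <= j < N.+1) if f i j then tens (v i) (v j) else 0.

Lemma dgE a b f : tens a b * dg f =
  \sum_(0 <= i < N.+1) \sum_(0 <= j < N.+1) if f i j then tens (a * v i) (v j * b) else 0.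
Proof.
rewrite mulr_sumr; apply: eq_bigr => i _; rewrite mulr_sumr; apply: eq_bigr => j _.
by case: (f i j); rewrite ?mulr0 // (tensM en).
Qed.

Lemma tens_dg i j a b f : a * v i = a -> v j * b = b ->
  tens a b * dg f = if f i j then tens a b else 0.
Proof.
move=> ai bj; rewrite dgE.
have vl r : a * v r = if r == i then a else 0.
  by rewrite -{1}ai -mulrA (zz_vv zz) (eq_sym r); case: eqP => _; rewrite ?ai ?mulr0.
have vr r : v r * b = if r == j then b else 0.
  by rewrite -{1}bj mulrA (zz_vv zz); case: eqP => [->|]; rewrite ?bj ?mul0r.
rewrite (@big_nat_pick _ _ i) => [|r ri]; last first.
  by rewrite big1 // => s _; rewrite vl (negbTE ri) tens0l if_same.
rewrite (@big_nat_pick _ _ j) => [|r rj]; last first.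
  by rewrite vr (negbTE rj) tens0r if_same.
rewrite vl vr !eqxx; case: ltnP => iN; last first.
  by rewrite -ai (zz_v_out zz) // mulr0 tens0l if_same.
case: ltnP => // jN.
by rewrite -bj (zz_v_out zz) // mul0r tens0r if_same.
Qed.

Lemma dgM f g : dg f * dg g = dg (fun i j => f i j && g i j).
Proof.
apply: tens_ext => i j a b _ _ ai bj; rewrite mulrA !(tens_dg _ ai bj).
by case: (f i j); rewrite ?mul0r // (tens_dg _ ai bj).
Qed.

Lemma eq_dg f g : (forall i j, f i j = g i j) -> dg f = dg g.
Proof. by move=> fg; apply: eq_bigr => i _; apply: eq_bigr => j _; rewrite fg. Qed.

Lemma dgT : dg (fun _ _ => true) = 1.
Proof. by apply: tens_ext => i j a b _ _ ai bj; rewrite (tens_dg _ ai bj) mulr1. Qed.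

Definition XL := tens X 1.
Definition XR := tens 1 X.

Lemma tens_XL a b : tens a b * XL = tens (a * X) b.
Proof. by rewrite (tensM en) mul1r. Qed.
Lemma tens_XR a b : tens a b * XR = tens a (X * b).
Proof. by rewrite (tensM en) mulr1. Qed.

Lemma mul_up_v (a : A) i : a * up i * v i = a * up i.
Proof. by rewrite -mulrA (zz_uv zz). Qed.
Lemma mul_dn_v (a : A) i : a * dn i * v i.+1 = a * dn i.
Proof. by rewrite -mulrA (zz_dv zz). Qed.
Lemma mul_v_up (b : A) i : v i.+1 * (up i * b) = up i * b.
Proof. by rewrite mulrA (zz_vu zz). Qed.
Lemma mul_v_dn (b : A) i : v i * (dn i * b) = dn i * b.
Proof. by rewrite mulrA (zz_vd zz). Qed.

Lemma tens_XL_dg i j a b g : a * v i = a -> v j * b = b ->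
  tens a b * XL * dg g =
    (if i is i'.+1 then if g i' j then (-1) ^+ i' * tens (a * up i') b else 0 else 0)
    + (if g i.+1 j then tens (a * dn i) b else 0).
Proof.
move=> ai bj; rewrite tens_XL (X_suml ai) (tensDl en) mulrDl (tens_dg _ (mul_dn_v a i) bj).
congr (_ + _); case: i {ai} => [|i]; first by rewrite tens0l mul0r.
by rewrite tens_signl -mulrA (tens_dg _ (mul_up_v a i) bj); case: ifP; rewrite ?mulr0.
Qed.

Lemma tens_XR_dg i j a b g : a * v i = a -> v j * b = b ->
  tens a b * XR * dg g =
    (if g i j.+1 then (-1) ^+ j * tens a (up j * b) else 0)
    + (if j is j'.+1 then if g i j' then tens a (dn j' * b) else 0 else 0).
Proof.
move=> ai bj; rewrite tens_XR (X_sumr bj) (tensDr en) mulrDl tens_signr -mulrA.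
rewrite (tens_dg _ ai (mul_v_up b j)).
congr (_ + _); first by case: ifP; rewrite ?mulr0.
case: j {bj} => [|j]; first by rewrite tens0r mul0r.
by rewrite (tens_dg _ ai (mul_v_dn b j)).
Qed.

Definition block (p : 'I_N.+1 * 'I_N.+1) : E := tens (v p.1) (v p.2).

Lemma dg_blocks f : dg f = \sum_p if f (nat_of_ord p.1) (nat_of_ord p.2) then block p else 0.
Proof.
rewrite -(pair_bigA _ (fun i j : 'I_N.+1 => if f i j then block (i, j) else 0)) /dg big_mkord.
by apply: eq_bigr => i _; rewrite big_mkord.
Qed.

(** One arrow, in exactly one of the two tensor factors, leads from one block to the other; [XL] and
    [XR] connect only such blocks. *)
Definition adj (p q : nat * nat) : bool :=
  (p.2 == q.2) && ((q.1 == p.1.+1) || (p.1 == q.1.+1))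
  || (p.1 == q.1) && ((q.2 == p.2.+1) || (p.2 == q.2.+1)).

Definition local_elt (U : E) := forall p q : 'I_N.+1 * 'I_N.+1,
  ~~ adj (nat_of_ord p.1, nat_of_ord p.2) (nat_of_ord q.1, nat_of_ord q.2) ->
  block p * U * block q = 0.

(** Only adjacent pairs of blocks contribute to the sandwiched product, so the supports need agree
    on those alone. Identities between differentials thus become arithmetic on indices. *)
Lemma dg2 f g f' g' U : local_elt U ->
  (forall p q, adj p q -> f p.1 p.2 && g q.1 q.2 = f' p.1 p.2 && g' q.1 q.2) ->
  dg f * U * dg g = dg f' * U * dg g'.
Proof.
move=> lU fg; rewrite !dg_blocks !mulr_suml; apply: eq_bigr => p _.
rewrite !mulr_sumr; apply: eq_bigr => q _.
have [pq|/lU pq] := boolP (adj (nat_of_ord p.1, nat_of_ord p.2) (nat_of_ord q.1, nat_of_ord q.2)).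
  have /= := fg _ _ pq.
  by case: (f _ _); case: (g _ _); case: (f' _ _); case: (g' _ _) => //=; rewrite ?mul0r ?mulr0 ?mul0r.
by do 4 case: ifP => _; rewrite ?mul0r ?mulr0 ?mul0r ?pq.
Qed.

(** A middle idempotent is redundant if every two-step route between the outer supports passes
    through its support: the terms that it removes are 0 anyway. *)
Lemma dg3 (f g h : nat -> nat -> bool) U V : local_elt U -> local_elt V ->
  (forall p q r, adj p q -> adj q r -> f p.1 p.2 -> h r.1 r.2 -> g q.1 q.2) ->
  dg f * U * dg g * V * dg h = dg f * (U * V) * dg h.
Proof.
move=> lU lV fgh; rewrite [RHS](_ : _ = dg f * U * dg (fun _ _ => true) * V * dg h); last first.
  by rewrite dgT mulr1 !mulrA.
rewrite !dg_blocks !mulr_suml; apply: eq_bigr => p _.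
rewrite mulr_sumr [RHS]mulr_sumr; apply: eq_bigr => r _.
rewrite !mulr_sumr !mulr_suml; apply: eq_bigr => q _.
case: ifP => fp; last by rewrite !mul0r.
case: (ifP (h _ _)) => hr; last by rewrite !mulr0.
case: ifP => // gq; rewrite mulr0 !mul0r.
have [pq|/lU ->] := boolP (adj (nat_of_ord p.1, nat_of_ord p.2) (nat_of_ord q.1, nat_of_ord q.2)); last first.
  by rewrite !mul0r.
have [qr|/lV e] := boolP (adj (nat_of_ord q.1, nat_of_ord q.2) (nat_of_ord r.1, nat_of_ord r.2)).
  by have := fgh _ _ _ pq qr fp hr; rewrite /= gq.
by rewrite -!mulrA (mulrA (block q)) e !mulr0.
Qed.

Lemma v_X_v i j : v i * X * v j = (if i == j.+1 then (-1) ^+ j * up j else 0) + (if j == i.+1 then dn i else 0).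
Proof.
rewrite (X_suml (v_idem i)) (v_dn zz) eqxx mulrDl (dn_v zz) (eq_sym j); congr (_ + _).
case: i => [|i]; first by rewrite mul0r.
rewrite (v_up zz) eqxx -mulrA (up_v zz) eqSS.
by case: eqP => [->|]; rewrite ?mulr0.
Qed.

Lemma local_XL : local_elt XL.
Proof.
move=> p q; rewrite /block /adj /= tens_XL (tensM en) v_X_v (zz_vv zz) => npq.
have [e|_] := eqVneq (q.2 : nat) (p.2 : nat); last by rewrite tens0r.
move: npq; rewrite e eqxx /= negb_or => /andP[/norP[/negbTE -> /negbTE ->] _].
by rewrite addr0 tens0l.
Qed.

Lemma local_XR : local_elt XR.
Proof.
move=> p q; rewrite /block /adj /= tens_XR (tensM en) mulrA v_X_v (zz_vv zz) => npq.
have [e|_] := eqVneq (p.1 : nat) (q.1 : nat); last by rewrite tens0l.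
move: npq; rewrite e eqxx /= negb_or => /andP[_ /norP[]].
rewrite (eq_sym (q.2 : nat)) => /negbTE n1 /negbTE n2.
by rewrite ?n1 ?n2 addr0 tens0r.
Qed.

Definition XX (s : bool) := if s then XL - XR else XL + XR.

Lemma local_XX s : local_elt (XX s).
Proof.
move=> p q pq; case: s; rewrite /= ?mulrBr ?mulrDr ?mulrBl ?mulrDl local_XL ?local_XR ?subr0 ?addr0 //.
Qed.

(** The inequality |i - j| <= n is split in two to avoid truncated subtraction. *)
Definition adm n i j := [&& (j <= n + i)%N, (i <= n + j)%N, (n <= i + j)%N & ~~ odd (n + i + j)].
(* [pp n] generates the n-th term of the resolution, and right multiplication by
   [dd n] is its differential from degree n + 1 to degree n. *)
Definition pp n := dg (adm n).
Definition dd n := pp n.+1 * XX (~~ odd n) * pp n.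

Lemma pp_idem n : pp n * pp n = pp n.
Proof. by rewrite dgM; apply: eq_dg => i j; rewrite andbb. Qed.
Lemma pp_dd n : pp n.+1 * dd n = dd n.
Proof. by rewrite /dd !mulrA pp_idem. Qed.
Lemma dd_pp n : dd n * pp n = dd n.
Proof. by rewrite /dd -!mulrA pp_idem. Qed.

(** * The complex and its periodicity *)

Lemma XX_XX s : XX s * XX (~~ s) = tens (X * X) 1 - tens 1 (X * X).
Proof.
have e1 : XL * XL = tens (X * X) 1 by rewrite tens_XL.
have e2 : XR * XR = tens 1 (X * X) by rewrite tens_XR.
have e3 : XL * XR = XR * XL by rewrite tens_XR tens_XL mul1r mulr1.
case: s => /=.
  by rewrite mulrBl !mulrDr e1 e2 e3 opprD addrA addrK.
by rewrite mulrDl !mulrBr e1 e2 e3 addrA subrK.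
Qed.

Lemma v_XX i : v i * (X * X) = if i == 0%N then dn 0 * up 0 else 0.
Proof.
rewrite mulrA (X_suml (v_idem i)) (v_dn zz) eqxx mulrDl.
have dX j : dn j * X = (-1) ^+ j * (dn j * up j) + dn j * dn j.+1 by rewrite (X_suml (zz_dv zz j)).
rewrite dX (dn_dn zz) addr0; case: i => [|i]; first by rewrite mul0r add0r expr0 mul1r.
rewrite (v_up zz) eqxx -mulrA (X_suml (zz_uv zz i)) (up_dn zz) eqxx exprS mulN1r mulNr.
by case: i => [|i]; rewrite ?(up_up zz) ?mulr0 ?add0r subrr.
Qed.

Lemma XX_v i : X * X * v i = if i == 0%N then dn 0 * up 0 else 0.
Proof.
rewrite -mulrA (X_sumr (v_idem i)) (up_v zz) eqxx mulrDr.
have Xu j : X * up j = (-1) ^+ j.+1 * (up j.+1 * up j) + dn j * up j by rewrite (X_sumr (zz_vu zz j)).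
rewrite mulrA commr_sign -mulrA Xu (up_up zz) mulr0 add0r.
case: i => [|i]; first by rewrite mulr0 addr0 expr0 mul1r.
rewrite (dn_v zz) eqxx (X_sumr (zz_vd zz i)) (up_dn zz) eqxx exprS mulN1r mulNr.
by case: i => [|i]; rewrite ?(dn_dn zz) ?addr0 addNr.
Qed.

(** A block with a vertex 0 is admissible in one degree only, namely its other vertex. As X^2 lives
    at the vertex 0, this kills X^2 between the degrees n + 2 and n. *)
Lemma adm_gap n j : ~~ (adm n.+2 0 j && adm n 0 j) && ~~ (adm n.+2 j 0 && adm n j 0).
Proof. rewrite /adm; lia. Qed.

Lemma pp_XX_pp n : pp n.+2 * (tens (X * X) 1 - tens 1 (X * X)) * pp n = 0.
Proof.
apply: tens_ext => i j a b _ _ ai bj; rewrite mulr0 !mulrA (tens_dg _ ai bj).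
case: ifP => ad; last by rewrite !mul0r.
have z1 : tens a b * tens (X * X) 1 * pp n = 0.
  rewrite (tensM en) mul1r -ai -(mulrA a) v_XX; case: eqP => [i0|]; last by rewrite mulr0 tens0l mul0r.
  rewrite (tens_dg (i := 0) (j := j)) //; last by rewrite -!mulrA (zz_uv zz).
  by have /andP[/negbTE] := adm_gap n j; rewrite -i0 ad /= i0 => ->.
have z2 : tens a b * tens 1 (X * X) * pp n = 0.
  rewrite (tensM en) mulr1 -bj mulrA XX_v; case: eqP => [j0|]; last by rewrite mul0r tens0r mul0r.
  rewrite (tens_dg (i := i) (j := 0)) //; last by rewrite !mulrA (zz_vd zz).
  by have /andP[_ /negbTE] := adm_gap n i; rewrite -j0 ad /= j0 => ->.
by rewrite mulrBr mulrBl z1 z2 subrr.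
Qed.

Lemma dd_dd n : dd n.+1 * dd n = 0.
Proof.
have -> : dd n.+1 * dd n = pp n.+2 * XX (~~ odd n.+1) * pp n.+1 * XX (~~ odd n) * pp n.
  by rewrite /dd !mulrA -(mulrA _ (pp n.+1) (pp n.+1)) pp_idem.
rewrite /pp (dg3 (local_XX _) (local_XX _)) => [|p q r]; first by rewrite /= negbK XX_XX pp_XX_pp.
rewrite /adj /adm; lia.
Qed.

(** An even shift keeps the sign of the differential, and on adjacent blocks the two sets of
    admissibility conditions coincide. *)
Lemma dd_shift n m : pp (n.+1 + m.*2) * dd n = dd (n + m.*2) * pp n.
Proof.
rewrite /dd !mulrA /pp dgM -[RHS]mulrA dgM oddD odd_double addbF.
apply: dg2 => [|p q]; first exact: local_XX.
rewrite /adj /adm; lia.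
Qed.

(** * The action on the algebra *)

Lemma act0r x : act x 0 = 0.
Proof. exact: (@add_fun0 _ _ (act x) (actDr en x)). Qed.
Lemma act0l a : act 0 a = 0.
Proof. exact: (@add_fun0 _ _ (act^~ a) (fun x y => actDl en x y a)). Qed.
Lemma actBl x y a : act (x - y) a = act x a - act y a.
Proof. exact: (@add_funB _ _ (act^~ a) (fun x y => actDl en x y a)). Qed.

Lemma act_dg f a : act (dg f) a = \sum_(0 <= i < N.+1) \sum_(0 <= j < N.+1) if f i j then v i * a * v j else 0.
Proof.
rewrite (@add_fun_sum _ _ (act^~ a) (fun x y => actDl en x y a)); apply: eq_bigr => i _.
rewrite (@add_fun_sum _ _ (act^~ a) (fun x y => actDl en x y a)); apply: eq_bigr => j _.
by case: (f i j); rewrite ?act0l // (act_tens en).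
Qed.

Lemma act_dg_block f i j a : v i * a = a -> a * v j = a -> act (dg f) a = if f i j then a else 0.
Proof.
move=> ia aj; rewrite act_dg.
have vl r : v r * a = if r == i then a else 0.
  by rewrite -{1}ia mulrA (zz_vv zz); case: eqP => [->|]; rewrite ?ia ?mul0r.
have vr r : a * v r = if r == j then a else 0.
  by rewrite -{1}aj -mulrA (zz_vv zz) (eq_sym r); case: eqP => _; rewrite ?aj ?mulr0.
rewrite (@big_nat_pick _ _ i) => [|r ri]; last first.
  by rewrite big1 // => s _; rewrite vl (negbTE ri) mul0r if_same.
rewrite (@big_nat_pick _ _ j) => [|r rj]; last first.
  by rewrite vl eqxx vr (negbTE rj) if_same.
rewrite vl eqxx vr eqxx; case: ltnP => iN; last by rewrite -ia (zz_v_out zz) // mul0r if_same.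
by case: ltnP => // jN; rewrite -aj (zz_v_out zz) // mulr0 if_same.
Qed.

Lemma act_dg_central f z : (forall x, z * x = x * z) ->
  act (dg f) z = \sum_(0 <= i < N.+1) if f i i then v i * z else 0.
Proof.
move=> zC; rewrite act_dg !big_mkord; apply: eq_bigr => i _; rewrite big_mkord (bigD1 i) //=.
rewrite big1 ?addr0 => [|j ji]; first by rewrite -mulrA zC mulrA v_idem.
rewrite -mulrA zC mulrA (zz_vv zz); case: eqP => [/val_inj e|_]; last by rewrite mul0r if_same.
by rewrite e eqxx in ji.
Qed.

Lemma act_pp0_1 : act (pp 0) 1 = 1.
Proof.
rewrite act_dg_central => [|x]; last by rewrite mulr1 mul1r.
rewrite -[RHS](zz_sum zz); apply: eq_bigr => i _; rewrite mulr1 /adm; case: ifP => //; lia.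
Qed.

(** [dd 0] kills 1 because [XL] and [XR] act on it alike, and [dd_shift] carries this to every even
    degree: it is the cocycle condition for the powers of y. *)
Lemma act_dd_even_1 m : act (dd m.*2) 1 = 0.
Proof.
have e : act (dd 0) 1 = 0.
  rewrite /dd !(actM en) act_pp0_1 /= actBl !(act_tens en) !mulr1 mul1r subrr; exact: act0r.
by rewrite -act_pp0_1 -(actM en) -[m.*2]add0n -dd_shift (actM en) e act0r.
Qed.

(** On the diagonal, admissibility in degree 2m means m <= i, which only gets stronger as m grows;
    this will give y^a y^b = y^(a+b). *)
Lemma act_pp_pp_1 a b : act (pp (a + b).*2 * pp a.*2) 1 = act (pp (a + b).*2) 1.
Proof.
have c1 (x : A) : 1 * x = x * 1 by rewrite mulr1 mul1r.
rewrite dgM !act_dg_central //; apply: eq_bigr => i _.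
suff -> : adm (a + b).*2 i i && adm a.*2 i i = adm (a + b).*2 i i by [].
rewrite /adm; lia.
Qed.

(** * Exactness of the complex *)

Lemma sign_mulK (R : pzRingType) n (x : R) : (-1) ^+ n * ((-1) ^+ n * x) = x.
Proof. by rewrite mulrA -expr2 sqrr_sign mul1r. Qed.

Lemma mulr_signCA (R : pzRingType) n (x y : R) : x * ((-1) ^+ n * y) = (-1) ^+ n * (x * y).
Proof. by rewrite mulrA commr_sign -mulrA. Qed.

Lemma tens_dd i j a b n : adm n.+1 i j -> a * v i = a -> v j * b = b ->
  tens a b * dd n = tens a b * XL * pp n + (-1) ^+ n.+1 * (tens a b * XR * pp n).
Proof.
move=> ad ai bj; rewrite /dd !mulrA (tens_dg _ ai bj) ad -signr_odd /= /XX.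
by case: (odd n); rewrite /= ?expr0 ?expr1 ?mul1r ?mulN1r ?mulrDr ?mulrDl // mulrN mulNr.
Qed.

(** Modulo the image of [dd 0] an arrow moves across the tensor sign: of the four neighbours of the
    block (i+1, i), only (i, i) and (i+1, i+1) are admissible in degree 0. *)
Lemma up_homotopy i b : v i * b = b ->
  (-1) ^+ i * tens (v i.+1) b * dd 0 = tens (up i) b - tens (v i.+1) (up i * b).
Proof.
move=> bi; rewrite -mulrA (tens_dd _ (v_idem _) bi) ?(tens_XL_dg _ (v_idem _) bi)
  ?(tens_XR_dg _ (v_idem _) bi); last by rewrite /adm; lia.
have -> : adm 0 i i by rewrite /adm; lia.
have -> : adm 0 i.+2 i = false by rewrite /adm; lia.
have -> : adm 0 i.+1 i.+1 by rewrite /adm; lia.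
rewrite addr0 (_ : (if i is j'.+1 then _ else _) = 0); last first.
  by case: i {bi} => // i; case: ifP => //; rewrite /adm; lia.
by rewrite addr0 (v_up zz) eqxx expr1 mulN1r -mulrN mulrDr !sign_mulK.
Qed.

Lemma dn_homotopy i b : v i.+1 * b = b ->
  tens (v i) b * dd 0 = tens (dn i) b - tens (v i) (dn i * b).
Proof.
move=> bi; rewrite (tens_dd _ (v_idem _) bi) ?(tens_XL_dg _ (v_idem _) bi)
  ?(tens_XR_dg _ (v_idem _) bi); last by rewrite /adm; lia.
have -> : adm 0 i i by rewrite /adm; lia.
have -> : adm 0 i i.+2 = false by rewrite /adm; lia.
have -> : adm 0 i.+1 i.+1 by rewrite /adm; lia.
rewrite add0r (_ : (if i is j'.+1 then _ else _) = 0); last first.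
  by case: i {bi} => // i; case: ifP => //; rewrite /adm; lia.
by rewrite add0r (v_dn zz) eqxx expr1 mulN1r.
Qed.

Lemma exact0 x : x * pp 0 = x -> act x 1 = 0 -> exists y, x = y * dd 0.
Proof.
(* [sig] is a section of the augmentation. Moving the whole left factor across the tensor sign shows
   that every element of E p_0 is congruent to [sig] of its augmentation modulo the image of
   [dd 0]. *)
pose sig z := \sum_(0 <= r < N.+1) tens (v r) (v r * z).
have sigD z w : sig (z + w) = sig z + sig w.
  by rewrite -big_split; apply: eq_bigr => r _; rewrite mulrDr (tensDr en).
have sigE i z : v i * z = z -> sig z = tens (v i) z.
  move=> iz; rewrite /sig (@big_nat_pick _ _ i) => [|j ji]; last first.
    by rewrite -iz mulrA (zz_vv zz) (negbTE ji) mul0r tens0r.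
  by rewrite iz; case: ltnP => // iN; rewrite (zz_v_out zz) // tens0l.
have sig0 : sig 0 = 0 by rewrite /sig big1 // => r _; rewrite mulr0 tens0r.
suff H : exists y, x * pp 0 = y * dd 0 + sig (act (x * pp 0) 1).
  by move=> xp x1; case: H => y; rewrite xp x1 sig0 addr0 => ->; exists y.
move: x; apply: tens_span_basis => [|x y [x' ex] [y' ey]|j b bj].
- by exists 0; rewrite !mul0r act0l sig0 addr0.
- by exists (x' + y'); rewrite !mulrDl (actDl en) sigD {1}ex {1}ey addrACA.
have off i a : a * v i = a -> (i = j -> exists y, tens a b = y * dd 0 + sig (a * b)) ->
    exists y, tens a b * pp 0 = y * dd 0 + sig (act (tens a b * pp 0) 1).
  move=> ai aj; rewrite (tens_dg _ ai bj); have [ij|ij] := eqVneq i j.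
    have -> : adm 0 i j by rewrite /adm; lia.
    by rewrite (act_tens en) mulr1; apply: aj.
  have -> : adm 0 i j = false by rewrite /adm; lia.
  by exists 0; rewrite mul0r act0l sig0 addr0.
have dnP i b' : v i.+1 * b' = b' -> tens (dn i) b' = tens (v i) b' * dd 0 + sig (dn i * b').
  by move=> bi; rewrite (dn_homotopy bi) (sigE i) ?subrK // mulrA (zz_vd zz).
split=> i.
- apply: (off i); first exact: v_idem.
  by move=> ij; exists 0; rewrite ij bj (sigE j) // mul0r add0r.
- apply: (off i); first exact: (zz_uv zz).
  move=> ij; subst j; exists ((-1) ^+ i * tens (v i.+1) b).
  by rewrite (up_homotopy bj) (sigE i.+1) ?subrK // mulrA (zz_vu zz).
- apply: (off i.+1); first exact: (zz_dv zz).
  by move=> ij; subst j; exists (tens (v i) b); apply: dnP.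
- apply: (off i); first by rewrite -mulrA (zz_uv zz).
  move=> ij; subst j.
  (* The loop crosses in two moves: the first term of the witness moves the up, the second then
     moves the dn. *)
  exists (tens (dn i) 1 * ((-1) ^+ i * tens (v i.+1) b) + tens (v i) (up i * b)).
  rewrite mulrDl -mulrA (up_homotopy bj) -addrA -[dn i * up i * b]mulrA -dnP; last by rewrite mulrA (zz_vu zz).
  by rewrite mulrBr !(tensM en) !mulr1 (zz_dv zz) subrK.
Qed.

(** Removes a rightmost up from each basis element, reading a loop as dn_i up_i; the sign undoes
    that of up_i in [X]. Likewise [strip_dn] removes a dn, but leaves loops aside. Being k-linear by
    their definition through coordinates, both extend to E by [tens_lift]. *)
Definition strip_up (x : A) : A := \sum_(0 <= i < N)
  (kin (phi i i.+1 1 x) * ((-1) ^+ i * v i.+1) + kin (phi i i 2 x) * ((-1) ^+ i * dn i)).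
Definition strip_dn (x : A) : A := \sum_(0 <= i < N) kin (phi i.+1 i 1 x) * v i.

Lemma strip_upD x y : strip_up (x + y) = strip_up x + strip_up y.
Proof.
rewrite -big_split; apply: eq_bigr => i _ /=.
by rewrite !(zz_phiD zz) !kinD !mulrDl addrACA.
Qed.
Lemma strip_upZ c x : strip_up (kin c * x) = kin c * strip_up x.
Proof.
rewrite mulr_sumr; apply: eq_bigr => i _ /=.
by rewrite !(zz_phiZ zz) !kinM mulrDr !mulrA.
Qed.
Lemma strip_dnD x y : strip_dn (x + y) = strip_dn x + strip_dn y.
Proof.
rewrite -big_split; apply: eq_bigr => i _ /=.
by rewrite !(zz_phiD zz) !kinD !mulrDl.
Qed.
Lemma strip_dnZ c x : strip_dn (kin c * x) = kin c * strip_dn x.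
Proof.
rewrite mulr_sumr; apply: eq_bigr => i _ /=.
by rewrite !(zz_phiZ zz) !kinM !mulrA.
Qed.

Lemma strip_up_v j : strip_up (v j) = 0.
Proof.
by rewrite /strip_up big1 // => i _; rewrite !(zz_phi_v zz) /= !andbF kin0 !mul0r addr0.
Qed.
Lemma strip_up_up j : strip_up (up j) = (-1) ^+ j * v j.+1.
Proof.
rewrite /strip_up (@big_nat_pick _ _ j) => [|i ij]; rewrite !(zz_phi_u zz) /= ?eqxx !andbF kin0 mul0r addr0.
  by case: ltnP => jN; [rewrite kin1 mul1r|rewrite (zz_v_out zz) ?mulr0].
by rewrite (negbTE ij) /= andbF kin0 mul0r.
Qed.
Lemma strip_up_dn j : strip_up (dn j) = 0.
Proof.
rewrite /strip_up big1 // => i _; rewrite !(zz_phi_d zz) /= !andbF kin0 !mul0r addr0.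
by rewrite (_ : [&& _, _ & _] = false) ?kin0 ?mul0r //; lia.
Qed.
Lemma strip_up_loop j : strip_up (dn j * up j) = (-1) ^+ j * dn j.
Proof.
rewrite /strip_up (@big_nat_pick _ _ j) => [|i ij]; rewrite !(zz_phi_c zz) /= ?eqxx !andbF kin0 mul0r add0r.
  by case: ltnP => jN; [rewrite kin1 mul1r|rewrite dn_outN ?mulr0].
by rewrite (negbTE ij) /= andbF kin0 mul0r.
Qed.
Lemma strip_dn_v j : strip_dn (v j) = 0.
Proof.
by rewrite /strip_dn big1 // => i _; rewrite !(zz_phi_v zz) /= !andbF kin0 !mul0r.
Qed.
Lemma strip_dn_up j : strip_dn (up j) = 0.
Proof.
rewrite /strip_dn big1 // => i _; rewrite !(zz_phi_u zz) /=.
by rewrite (_ : [&& _, _, _ & _] = false) ?kin0 ?mul0r //; lia.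
Qed.
Lemma strip_dn_dn j : strip_dn (dn j) = if (j < N)%N then v j else 0.
Proof.
rewrite /strip_dn (@big_nat_pick _ _ j) => [|i ij]; rewrite !(zz_phi_d zz) /= ?eqxx.
  by case: ltnP => jN //; rewrite kin1 mul1r.
by rewrite eqSS (negbTE ij) /= andbF kin0 mul0r.
Qed.
Lemma strip_dn_loop j : strip_dn (dn j * up j) = 0.
Proof.
by rewrite /strip_dn big1 // => i _; rewrite !(zz_phi_c zz) /= !andbF kin0 !mul0r.
Qed.

Section Homotopy.
Variables (T1 T2 : E -> E).
Hypotheses (T1D : forall x y, T1 (x + y) = T1 x + T1 y)
  (T1E : forall a b, T1 (tens a b) = tens (strip_up a) b).
Hypotheses (T2D : forall x y, T2 (x + y) = T2 x + T2 y)
  (T2E : forall a b, T2 (tens a b) = tens (strip_dn a) b).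

(* A contraction for the differential with [XL] alone: an up can be stripped from
   the left tensor factor everywhere, a dn only on the extremal blocks j = n + i,
   where multiplication by an up leads out of the support of the next [pp]. *)
Definition htpy n x := T1 x + T2 (x * dg (fun i j => j == (n + i)%N)).

Lemma htpyD n x y : htpy n (x + y) = htpy n x + htpy n y.
Proof. by rewrite /htpy mulrDl T1D T2D addrACA. Qed.
Lemma htpy0 n : htpy n 0 = 0.
Proof. exact: (add_fun0 (htpyD n)). Qed.

Section HomotopyOnBasis.
Variables (j : nat) (b : A) (bj : v j * b = b).

Lemma htpyE n i a : a * v i = a ->
  htpy n (tens a b) = tens (strip_up a) b + (if j == (n + i)%N then tens (strip_dn a) b else 0).
Proof. by move=> ai; rewrite /htpy T1E (tens_dg _ ai bj) (add_fun_if T2D) T2E. Qed.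

Lemma htpy_v n i : htpy n (tens (v i) b) = 0.
Proof. by rewrite (htpyE n (v_idem i)) strip_up_v strip_dn_v tens0l if_same addr0. Qed.
Lemma htpy_up n i : htpy n (tens (up i) b) = (-1) ^+ i * tens (v i.+1) b.
Proof. by rewrite (htpyE n (zz_uv zz i)) strip_up_up strip_dn_up tens0l if_same addr0 tens_signl. Qed.
Lemma htpy_dn n i : htpy n (tens (dn i) b) = if j == (n + i.+1)%N then tens (v i) b else 0.
Proof.
rewrite (htpyE n (zz_dv zz i)) strip_up_dn strip_dn_dn tens0l add0r; case: eqP => // jn.
case: ltnP => // iN; rewrite -bj (zz_v_out zz) ?mul0r ?tens0r //; lia.
Qed.
Lemma htpy_loop n i : htpy n (tens (dn i * up i) b) = (-1) ^+ i * tens (dn i) b.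
Proof.
rewrite (@htpyE n i) ?strip_up_loop ?strip_dn_loop ?tens0l ?if_same ?addr0 ?tens_signl //.
by rewrite -mulrA (zz_uv zz).
Qed.

End HomotopyOnBasis.

Lemma htpy_XL n x :
  htpy n (x * pp n.+1 * XL * pp n) + htpy n.+1 (x * pp n.+1) * pp n.+2 * XL * pp n.+1 = x * pp n.+1.
Proof.
move: x; apply: tens_span_basis => [|x y|j b bj].
- by rewrite !mul0r !htpy0 !mul0r addr0.
- move=> ex ey; rewrite (mulrDl x y) (mulrDl (x * _)) (mulrDl (x * _ * _)) !htpyD.
  by rewrite (mulrDl (htpy n.+1 _)) 2!(mulrDl (_ * _)) addrACA ex ey.
have red i a : a * v i = a -> (adm n.+1 i j -> htpy n (tens a b * XL * pp n) +
     htpy n.+1 (tens a b) * pp n.+2 * XL * pp n.+1 = tens a b) ->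
   htpy n (tens a b * pp n.+1 * XL * pp n) + htpy n.+1 (tens a b * pp n.+1) * pp n.+2 * XL * pp n.+1
   = tens a b * pp n.+1.
  move=> ai H; rewrite (tens_dg _ ai bj); case: ifP => [/H //|_].
  by rewrite !mul0r !htpy0 !mul0r addr0.
have hhs m r x : htpy m ((-1) ^+ r * x) = (-1) ^+ r * htpy m x by apply: (add_fun_sign (htpyD m)).
split=> i.
- apply: (red i) => [|ad]; first exact: v_idem.
  rewrite (htpy_v bj) !mul0r addr0 (tens_XL_dg _ (v_idem i) bj) htpyD (v_dn zz) eqxx.
  rewrite !(add_fun_if (htpyD n)) (htpy_dn bj).
  (* Exactly one neighbour gives v_i back: the dn on an extremal block, where the up leaves the
     support, and the up on all other blocks, where [htpy] ignores the dn. *)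
  have [jn|jn] := eqVneq j (n + i.+1)%N.
    have -> : adm n i.+1 j by move: ad; rewrite /adm; lia.
    case: i ad jn => [|i] ad jn; first by rewrite htpy0 add0r.
    have -> : adm n i j = false by move: ad; rewrite /adm; lia.
    by rewrite htpy0 add0r.
  rewrite if_same addr0; case: i ad jn => [|i] ad jn; first by move: ad; rewrite /adm; lia.
  have -> : adm n i j by move: ad; rewrite /adm; lia.
  by rewrite hhs (v_up zz) eqxx (htpy_up bj) sign_mulK.
- apply: (red i) => [|ad]; first exact: (zz_uv zz).
  rewrite (tens_XL_dg _ (zz_uv zz i) bj) htpyD (up_dn zz) eqxx.
  rewrite (_ : (if i is i'.+1 then _ else _) = 0); last first.
    by case: i {ad} => // i; rewrite (up_up zz) tens0l mulr0 if_same.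
  rewrite htpy0 add0r (add_fun_if (htpyD n)) (htpy_loop bj) (htpy_up bj) -!mulrA.
  rewrite (mulrA _ (pp n.+2)) (tens_dg _ (v_idem _) bj).
  have -> : adm n.+2 i.+1 j by move: ad; rewrite /adm; lia.
  rewrite (mulrA (tens _ _)) (tens_XL_dg _ (v_idem _) bj) ad (v_up zz) eqxx (v_dn zz) eqxx.
  (* Both composites can produce a dn_(i+1) term, with opposite signs; since these two conditions
     agree, the terms occur together and cancel. *)
  have -> : adm n.+1 i.+2 j = adm n i.+1 j by move: ad; rewrite /adm; lia.
  rewrite mulrDr sign_mulK addrCA; case: ifP => _; last by rewrite mulr0 !addr0.
  by rewrite exprS mulN1r mulNr addNr addr0.
- apply: (red i.+1) => [|ad]; first exact: (zz_dv zz).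
  rewrite (tens_XL_dg _ (zz_dv zz i) bj) (dn_dn zz) tens0l if_same addr0.
  rewrite (add_fun_if (htpyD n)) hhs (htpy_loop bj) sign_mulK (htpy_dn bj).
  have [jn|jn] := eqVneq j (n.+1 + i.+1)%N.
    have -> : adm n i j = false by move: ad; rewrite /adm; lia.
    rewrite (tens_dg _ (v_idem _) bj).
    have -> : adm n.+2 i j by move: ad; rewrite /adm; lia.
    rewrite (tens_XL_dg _ (v_idem _) bj) ad (v_dn zz) eqxx add0r.
    rewrite (_ : (if i is i'.+1 then _ else _) = 0) ?add0r //.
    case: i ad jn => // i ad jn; have -> // : adm n.+1 i j = false by move: ad; rewrite /adm; lia.
  have -> : adm n i j by move: ad; rewrite /adm; lia.
  by rewrite !mul0r addr0.
- have ci : dn i * up i * v i = dn i * up i by rewrite -mulrA (zz_uv zz).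
  apply: (red i) => // ad; rewrite (tens_XL_dg _ ci bj) -mulrA (up_dn zz) eqxx mulrA (dn_dn zz).
  rewrite mul0r tens0l if_same addr0.
  rewrite (_ : (if i is i'.+1 then _ else _) = 0); last first.
    by case: i {ad ci} => // i; rewrite -mulrA (up_up zz) mulr0 tens0l mulr0 if_same.
  rewrite htpy0 add0r (htpy_loop bj) -!mulrA (mulrA _ (pp n.+2)) (tens_dg _ (zz_dv zz i) bj).
  have -> : adm n.+2 i.+1 j by move: ad; rewrite /adm; lia.
  rewrite (mulrA (tens _ _)) (tens_XL_dg _ (zz_dv zz i) bj) ad (dn_dn zz) tens0l if_same addr0.
  by rewrite sign_mulK.
Qed.

End Homotopy.

(* [htpy] contracts the XL part of the differential.  The XR part raises the
   radical degree of the right tensor factor, and the cube of the radical is 0, so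
   three corrections give exactness of the whole complex. *)
Inductive radpow : nat -> A -> Prop :=
  | Radpow0 b : radpow 0 b
  | RadpowUp r i b of radpow r b : radpow r.+1 (up i * b)
  | RadpowDn r i b of radpow r b : radpow r.+1 (dn i * b).

Lemma radpow_0 r : radpow r 0.
Proof.
by elim: r => [|r IH]; [exact: Radpow0|rewrite -(mulr0 (up 0)); apply: RadpowUp].
Qed.

Lemma radpow_v r j b : radpow r b -> radpow r (v j * b).
Proof.
case=> {r b}[b|r i b rb|r i b rb]; first exact: Radpow0.
  by rewrite mulrA (v_up zz); case: ifP => _; [apply: RadpowUp|rewrite mul0r; apply: radpow_0].
by rewrite mulrA (v_dn zz); case: ifP => _; [apply: RadpowDn|rewrite mul0r; apply: radpow_0].
Qed.

Lemma radpowS r b : radpow r.+1 b -> exists i, exists2 b', radpow r b' & b = up i * b' \/ b = dn i * b'.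
Proof.
move: {-1}r.+1 (erefl r.+1) => r' er rb; case: rb er => {r' b}[b|r' i b rb|r' i b rb] // [e]; rewrite -e in rb.
  by exists i, b => //; left.
by exists i, b => //; right.
Qed.

Lemma radpow3 b : radpow 3 b -> b = 0.
Proof.
move=> /radpowS[i [b1 /radpowS[j [b2 /radpowS[l [b' _ e]] e']] e'']].
case: e'' => ->; case: e' => ->; case: e => ->; rewrite !mulrA ?(up_up zz) ?(dn_dn zz) ?mul0r //.
- by rewrite (up_dn zz); case: ifP => _; rewrite ?mul0r // -(mulrA (dn _)) (up_up zz) mulr0 mul0r.
- by rewrite -(mulrA (up i)) (dn_dn zz) mulr0 mul0r.
- by rewrite -(mulrA (dn i)) (up_up zz) mulr0 mul0r.
- by rewrite -(mulrA (dn i)) (up_dn zz); case: ifP => _; rewrite ?mulr0 ?mul0r // mulrA (dn_dn zz) !mul0r.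
Qed.

Inductive fil (r : nat) : E -> Prop :=
  | Fil0 : fil r 0
  | FilD x y of fil r x & fil r y : fil r (x + y)
  | FilTens a b of radpow r b : fil r (tens a b).

Lemma fil_start x : fil 0 x.
Proof.
move: x; apply: (tens_span en) => [|x y|a b]; [exact: Fil0|exact: FilD|].
exact/FilTens/Radpow0.
Qed.

Lemma fil3 x : fil 3 x -> x = 0.
Proof. by elim=> {x} [|x y _ -> _ ->|a b /radpow3->] //; rewrite ?addr0 ?tens0r. Qed.

Lemma fil_sign r n x : fil r x -> fil r ((-1) ^+ n * x).
Proof.
elim=> {x}[|x y _ Fx _ Fy|a b rb]; first by rewrite mulr0; apply: Fil0.
  by rewrite mulrDr; apply: FilD.
by rewrite -tens_signl; apply: FilTens.
Qed.

Lemma filN r x : fil r x -> fil r (- x).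
Proof. by move=> /(fil_sign 1); rewrite expr1 mulN1r. Qed.

Lemma fil_lift r (T : E -> E) h : (forall x y, T (x + y) = T x + T y) ->
  (forall a b, T (tens a b) = tens (h a) b) -> forall x, fil r x -> fil r (T x).
Proof.
move=> TD TE x; elim=> {x}[|x y _ Fx _ Fy|a b rb].
- by rewrite (add_fun0 TD); apply: Fil0.
- by rewrite TD; apply: FilD.
- by rewrite TE; apply: FilTens.
Qed.

Lemma fil_dg r f x : fil r x -> fil r (x * dg f).
Proof.
elim=> {x}[|x y _ Fx _ Fy|a b rb]; first by rewrite mul0r; apply: Fil0.
  by rewrite mulrDl; apply: FilD.
rewrite dgE; apply: big_ind => [||i _]; [exact: Fil0|exact: FilD|].
apply: big_ind => [||j _]; [exact: Fil0|exact: FilD|].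
by case: ifP => _; [apply/FilTens/radpow_v|apply: Fil0].
Qed.

Lemma fil_XR r x : fil r x -> fil r.+1 (x * XR).
Proof.
elim=> {x}[|x y _ Fx _ Fy|a b rb]; first by rewrite mul0r; apply: Fil0.
  by rewrite mulrDl; apply: FilD.
rewrite tens_XR mulr_suml tens_sumr; apply: big_ind => [||i _]; [exact: Fil0|exact: FilD|].
rewrite mulrDl -mulrA (tensDr en) tens_signr; apply: FilD; last exact/FilTens/RadpowDn.
exact/fil_sign/FilTens/RadpowUp.
Qed.

Lemma XXE s : XX (odd s) = XL + (-1) ^+ s * XR.
Proof. by rewrite -signr_odd /XX; case: (odd s); rewrite ?expr0 ?expr1 ?mul1r ?mulN1r. Qed.

Lemma mul_ddE x n : x * pp n.+1 = x ->
  x * dd n = x * XL * pp n + (-1) ^+ n.+1 * (x * XR * pp n).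
Proof.
move=> xp; rewrite /dd !mulrA xp -[~~ odd n]/(odd n.+1) XXE mulrDr mulrDl !mulrA.
by rewrite commr_sign.
Qed.

Lemma exactS n x : x * pp n.+1 = x -> x * dd n = 0 -> exists y, x = y * dd n.+1.
Proof.
have [T1 T1D T1E] := tens_lift en strip_upD strip_upZ; have [T2 T2D T2E] := tens_lift en strip_dnD strip_dnZ.
pose H m z := T1 z + T2 (z * dg (fun i j => j == (m + i)%N)).
have Hfil m r z : fil r z -> fil r (H m z).
  move=> rz; apply: FilD; first exact: fil_lift T1D T1E _ rz.
  by apply: fil_lift T2D T2E _ _; apply: fil_dg.
(* [r] is the number of corrections left: for r = 3 the filtration imposes nothing, and for r = 0 it
   forces z = 0. *)
suff S r z : (r <= 3)%N -> fil (3 - r) z -> z * pp n.+1 = z -> z * dd n = 0 ->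
    exists y, z = y * dd n.+1 by apply: (S 3) => //; apply: fil_start.
elim: r z => [|r IH] z r3 rz zp z0; first by exists 0; rewrite mul0r; apply: fil3.
pose y := H n.+1 z * pp n.+2.
have yp : y * pp n.+2 = y by rewrite -mulrA pp_idem.
have [||||y' ey'] := IH (z - y * dd n.+1); last first.
- by exists (y + y'); rewrite mulrDl -ey' addrC subrK.
- by rewrite mulrBl z0 -mulrA dd_dd mulr0 subr0.
- by rewrite mulrBl zp -mulrA dd_pp.
(* Since z is a cycle, its [XL] part is minus its signed [XR] part. Substituting this in the
   contraction identity leaves z - y * dd n.+1 as a sum of two terms that contain [XR], hence one
   step deeper in the filtration. *)
- have ez : z = H n (z * XL * pp n) + y * XL * pp n.+1.
    by have := htpy_XL T1D T1E T2D T2E n z; rewrite zp => {1}<-.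
  have eXL : z * XL * pp n = - ((-1) ^+ n.+1 * (z * XR * pp n)).
    by apply/eqP; rewrite -addr_eq0 -(mul_ddE zp) z0.
  rewrite {1}ez (mul_ddE yp) opprD addrA addrK eXL -subSS subSn //.
  apply: FilD; first by apply/Hfil/filN/fil_sign/fil_dg/fil_XR.
  by apply/filN/fil_sign/fil_dg/fil_XR/fil_dg/Hfil.
- exact: ltnW.
Qed.

(** * Even cocycles and coboundaries of the complex *)

Local Notation loop i := (dn i * up i).

Lemma loop_v i j : loop i * v j = if i == j then loop i else 0.
Proof. by rewrite -mulrA (up_v zz); case: ifP; rewrite ?mulr0. Qed.
Lemma v_loop i j : v i * loop j = if i == j then loop j else 0.
Proof. by rewrite mulrA (v_dn zz); case: ifP; rewrite ?mul0r. Qed.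
Lemma loop_up i j : loop i * up j = 0.
Proof. by rewrite -mulrA (up_up zz) mulr0. Qed.
Lemma dn_loop i j : dn i * loop j = 0.
Proof. by rewrite mulrA (dn_dn zz) mul0r. Qed.
Lemma up_loop i j : up i * loop j = 0.
Proof. by rewrite mulrA (up_dn zz); case: ifP => _; rewrite ?mul0r // -mulrA (up_up zz) mulr0. Qed.
Lemma loop_dn i j : loop i * dn j = 0.
Proof. by rewrite -mulrA (up_dn zz); case: ifP => _; rewrite ?mulr0 // mulrA (dn_dn zz) mul0r. Qed.
Lemma loop_loop i j : loop i * loop j = 0.
Proof. by rewrite mulrA loop_dn mul0r. Qed.

Lemma loop_central i x : loop i * x = x * loop i.
Proof.
move: x; apply: (zz_span zz) => [|x y ex ey|c x bx]; first by rewrite mulr0 mul0r.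
  by rewrite mulrDr mulrDl ex ey.
rewrite mulrA -kinC -!mulrA; congr (_ * _); rewrite mulrA.
case: bx => [->|[j [->|[->|[->|->]]]]]; rewrite ?mulr0 ?mul0r //.
- by rewrite loop_v v_loop eq_sym; case: eqP => // ->.
- by rewrite loop_up up_loop.
- by rewrite loop_dn dn_loop.
- by rewrite !loop_loop.
Qed.

Lemma phi_ext (f g : A -> k) :
  (forall x y, f (x + y) = f x + f y) -> (forall c x, f (kin c * x) = c * f x) ->
  (forall x y, g (x + y) = g x + g y) -> (forall c x, g (kin c * x) = c * g x) ->
  (forall i, [/\ f (v i) = g (v i), f (up i) = g (up i), f (dn i) = g (dn i) & f (loop i) = g (loop i)]) ->
  forall x, f x = g x.
Proof.
move=> fD fZ gD gZ fg; have f0 := add_fun0 fD; have g0 := add_fun0 gD.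
apply: (zz_span zz) => [|x y ex ey|c x bx]; first by rewrite f0 g0.
  by rewrite fD gD ex ey.
rewrite fZ gZ; congr (_ * _); case: bx => [->|[i ex]]; first by rewrite f0 g0.
by have [ev eu ed el] := fg i; case: ex => [->|[->|[->|->]]].
Qed.

Lemma phi_sandwich s t d a b (g : A -> k) :
  (forall x y, g (x + y) = g x + g y) -> (forall c x, g (kin c * x) = c * g x) ->
  (forall i, [/\ phi s t d (a * v i * b) = g (v i), phi s t d (a * up i * b) = g (up i),
     phi s t d (a * dn i * b) = g (dn i) & phi s t d (a * loop i * b) = g (loop i)]) ->
  forall x, phi s t d (a * x * b) = g x.
Proof.
move=> gD gZ H; apply: (phi_ext _ _ gD gZ H) => [x y|c x].
  by rewrite mulrDr mulrDl (zz_phiD zz).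
by rewrite sandwichZ (zz_phiZ zz).
Qed.

Lemma phi0 s t d : phi s t d 0 = 0.
Proof. exact: (add_fun0 (zz_phiD zz s t d)). Qed.

Definition phi_basis := (zz_phi_v zz, zz_phi_u zz, zz_phi_d zz, zz_phi_c zz).

Lemma phi_if s t d (b : bool) x : phi s t d (if b then x else 0) = if b then phi s t d x else 0.
Proof. by case: b; rewrite ?phi0. Qed.

(** This and the next three lemmas isolate the coefficient of up_i in the terms of v_(i+1) X w v_i =
    v_(i+1) w X v_i. The terms with an up return a diagonal coefficient of w; those with a dn would
    need a component of w between vertices at distance 2. *)
Lemma phi_up_w i w : (i < N)%N -> phi i i.+1 1 (up i * w * v i) = phi i i 0 w.
Proof.
move=> iN; apply: phi_sandwich (zz_phiD zz i i 0) (zz_phiZ zz i i 0) _ w => j.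
rewrite (up_v zz) (up_up zz) (up_dn zz) up_loop !mul0r !phi0 !phi_basis !andbF; split=> //.
- case: eqP => [<-|_]; rewrite ?mul0r ?phi0 ?andbF //.
  by rewrite (up_v zz) eqxx phi_basis iN !eqxx (ltnW iN).
- case: eqP => [_|_]; rewrite ?mul0r ?phi0 //.
  by rewrite loop_v; case: eqP => // _; rewrite ?phi_basis ?phi0 //= !andbF.
Qed.

Lemma phi_w_up i w : (i < N)%N -> phi i i.+1 1 (v i.+1 * w * up i) = phi i.+1 i.+1 0 w.
Proof.
move=> iN; apply: phi_sandwich (zz_phiD zz i.+1 i.+1 0) (zz_phiZ zz i.+1 i.+1 0) _ w => j.
rewrite -!(mulrA (v i.+1)) (v_up zz) (up_up zz) (dn_up zz) loop_up !mulr0 !phi0 !phi_basis !andbF; split=> //.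
- rewrite (eq_sym j); case: eqP => [<-|_]; rewrite ?mulr0 ?phi0 ?andbF //.
  by rewrite (v_up zz) eqxx phi_basis iN !eqxx.
- case: eqP => [_|_]; rewrite ?mulr0 ?phi0 //.
  by rewrite v_loop; case: eqP => // _; rewrite ?phi_basis ?phi0 //= !andbF.
Qed.

Lemma phi_dn_w i w : phi i i.+1 1 (dn i.+1 * w * v i) = 0.
Proof.
have z x : (fun=> 0 : k) x = 0 by [].
apply: (@phi_sandwich _ _ _ _ _ (fun=> 0)) => [x y|c x|j]; rewrite ?addr0 ?mulr0 //.
rewrite (dn_v zz) (dn_up zz) (dn_dn zz) dn_loop !mul0r !phi0; split=> //.
  case: eqP => _; rewrite ?mul0r ?phi0 // (dn_v zz).
  by rewrite (_ : _ == _ = false) ?phi0 //; lia.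
case: eqP => _; rewrite ?mul0r ?phi0 // loop_v.
by rewrite (_ : _ == _ = false) ?phi0 //; lia.
Qed.

Lemma phi_w_dn i w : phi i.+1 i.+2 1 (v i.+2 * w * dn i) = 0.
Proof.
apply: (@phi_sandwich _ _ _ _ _ (fun=> 0)) => [x y|c x|j]; rewrite ?addr0 ?mulr0 //.
rewrite -!(mulrA (v i.+2)) (v_dn zz) (up_dn zz) (dn_dn zz) loop_dn !mulr0 !phi0; split=> //.
  case: eqP => _; rewrite ?mulr0 ?phi0 // (v_dn zz).
  by rewrite (_ : _ == _ = false) ?phi0 //; lia.
case: eqP => [->|_]; rewrite ?mulr0 ?phi0 // v_loop.
by rewrite (_ : _ == _ = false) ?phi0 //; lia.
Qed.

Lemma zz_expand x : x = \sum_(0 <= i < N.+1) kin (phi i i 0 x) * v i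
  + \sum_(0 <= i < N) kin (phi i i.+1 1 x) * up i + \sum_(0 <= i < N) kin (phi i.+1 i 1 x) * dn i
  + \sum_(0 <= i < N) kin (phi i i 2 x) * loop i.
Proof.
set f := fun s t d (g : nat -> A) n x => \sum_(0 <= i < n) kin (phi (s i) (t i) d x) * g i.
have fD s t d g n y z : f s t d g n (y + z) = f s t d g n y + f s t d g n z.
  by rewrite -big_split; apply: eq_bigr => i _; rewrite (zz_phiD zz) kinD mulrDl.
have fZ s t d g n c y : f s t d g n (kin c * y) = kin c * f s t d g n y.
  by rewrite mulr_sumr; apply: eq_bigr => i _; rewrite (zz_phiZ zz) kinM mulrA.
have f0 s t d g n : f s t d g n 0 = 0 by apply: (add_fun0 (fD s t d g n)).
have fpick s t d (g : nat -> A) n y j : (forall i, phi (s i) (t i) d y = ((i == j) && (j < n)%N)%:R) ->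
    ((n <= j)%N -> g j = 0) -> f s t d g n y = g j.
  move=> H g0; rewrite /f (@big_nat_pick _ _ j) => [|i ij]; rewrite H ?(negbTE ij) ?kin0 ?mul0r // eqxx.
  by case: ltnP => [_|/g0->] //; rewrite kin1 mul1r.
have fno s t d (g : nat -> A) n y : (forall i, phi (s i) (t i) d y = 0) -> f s t d g n y = 0.
  by move=> H; rewrite /f big1 // => i _; rewrite H kin0 mul0r.
pose F x := f id id 0%N v N.+1 x + f id succn 1%N up N x + f succn id 1%N dn N x + f id id 2%N (fun i => loop i) N x.
rewrite -[RHS]/(F x); move: x; apply: (zz_span zz) => [|x y|c x bx]; first by rewrite /F !f0 !addr0.
  move=> ex ey; rewrite {1}ex {1}ey /F !fD addrACA; congr (_ + _).
  by rewrite addrACA; congr (_ + _); rewrite addrACA.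
rewrite /F !fZ -!mulrDr; congr (_ * _).
case: bx => [->|[j [->|[->|[->|->]]]]]; first by rewrite !f0 !addr0.
- rewrite (fno id succn) ?(fno succn id) ?(fno id id 2%N) ?addr0 => [|i|i|i]; last first.
  + by rewrite phi_basis /= ?andbF.
  + by rewrite phi_basis /= ?andbF.
  + by rewrite phi_basis /= ?andbF.
  + rewrite (fpick _ _ _ _ _ _ j) // => [i|jN]; last by rewrite (zz_v_out zz).
    by rewrite phi_basis andbT andbb andbC.
- rewrite (fno id id 0%N) ?(fno succn id) ?(fno id id 2%N) ?add0r ?addr0 => [|i|i|i]; last first.
  + by rewrite phi_basis (_ : [&& _, _, _ & _] = false) //; lia.
  + by rewrite phi_basis (_ : [&& _, _, _ & _] = false) //; lia.
  + by rewrite phi_basis (_ : [&& _, _, _ & _] = false) //; lia.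
  + rewrite (fpick _ _ _ _ _ _ j) // => [i|jN]; last by rewrite up_outN.
    by rewrite phi_basis andbT eqSS andbb andbC.
- rewrite (fno id id 0%N) ?(fno id succn) ?(fno id id 2%N) ?add0r ?addr0 => [|i|i|i]; last first.
  + by rewrite phi_basis (_ : [&& _, _, _ & _] = false) //; lia.
  + by rewrite phi_basis (_ : [&& _, _, _ & _] = false) //; lia.
  + by rewrite phi_basis (_ : [&& _, _, _ & _] = false) //; lia.
  + rewrite (fpick _ _ _ _ _ _ j) // => [i|jN]; last by rewrite dn_outN.
    by rewrite phi_basis andbT eqSS andbb andbC.
- rewrite (fno id id 0%N) ?(fno id succn) ?(fno succn id) ?add0r ?addr0 => [|i|i|i]; last first.
  + by rewrite phi_basis (_ : [&& _, _, _ & _] = false) //; lia.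
  + by rewrite phi_basis (_ : [&& _, _, _ & _] = false) //; lia.
  + by rewrite phi_basis (_ : [&& _, _, _ & _] = false) //; lia.
  + rewrite (fpick _ _ _ _ _ _ j) // => [i|jN]; last by rewrite up_outN // mulr0.
    by rewrite phi_basis andbT andbb andbC.
Qed.

Lemma act_sum x (I : Type) (r : seq I) (P : pred I) (F : I -> A) :
  act x (\sum_(i <- r | P i) F i) = \sum_(i <- r | P i) act x (F i).
Proof. exact: (add_fun_sum (actDr en x)). Qed.

Lemma act_dg_kin f c x : act (dg f) (kin c * x) = kin c * act (dg f) x.
Proof.
rewrite !act_dg mulr_sumr; apply: eq_bigr => i _; rewrite mulr_sumr; apply: eq_bigr => j _.
by case: (f i j); rewrite ?mulr0 // sandwichZ.
Qed.

Lemma act_pp_up m i : act (pp m.*2) (up i) = 0.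
Proof.
rewrite (act_dg_block _ (zz_vu zz i) (zz_uv zz i)) (_ : adm _ _ _ = false) //.
by rewrite /adm; lia.
Qed.
Lemma act_pp_dn m i : act (pp m.*2) (dn i) = 0.
Proof.
rewrite (act_dg_block _ (zz_vd zz i) (zz_dv zz i)) (_ : adm _ _ _ = false) //.
by rewrite /adm; lia.
Qed.
Lemma act_pp_v m i : act (pp m.*2) (v i) = if (m <= i)%N then v i else 0.
Proof.
rewrite (act_dg_block _ (v_idem i) (v_idem i)) (_ : adm _ _ _ = (m <= i)%N) //.
by rewrite /adm; lia.
Qed.
Lemma act_pp_loop m i : act (pp m.*2) (loop i) = if (m <= i)%N then loop i else 0.
Proof.
rewrite (@act_dg_block _ i i) ?v_loop ?loop_v ?eqxx // (_ : adm _ _ _ = (m <= i)%N) //.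
by rewrite /adm; lia.
Qed.

(** At the block (i+1, i) the cocycle condition says that X w and w X agree. The arrow up_i enters
    both sides with the sign (-1)^i, so comparing its coefficients equates the diagonal entries of w
    at i and i+1. *)
Lemma cocycle_diag m w i : act (pp m.*2) w = w -> act (dd m.*2) w = 0 ->
  (m <= i < N)%N -> phi i i 0 w = phi i.+1 i.+1 0 w.
Proof.
move=> pw dw /andP[mi iN].
have ad : adm m.*2.+1 i.+1 i by rewrite /adm; lia.
have e : v i.+1 * X * w * v i = v i.+1 * w * (X * v i).
  have : act (tens (v i.+1) (v i) * dd m.*2) w = 0 by rewrite (actM en) dw act0r.
  rewrite (tens_dd ad (v_idem _) (v_idem _)) -signr_odd /= odd_double expr1 mulN1r actBl.
  rewrite !(actM en _ _ w) pw tens_XL tens_XR !(act_tens en).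
  by move/eqP; rewrite subr_eq0 => /eqP.
have := congr1 (phi i i.+1 1) e.
rewrite (X_suml (v_idem _)) (v_up zz) eqxx (v_dn zz) eqxx.
rewrite (X_sumr (v_idem _)) (up_v zz) eqxx mulrDl mulrDl (zz_phiD zz) phi_dn_w addr0.
rewrite mulrDr (zz_phiD zz).
rewrite (_ : phi i i.+1 1 (v i.+1 * w * (if i is i'.+1 then _ else _)) = 0); last first.
  case: i {mi iN ad e} => [|i]; first by rewrite mulr0 phi0.
  by rewrite (dn_v zz) eqxx phi_w_dn.
have phis n x : phi i i.+1 1 ((-1) ^+ n * x) = (-1) ^+ n * phi i i.+1 1 x.
  exact: (add_fun_sign (zz_phiD zz i i.+1 1)).
rewrite addr0 -(mulrA _ (up i) w) -(mulrA _ (up i * w)) phis phi_up_w // mulr_signCA phis phi_w_up //.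
by move/(congr1 (fun x => (-1) ^+ i * x)); rewrite !sign_mulK.
Qed.

(** The arrow components of w are cut off by [pp m.*2], and by [cocycle_diag] its diagonal
    coefficients from m to N all equal the one at N. Hence w is the truncation of a central element
    with that constant. *)
Lemma cocycle_even m w : act (pp m.*2) w = w -> act (dd m.*2) w = 0 ->
  w = act (pp m.*2) (kin (phi N N 0 w) + \sum_(0 <= i < N) kin (phi i i 2 w) * loop i).
Proof.
move=> pw dw; rewrite -[LHS]pw {1}[w]zz_expand !(actDr en); congr (_ + _).
rewrite (act_sum _ _ _ (fun i => kin (phi i i.+1 1 w) * up i)).
rewrite (act_sum _ _ _ (fun i => kin (phi i.+1 i 1 w) * dn i)).
rewrite [X in _ + X + _]big1 ?addr0 => [|i _]; last by rewrite act_dg_kin act_pp_up mulr0.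
rewrite [X in _ + X]big1 ?addr0 => [|i _]; last by rewrite act_dg_kin act_pp_dn mulr0.
rewrite -[kin (phi N N 0 w)]mulr1 -(zz_sum zz) mulr_sumr !act_sum; apply: eq_big_nat => i iN.
rewrite !act_dg_kin act_pp_v; case: ifP => mi; last by rewrite !mulr0.
congr (kin _ * _); move: iN => /andP[_]; rewrite ltnS => iN.
have [n eN] : exists n, N = (i + n)%N by exists (N - i)%N; lia.
suff H r : (i + r <= N)%N -> phi i i 0 w = phi (i + r) (i + r) 0 w by rewrite eN; apply: H; rewrite -eN.
elim: r => [|r IH] irN; first by rewrite addn0.
rewrite addnS; rewrite addnS in irN; apply: etrans (IH (ltnW irN)) _.
by apply: (cocycle_diag pw dw); apply/andP; split; [apply: leq_trans mi (leq_addr _ _)|].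
Qed.

Lemma pp_act_unit m x : (N < m)%N -> act (pp m.*2) x = 0.
Proof.
move=> Nm; rewrite act_dg big1_seq // => i; rewrite mem_index_iota /= => iN.
rewrite big1_seq // => j; rewrite mem_index_iota /= => jN.
by case: ifP => //; rewrite /adm; lia.
Qed.

(** The differential out of odd degree carries a plus sign, so it sends (-1)^i dn_i, for i >= m, to
    the truncation of loop_i + loop_(i+1). Thus loop_(i+1) is cohomologous to minus loop_i, and the
    induction starts at loop_0, which the truncation kills. *)
Lemma loop_coboundary m i : exists w, act (pp m.+1.*2) (loop i) = act (dd m.*2.+1) w.
Proof.
elim: i => [|i [w IH]].
  by exists 0; rewrite act0r act_pp_loop.
have [im|mi] := ltnP i m.
  by exists 0; rewrite act0r act_pp_loop ltnS leqNgt im.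
exists ((-1) ^+ i * dn i - w).
rewrite (@add_funB _ _ (act _) (actDr en _)) -IH (add_fun_sign (actDr en (dd m.*2.+1))).
rewrite {1}/dd !(actM en) (act_dg_block _ (zz_vd zz i) (zz_dv zz i)).
have -> : adm m.*2.+1 i i.+1 by rewrite /adm; lia.
rewrite /= odd_double /= (actDl en) !(act_tens en) mulr1 mul1r.
rewrite (X_suml (zz_dv zz i)) (X_sumr (zz_vd zz i)) (up_dn zz) eqxx (dn_dn zz) addr0.
rewrite (_ : (if i is i'.+1 then _ else _) = 0) ?addr0; last by case: i {IH mi} => // i; rewrite (dn_dn zz).
by rewrite -mulrDr (add_fun_sign (actDr en _)) sign_mulK (actDr en) addrK.
Qed.

(** A character kills every arrow, hence [X], and [XX] only multiplies by [X] on either side. *)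
Lemma phi_top_XX s x : phi N N 0 (act (XX s) x) = 0.
Proof.
have pX : phi N N 0 X = 0.
  rewrite (add_fun_sum (zz_phiD zz N N 0)) big1 // => i _; rewrite (zz_phiD zz) phi_basis !andbF addr0.
  by rewrite (zz_phiM zz) phi_basis !andbF mulr0.
case: s; rewrite /XX ?actBl ?(actDl en) !(act_tens en) mulr1 mul1r.
  by rewrite (add_funB (zz_phiD zz N N 0)) !(zz_phiM zz) pX mulr0 mul0r subrr.
by rewrite (zz_phiD zz) !(zz_phiM zz) pX mulr0 mul0r addr0.
Qed.

Lemma phi_top_dg f x : phi N N 0 (act (dg f) x) = if f N N then phi N N 0 x else 0.
Proof.
rewrite act_dg (add_fun_sum (zz_phiD zz N N 0)) (@big_nat_pick _ _ N) => [|i iN]; last first.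
  rewrite (add_fun_sum (zz_phiD zz N N 0)) big1 // => j _; rewrite phi_if !(zz_phiM zz) phi_basis.
  by rewrite (eq_sym N) (negbTE iN) /= andbF !mul0r if_same.
rewrite ltnSn (add_fun_sum (zz_phiD zz N N 0)) (@big_nat_pick _ _ N) => [|i iN]; last first.
  by rewrite phi_if !(zz_phiM zz) !phi_basis (eq_sym N) (negbTE iN) /= !andbF !mulr0 if_same.
by rewrite ltnSn phi_if !(zz_phiM zz) phi_basis leqnn !eqxx mul1r mulr1.
Qed.

Lemma phi_top_dd n x : phi N N 0 (act (dd n) x) = 0.
Proof. by rewrite /dd !(actM en) phi_top_dg phi_top_XX if_same. Qed.

Lemma phi_top_pp m x : (m <= N)%N -> phi N N 0 (act (pp m.*2) x) = phi N N 0 x.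
Proof. by move=> mN; rewrite phi_top_dg (_ : adm _ _ _ = true) //; rewrite /adm; lia. Qed.

Lemma phi_1 i : (i <= N)%N -> phi i i 0 1 = 1.
Proof.
move=> iN; rewrite -(zz_sum zz) (add_fun_sum (zz_phiD zz i i 0)) (@big_nat_pick _ _ i) => [|j ji].
  by rewrite ltnS iN phi_basis iN !eqxx.
by rewrite phi_basis (eq_sym i) (negbTE ji) /= andbF.
Qed.

Lemma phi_loop_1 i : phi i i 2 1 = 0.
Proof.
rewrite -(zz_sum zz) (add_fun_sum (zz_phiD zz i i 2)) big1 // => j _.
by rewrite phi_basis /= !andbF.
Qed.

Lemma tens_central z : (forall x, z * x = x * z) -> forall u, tens z 1 * u = u * tens z 1.
Proof.
move=> zC; apply: (tens_span en) => [|x y ex ey|a b]; first by rewrite mulr0 mul0r.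
  by rewrite mulrDr mulrDl ex ey.
by rewrite !(tensM en) zC mulr1 mul1r.
Qed.

End ZigzagResolution.

(** * Comparison with an arbitrary resolution *)

(* [ir_shift] and [ir_pp1] say that right multiplication by the p_n is a chain map
   of even degree, lifting the periodicity class. *)
Record idempotent_resolution (E : pzRingType) (M : lmodType E) (p D : nat -> E) (one : M) : Prop :=
    IdempotentResolution {
  ir_pp : forall n, p n * p n = p n;
  ir_pD : forall n, p n.+1 * D n = D n;
  ir_Dp : forall n, D n * p n = D n;
  ir_DD : forall n, D n.+1 * D n = 0;
  ir_p1 : p 0%N *: one = one;
  ir_D1 : forall m, D m.*2 *: one = 0;
  ir_gen : forall m : M, exists u, u *: one = m;
  ir_exact0 : forall x, x * p 0%N = x -> x *: one = 0 -> exists y, x = y * D 0%N;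
  ir_exactS : forall n x, x * p n.+1 = x -> x * D n = 0 -> exists y, x = y * D n.+1;
  ir_shift : forall n m, p (n.+1 + m.*2)%N * D n = D (n + m.*2)%N * p n;
  ir_pp1 : forall a b, (p (a + b).*2 * p a.*2) *: one = p (a + b).*2 *: one
}.

Section LinearMaps.
Variables (E : pzRingType).

Fact act_on_linear (M : lmodType E) (w : M) : linear (fun x : E^o => (x : E) *: w).
Proof. by move=> a x y; rewrite scalerDl scalerA. Qed.
Definition act_on (M : lmodType E) (w : M) : {linear E^o -> M} :=
  HB.pack (fun x : E^o => (x : E) *: w) (GRing.isLinear.Build E E^o M *:%R _ (act_on_linear w)).

End LinearMaps.

Section Comparison.
Variables (k : fieldType) (E : kalgType k) (M : lmodType E) (P : proj_resolution M).
Variables (p D : nat -> E) (one : M) (ir : idempotent_resolution p D one).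
Local Notation d := (res_d P).
Local Notation aug := (res_aug P).

(** A linear map from P n to the left ideal E p_n, encoded as a map to E whose values p_n fixes. The
    second condition is what the next lifting needs. *)
Let goodF n := {f : {linear P n -> E^o} |
  (forall x, (f x : E) * p n = f x) /\ forall x, exists y, f (d n x) = (y : E) * D n}.

Let goodF0 : {f : goodF 0 | forall x, (sval f x : E) *: one = aug x}.
Proof.
have [h hE] := cid (projective_lift (f := act_on one) (g := aug) (@res_proj _ _ P 0)
  (fun x => ir_gen ir (aug x))).
pose f : {linear P 0%N -> E^o} := act_on (p 0 : E^o) \o h.
have fp x : (f x : E) * p 0 = f x by rewrite -mulrA (ir_pp ir).
have f1 x : (f x : E) *: one = aug x.
  by rewrite -hE /= -[in RHS](ir_p1 ir) scalerA.
have fd x : exists y, f (d 0 x) = (y : E) * D 0.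
  by apply: (ir_exact0 ir) => //; rewrite f1 res_aug_d.
by exists (exist _ f (conj fp fd)).
Qed.

Let goodFS n (f : goodF n) : {f' : goodF n.+1 | forall x, sval f (d n x) = (sval f' x : E) * D n}.
Proof.
case: f => f [fp fd] /=.
have [h hE] := cid (projective_lift (f := act_on (D n : E^o)) (g := f \o d n) (@res_proj _ _ P n.+1)
  (fun x => let: ex_intro y e := fd x in ex_intro _ (y : E^o) (esym e))).
pose f' : {linear P n.+1 -> E^o} := act_on (p n.+1 : E^o) \o h.
have f'p x : (f' x : E) * p n.+1 = f' x by rewrite -mulrA (ir_pp ir).
have f'D x : f (d n x) = (f' x : E) * D n.
  transitivity ((h x : E) * D n); first by rewrite -[LHS]hE.
  by rewrite -[RHS]mulrA (ir_pD ir).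
have f'd x : exists y, f' (d n.+1 x) = (y : E) * D n.+1.
  by apply: (ir_exactS ir) => //; rewrite -f'D res_dd linear0.
by exists (exist _ f' (conj f'p f'd)).
Qed.

Let Fixpoint goodFs n : goodF n :=
  if n is m.+1 return goodF n then sval (goodFS (goodFs m)) else sval goodF0.

Lemma comparison_to : exists F : forall n, {linear P n -> E^o},
  [/\ forall n x, (F n x : E) * p n = F n x, forall x, (F 0%N x : E) *: one = aug x
    & forall n x, F n (d n x) = (F n.+1 x : E) * D n].
Proof.
exists (fun n => sval (goodFs n)); split=> [n|x|n x].
- by case: (svalP (goodFs n)).
- exact: (svalP goodF0).
- exact: (svalP (goodFS (goodFs n))).
Qed.

(** A linear map out of E p_n amounts to an element fixed by p_n, the image of the generator. It is
    lifted by taking any preimage and multiplying it by the idempotent. *)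
Let goodG n := {g : P n | p n *: g = g /\ exists y, d n y = D n *: g}.

Let goodG0 : {g : goodG 0 | aug (sval g) = one}.
Proof.
have [y ey] := cid (res_aug_surj P one).
have pg : p 0%N *: (p 0%N *: y) = p 0%N *: y by rewrite scalerA (ir_pp ir).
have ag : aug (p 0%N *: y) = one by rewrite linearZ /= ey (ir_p1 ir).
have dg : exists z, d 0%N z = D 0%N *: (p 0%N *: y).
  by apply/res_aug_exact; rewrite linearZ /= ag (ir_D1 ir 0).
by exists (exist _ (p 0%N *: y) (conj pg dg)).
Qed.

Let goodGS n (g : goodG n) : {g' : goodG n.+1 | d n (sval g') = D n *: sval g}.
Proof.
case: g => g [pg ex] /=; have [y ey] := cid ex.
have pg' : p n.+1 *: (p n.+1 *: y) = p n.+1 *: y by rewrite scalerA (ir_pp ir).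
have dy : d n (p n.+1 *: y) = D n *: g by rewrite linearZ /= ey scalerA (ir_pD ir).
have dg' : exists z, d n.+1 z = D n.+1 *: (p n.+1 *: y).
  by apply/res_exact; rewrite linearZ /= dy scalerA (ir_DD ir) scale0r.
by exists (exist _ (p n.+1 *: y) (conj pg' dg')).
Qed.

Let Fixpoint goodGs n : goodG n :=
  if n is m.+1 return goodG n then sval (goodGS (goodGs m)) else sval goodG0.

Lemma comparison_from : exists g : forall n, P n,
  [/\ forall n, p n *: g n = g n, aug (g 0%N) = one & forall n, d n (g n.+1) = D n *: g n].
Proof.
exists (fun n => sval (goodGs n)); split=> [n||n].
- by case: (svalP (goodGs n)).
- exact: (svalP goodG0).
- exact: (svalP (goodGS (goodGs n))).
Qed.

End Comparison.

(** * Ext classes represented by elements of M *)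

Section Classes.
Variables (k : fieldType) (E : kalgType k) (M : lmodType E) (P : proj_resolution M).
Variables (p D : nat -> E) (one : M) (ir : idempotent_resolution p D one).
Local Notation d := (res_d P).
Local Notation aug := (res_aug P).
Variables (F : forall n, {linear P n -> E^o}) (g : forall n, P n).
Hypotheses (Fp : forall n x, (F n x : E) * p n = F n x) (F1 : forall x, (F 0%N x : E) *: one = aug x)
  (Fd : forall n x, F n (d n x) = (F n.+1 x : E) * D n).
Hypotheses (pg : forall n, p n *: g n = g n) (ag : aug (g 0%N) = one)
  (dg : forall n, d n (g n.+1) = D n *: g n).

Lemma F_g_D n : (F n.+1 (g n.+1) : E) * D n = D n * (F n (g n) : E).
Proof. by rewrite -Fd dg linearZ. Qed.

(** On E p_n the composite of the two comparison maps is right multiplication by [F n (g n)]. The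
    hypothesis makes p_(n+1) - F (g_(n+1)) - D_n t p_(n+1) a cycle, and exactness supplies the next
    component t' of a homotopy to the identity. *)
Lemma FG_step n t : D n * (p n - (F n (g n) : E)) = D n * t * D n ->
  exists t', p n.+1 - (F n.+1 (g n.+1) : E) = t' * D n.+1 + D n * (t * p n.+1).
Proof.
move=> e; pose x := p n.+1 - (F n.+1 (g n.+1) : E) - D n * t * p n.+1.
have [||y ey] := ir_exactS ir (n := n) (x := x).
- by rewrite /x !mulrBl Fp (ir_pp ir) -(mulrA (D n * t)) (ir_pp ir).
- rewrite /x !mulrBl (ir_pD ir) F_g_D -(mulrA (D n * t)) (ir_pD ir) -e mulrBr (ir_Dp ir) subrr //.
- by exists y; rewrite -ey /x mulrA subrK.
Qed.

Lemma FG_homotopy0 : exists t, p 0%N - (F 0%N (g 0%N) : E) = t * D 0%N.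
Proof.
apply: (ir_exact0 ir); first by rewrite mulrBl Fp (ir_pp ir).
by rewrite scalerBl F1 ag (ir_p1 ir) subrr.
Qed.

Lemma FG_homotopy n : exists t t', p n.+1 - (F n.+1 (g n.+1) : E) = t' * D n.+1 + D n * t.
Proof.
(* Only this consequence of the homotopy in degree n passes through the induction; its other term
   dies by D D = 0. *)
have inv : exists t, D n * (p n - (F n (g n) : E)) = D n * t * D n.
  elim: n => [|n [t /FG_step[t' e]]].
    by have [t ->] := FG_homotopy0; exists t; rewrite mulrA.
  by exists t'; rewrite e mulrDr !mulrA (ir_DD ir) mul0r mul0r addr0.
by have [t /FG_step[t' e]] := inv; exists (t * p n.+1), t'.
Qed.

Lemma eval_linear n (w : M) : linear (fun x : P n => (F n x : E) *: w).
Proof. by move=> a x y; rewrite linearP scalerDl scalerA. Qed.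

Lemma eval_cocycle n (w : M) : D n *: w = 0 -> forall x, (F n (d n x) : E) *: w = 0.
Proof. by move=> dw x; rewrite Fd -scalerA dw scaler0. Qed.

(** A linear map from E p_n to M is an element w of p_n M, and this is the class of its pullback
    along [F]. The value 0 away from cocycles makes the function total, so that no proof enters as
    an argument. *)
Definition eval_class n (w : M) : Ext P M n :=
  if pselect (D n *: w = 0) is left dw
  then ext_class (mk_cocycle (@eval_linear n w) (eval_cocycle dw)) else 0.

Lemma eval_classE n w (dw : D n *: w = 0) :
  eval_class n w = ext_class (mk_cocycle (@eval_linear n w) (eval_cocycle dw)).
Proof.
rewrite /eval_class; case: pselect => // dw'; congr ext_class; exact: val_inj.
Qed.

Lemma eval_class_eqP n w w' (dw : D n *: w = 0) (dw' : D n *: w' = 0) :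
  eval_class n w = eval_class n w' <->
  is_coboundary ((fun x : P n => (F n x : E) *: w : resk M) - (fun x : P n => (F n x : E) *: w' : resk M)).
Proof. by rewrite (eval_classE dw) (eval_classE dw'); apply: ext_classP. Qed.

Lemma eval_class_p n w : eval_class n (p n *: w) = eval_class n w.
Proof.
have e : D n *: (p n *: w) = D n *: w by rewrite scalerA (ir_Dp ir).
rewrite /eval_class; case: pselect => dpw; case: pselect => dw //; last 2 first.
- by case: dw; rewrite -e.
- by case: dpw; rewrite e.
congr ext_class; apply: val_inj; apply: funext => x /=.
by rewrite scalerA Fp.
Qed.

Lemma eval_class_coboundary n w u : D n.+1 *: w = 0 ->
  eval_class n.+1 (w + D n *: u) = eval_class n.+1 w.
Proof.
move=> dw; have dw' : D n.+1 *: (w + D n *: u) = 0.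
  by rewrite scalerDr dw scalerA (ir_DD ir) scale0r addr0.
apply/(eval_class_eqP dw' dw) => /=; exists (fun x => (F n x : E) *: u) => [|x].
  exact: eval_linear.
rewrite !fctE /= Fd; rewrite -[LHS]/((F n.+1 x : E) *: (w + D n *: u) - (F n.+1 x : E) *: w).
by rewrite scalerDr addrC addKr scalerA.
Qed.

Lemma eval_classD n w w' : D n *: w = 0 -> D n *: w' = 0 ->
  eval_class n (w + w') = eval_class n w + eval_class n w'.
Proof.
move=> dw dw'; have dww : D n *: (w + w') = 0 by rewrite scalerDr dw dw' addr0.
rewrite (eval_classE dw) (eval_classE dw') (eval_classE dww).
rewrite /ext_class -qclassD; congr qclass; apply: val_inj; apply: funext => x /=.
by rewrite scalerDr.
Qed.

Lemma eval_classZ n c w : D n *: w = 0 ->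
  eval_class n ((kin c : E) *: w) = c *: eval_class n w.
Proof.
move=> dw; have dcw : D n *: ((kin c : E) *: w) = 0 by rewrite scalerA -kinC -scalerA dw scaler0.
rewrite (eval_classE dw) (eval_classE dcw).
rewrite /ext_class -[RHS](linearZ_LR (qclass (coboundary P M n))); congr qclass.
apply: val_inj; apply: funext => x /=.
by rewrite -[RHS]/((kin c : E) *: ((F n x : E) *: w)) !scalerA kinC.
Qed.

Lemma eval_class0 n : eval_class n 0 = 0.
Proof.
by apply: (addrI (eval_class n 0)); rewrite -eval_classD ?scaler0 // !addr0.
Qed.

(** The identity of P minus the composite of the comparison maps: a chain map that the augmentation
    kills, hence null-homotopic. *)
Let rem n : {linear P n -> P n} := idfun \- (act_on (g n) \o F n).

Let remE n x : rem n x = x - (F n x : E) *: g n. Proof. by []. Qed.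

Let rem_d n x : d n (rem n.+1 x) = rem n (d n x).
Proof. by rewrite !remE linearB linearZ /= dg Fd scalerA. Qed.

Let good n := {s : {linear P n -> P n.+1} | forall y, d n (s (d n y)) = rem n (d n y)}.

Let good0 : {s : good 0 | forall x, d 0%N (sval s x) = rem 0 x}.
Proof.
have ex x : exists y, d 0%N y = rem 0 x.
  by apply/res_aug_exact; rewrite remE linearB linearZ /= ag F1 subrr.
have [h hE] := cid (projective_lift (@res_proj _ _ P 0) ex).
by exists (exist _ h (fun y => hE (d 0%N y))).
Qed.

Let goodS n (s : good n) : {t : good n.+1 | forall x, d n.+1 (sval t x) = rem n.+1 x - sval s (d n x)}.
Proof.
case: s => s sd /=.
have ex x : exists y, d n.+1 y = (rem n.+1 \- (s \o d n)) x.
  by apply/res_exact; rewrite linearB /= rem_d sd subrr.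
have [h hE] := cid (projective_lift (@res_proj _ _ P n.+1) ex).
have hd y : d n.+1 (h (d n.+1 y)) = rem n.+1 (d n.+1 y) by rewrite hE /= res_dd linear0 subr0.
by exists (exist _ h hd).
Qed.

Let Fixpoint goods n : good n :=
  if n is m.+1 return good n then sval (goodS (goods m)) else sval good0.

Lemma GF_homotopy : exists s : forall n, {linear P n -> P n.+1},
  (forall x, x - (F 0%N x : E) *: g 0%N = d 0%N (s 0%N x)) /\
  forall n x, x - (F n.+1 x : E) *: g n.+1 = d n.+1 (s n.+1 x) + s n (d n x).
Proof.
exists (fun n => sval (goods n)); split=> [x|n x]; first by rewrite (svalP good0).
by rewrite (svalP (goodS (goods n))) subrK.
Qed.

(** A cocycle f differs from the evaluation of w = f (g n) by f composed with the null-homotopic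
    [rem], which is a coboundary. *)
Lemma hom_classE n (u : Ext P M n) :
  exists w, [/\ p n *: w = w, D n *: w = 0 & u = eval_class n w].
Proof.
pose f := hom_of_cocycle (ext_repr u).
have fd x : f (d n x) = 0 by apply: (cocycle_d (ext_repr u)).
exists (f (g n)); have pw : p n *: f (g n) = f (g n) by rewrite -linearZ pg.
have dw : D n *: f (g n) = 0 by rewrite -linearZ -[in LHS]dg; apply: fd.
split=> //; rewrite (eval_classE dw) -[LHS]ext_reprK; apply/ext_classP => /=.
have [s [s0 sS]] := GF_homotopy.
case: n u @f fd pw dw => [|n] u f fd pw dw /=.
  apply: funext => x; rewrite !fctE /=.
  transitivity (f x - (F 0%N x : E) *: f (g 0%N)) => //.
  by rewrite -linearZ -linearB s0; apply: fd.
exists (f \o s n) => [|x]; first exact: linearP.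
rewrite !fctE /=; transitivity (f x - (F n.+1 x : E) *: f (g n.+1)) => //.
rewrite -linearZ -linearB sS linearD; apply: etrans (congr2 +%R (fd _) erefl) _.
exact: add0r.
Qed.

Lemma eval_class_eq0 n w : D n *: w = 0 -> eval_class n w = 0 ->
  is_coboundary (fun x : P n => (F n x : E) *: w : resk M).
Proof.
move=> dw; rewrite -(eval_class0 n) => /(eval_class_eqP dw (scaler0 _ _)).
congr is_coboundary; apply: funext => x; rewrite !fctE /=.
transitivity ((F n x : E) *: w - (F n x : E) *: (0 : M)) => //.
by rewrite scaler0 subr0.
Qed.

Lemma eval_class_eq0_0 w : D 0%N *: w = 0 -> eval_class 0 w = 0 -> p 0%N *: w = 0.
Proof.
move=> dw /(eval_class_eq0 dw) /= e; have [t et] := FG_homotopy0.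
have eg : (F 0%N (g 0%N) : E) *: w = 0 by have /(congr1 (fun f => f (g 0%N))) := e.
by rewrite -[p 0%N](subrK (F 0%N (g 0%N) : E)) et scalerDl eg -scalerA dw scaler0 addr0.
Qed.

(** Evaluating the cochain that bounds at [g] turns F (g) w into a multiple of D n, and
    [FG_homotopy] replaces F (g) by p up to a term that kills w and another left multiple by D n. *)
Lemma eval_class_eq0_S n w : D n.+1 *: w = 0 -> eval_class n.+1 w = 0 ->
  exists u, p n.+1 *: w = D n *: u.
Proof.
move=> dw /(eval_class_eq0 dw)[h lh hE]; have [t [t' et]] := FG_homotopy n.
pose h1 : {linear P n -> M} := HB.pack h (GRing.isLinear.Build E (P n) M *:%R h lh).
have eg : (F n.+1 (g n.+1) : E) *: w = D n *: h1 (g n).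
  by rewrite -linearZ -[in RHS]dg; apply: hE.
exists (h1 (g n) + t *: w).
rewrite -[p n.+1](subrK (F n.+1 (g n.+1) : E)) et !scalerDl eg -!scalerA dw scaler0 add0r.
by rewrite scalerDr addrC.
Qed.

Section YonedaEval.
Variables (m : nat) (z : E) (zC : forall u, z * u = u * z).

Fact central_cocycle : D m.*2 *: (z *: one) = 0.
Proof. by rewrite scalerA -zC -scalerA (ir_D1 ir) scaler0. Qed.

Let cz := mk_cocycle (@eval_linear m.*2 (z *: one)) (eval_cocycle central_cocycle).

(** The composite of [F], of right multiplication by z p_n from degree n + 2m to degree n, and of
    the map given by [g]. It is an explicit lifting of the class of z, from which the Yoneda product
    can be computed; it commutes with the differentials by [ir_shift]. *)
Let L n : {linear P (n + m.*2)%N -> P n} := act_on (z *: g n) \o F (n + m.*2)%N.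

Fact L_aug x : aug (L 0%N x) = val cz x.
Proof. by rewrite /= !linearZ /= ag. Qed.

Fact L_d n x : d n (L n.+1 x) = L n (d (n + m.*2)%N x).
Proof.
have zg (u : E) : z *: (u *: g n) = u *: (z *: g n) by rewrite !scalerA zC.
have -> : L n (d (n + m.*2)%N x) = ((F (n + m.*2).+1 x : E) * D (n + m.*2)) *: (z *: g n).
  by rewrite /L /= Fd.
have -> : d n (L n.+1 x) = ((F (n + m.*2).+1 x : E) * p (n.+1 + m.*2) * D n) *: (z *: g n).
  by rewrite (Fp x) -scalerA -zg -dg /L /= !linearZ.
by rewrite -mulrA (ir_shift ir) mulrA -scalerA -zg pg.
Qed.

Lemma yoneda_eval i w : D i *: w = 0 ->
  yoneda (eval_class i w) (eval_class m.*2 (z *: one)) = eval_class (i + m.*2) (z *: (p i *: w)).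
Proof.
move=> dw; rewrite (eval_classE dw) (eval_classE central_cocycle).
rewrite (yonedaE _ (Lifting L_aug L_d)).
have zS (u : E) (y : M) : z *: (u *: y) = u *: (z *: y) by rewrite !scalerA zC.
have dw' : D (i + m.*2)%N *: (z *: (p i *: w)) = 0.
  by rewrite -zS (scalerA (D _)) -(ir_shift ir) -scalerA dw !scaler0.
rewrite (eval_classE dw'); apply/ext_classP => /=.
(* The lifting produces F (g) where the claim has p. Their difference is given by a homotopy: it
   acts as 0 on w in degree 0 and yields a coboundary in higher degrees. *)
have lE x : (F i ((F (i + m.*2)%N x : E) *: (z *: g i)) : E) *: w
    - (F (i + m.*2)%N x : E) *: (z *: (p i *: w))
   = - ((F (i + m.*2)%N x : E) *: (z *: ((p i - (F i (g i) : E)) *: w))).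
  have -> : (F i ((F (i + m.*2)%N x : E) *: (z *: g i)) : E)
     = (F (i + m.*2)%N x : E) * (z * (F i (g i) : E)) by rewrite linearZ linearZ.
  by rewrite -[in LHS]scalerA -scalerBr -[(z * _) *: w]scalerA -scalerBr -scalerBl -opprB scaleNr !scalerN.
case: i w dw {dw'} lE => [|i] w dw lE.
  have [t et] := FG_homotopy0; rewrite [X in is_coboundary X](_ : _ = 0); first exact: is_coboundary0.
  by apply: funext => x; apply: etrans (lE x) _; rewrite et -scalerA dw !scaler0 oppr0.
have [t [t' et]] := FG_homotopy i.
exists (fun x => (F (i + m.*2)%N x : E) *: - (p i *: (z *: (t *: w)))) => [|x]; first exact: eval_linear.
apply: etrans (lE x) _; rewrite et scalerDl -!scalerA dw scaler0 add0r scalerN; congr (- _).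
by rewrite Fd -scalerA (scalerA (D (i + m.*2)%N)) -(ir_shift ir) -scalerA zS [RHS]scalerA (Fp x).
Qed.

End YonedaEval.

End Classes.

Lemma mcoeff0M (n : nat) (R : comNzRingType) (p q : {mpoly R[n]}) : (p * q)@_0%MM = p@_0%MM * q@_0%MM.
Proof. by rewrite -!/(mcoeff 0%MM _) rmorphM. Qed.

Lemma mcoeffU_M (n : nat) (R : comNzRingType) (p q : {mpoly R[n]}) i :
  (p * q)@_(U_(i))%MM = p@_(U_(i))%MM * q@_0%MM + p@_0%MM * q@_(U_(i))%MM.
Proof.
(* The linear coefficient is the value at 0 of a partial derivative, so the claim is Leibniz's
   rule. *)
have d (r : {mpoly R[n]}) : r@_(U_(i))%MM = (r^`M(i))@_0%MM by rewrite mcoeff_deriv add0m mnm0E mulr1n.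
by rewrite !d mderivM mcoeffD !mcoeff0M.
Qed.

Lemma central_scale (E : pzRingType) (M : lmodType E) (p r z z' : E) (w : M) :
  (forall u, z * u = u * z) -> (forall u, z' * u = u * z') -> (p * r) *: w = p *: w ->
  p *: (z' *: (r *: (z *: w))) = p *: (z' *: (z *: w)).
Proof.
move=> zC zC' pr.
have zS u (y : M) : z *: (u *: y) = u *: (z *: y) by rewrite !scalerA zC.
have zS' u (y : M) : z' *: (u *: y) = u *: (z' *: y) by rewrite !scalerA zC'.
by rewrite -(zS r) -(zS' p) -(zS p) [p *: (r *: w)]scalerA pr (zS p) (zS' p).
Qed.

(** * The even part *)

(* [f (2 j) q] is the class of the product of y^j and the polynomial q in the z_i. *)
Record even_ext (k : fieldType) (N : nat) (E : kalgType k) (M : lmodType E) (P : proj_resolution M)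
    (f : forall n, {mpoly k[N]} -> Ext P M n) : Prop := EvenExt {
  eeD : forall n q q', f n (q + q') = f n q + f n q';
  eeZ : forall n c q, f n (c *: q) = c *: f n q;
  ee_odd : forall n q, odd n -> f n q = 0;
  ee1 : f 0%N 1 = ext_unit P;
  eeM : forall i j q q', ~~ odd i -> ~~ odd j -> yoneda (f i q) (f j q') = f (i + j)%N (q * q');
  eeXX : forall i j : 'I_N, f 0%N ('X_i * 'X_j) = 0;
  eeX : forall j (i : 'I_N), f j.+1.*2 'X_i = 0;
  ee_big : forall j, (N < j)%N -> f j.*2 1 = 0;
  ee_inj0 : forall q, f 0%N q = 0 -> q@_0%MM = 0 /\ forall i : 'I_N, q@_(U_(i))%MM = 0;
  ee_inj : forall j q, (j <= N)%N -> f j.*2 q = 0 -> q@_0%MM = 0;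
  ee_surj : forall n (u : Ext P M n), ~~ odd n -> exists q, u = f n q
}.

Section EvenClasses.
Variables (k : fieldType) (N : nat) (A : kalgType k) (v up dn : nat -> A).
Variables (phi : nat -> nat -> nat -> A -> k) (zz : zigzag_algebra N v up dn phi).
Local Notation E := (enveloping A).
Local Notation M := (bimod A).
Let tens : A -> A -> E := @etens k A.
Let act : E -> A -> A := @eact k A.
Let en : enveloping_algebra tens act := A_enveloping A.
Let p := pp N v tens.
Let D := dd N v up dn tens.
Variable P : proj_resolution M.

Lemma kin_act (c : k) (w : M) : (kin c : E) *: w = (kin c * (w : A) : M).
Proof.
have -> : (kin c : E) = tens (kin c) 1.
  by rewrite -[kin c in RHS]mulr1 (tensZl en) (tens1 en) mulr1.
by rewrite [LHS](act_tens en) mulr1.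
Qed.

Lemma zigzag_resolution : idempotent_resolution p D (1 : M).
Proof.
split.
- exact: (pp_idem zz en).
- exact: (pp_dd zz en).
- exact: (dd_pp zz en).
- exact: (dd_dd zz en).
- exact: (act_pp0_1 zz en).
- exact: (act_dd_even_1 zz en).
- by move=> m; exists (tens m 1); rewrite [LHS](act_tens en) !mulr1.
- exact: (exact0 zz en).
- exact: (exactS zz en).
- exact: (dd_shift zz en).
- exact: (act_pp_pp_1 zz en).
Qed.
Let ir := zigzag_resolution.

Local Notation loop i := (dn i * up i).

(** Evaluation of q at the loops: their products are 0, so only the constant and linear terms
    survive. *)
Definition ev (q : {mpoly k[N]}) : A := kin (q@_0%MM) + \sum_(i < N) kin (q@_(U_(i))%MM) * loop i.

Lemma evD q q' : ev (q + q') = ev q + ev q'.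
Proof.
rewrite /ev mcoeffD kinD addrACA -big_split; congr (_ + _); apply: eq_bigr => i _ /=.
by rewrite mcoeffD kinD mulrDl.
Qed.

Lemma evZ c q : ev (c *: q) = kin c * ev q.
Proof.
rewrite /ev mcoeffZ kinM mulrDr mulr_sumr; congr (_ + _); apply: eq_bigr => i _ /=.
by rewrite mcoeffZ kinM -mulrA.
Qed.

Lemma ev1 : ev 1 = 1.
Proof.
rewrite /ev mcoeff1 eqxx kin1 big1 ?addr0 // => i _.
by rewrite mcoeff1 mnm1_eq0 kin0 mul0r.
Qed.

Lemma evX i : ev 'X_i = loop i.
Proof.
rewrite /ev mcoeffX mnm1_eq0 kin0 add0r (bigD1 i) //= mcoeffX eqxx kin1 mul1r big1 ?addr0 // => j ji.
by rewrite mcoeffX (_ : _ == _ = false) ?kin0 ?mul0r // eq_mnm1 eq_sym (negbTE ji).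
Qed.

Lemma evM q q' : ev (q * q') = ev q * ev q'.
Proof.
rewrite /ev mcoeff0M kinM mulrDr mulrDl -addrA; congr (_ + _).
rewrite mulrDl [X in _ + (_ + X)](_ : _ = 0) ?addr0; last first.
  rewrite mulr_suml big1 // => i _; rewrite mulr_sumr big1 // => j _.
  by rewrite -mulrA (mulrA (loop i)) -kinC -mulrA (loop_loop zz) !mulr0.
rewrite mulr_sumr mulr_suml -big_split; apply: eq_bigr => i _ /=.
rewrite mcoeffU_M kinD mulrDl !kinM; congr (_ + _); last by rewrite -[LHS]mulrA.
by rewrite -[LHS]mulrA (kinC q'@_0%MM) -[RHS]mulrA.
Qed.

Lemma ev_central q x : ev q * x = x * ev q.
Proof.
rewrite /ev mulrDl mulrDr kinC; congr (_ + _); rewrite mulr_suml mulr_sumr.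
by apply: eq_bigr => i _; rewrite -mulrA (loop_central zz) mulrA kinC -mulrA.
Qed.

Lemma ev_tens q : (ev q : M) = tens (ev q) 1 *: (1 : M).
Proof. by rewrite [RHS](act_tens en) !mulr1. Qed.

Lemma tens_ev_central q (u : E) : tens (ev q) 1 * u = u * tens (ev q) 1.
Proof. exact: (tens_central en (ev_central q)). Qed.

Lemma ev_cocycle n q : ~~ odd n -> D n *: (ev q : M) = 0.
Proof.
move=> /even_halfK <-; rewrite ev_tens scalerA -tens_ev_central -scalerA.
by rewrite (ir_D1 ir) scaler0.
Qed.

Lemma phi_ev q : phi N N 0 (ev q) = q@_0%MM.
Proof.
rewrite /ev (zz_phiD zz) -[kin q@_0%MM]mulr1 (zz_phiZ zz) (phi_1 zz) // mulr1.
rewrite (add_fun_sum (zz_phiD zz N N 0)) big1 ?addr0 // => i _.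
by rewrite (zz_phiZ zz) (zz_phi_c zz) /= !andbF mulr0.
Qed.

Lemma phi_ev2 q (i : 'I_N) : phi i i 2 (ev q) = q@_(U_(i))%MM.
Proof.
rewrite /ev (zz_phiD zz) -[kin q@_0%MM]mulr1 (zz_phiZ zz) (phi_loop_1 zz) mulr0 add0r.
rewrite (add_fun_sum (zz_phiD zz i i 2)) (bigD1 i) //= (zz_phiZ zz) (zz_phi_c zz) ltn_ord !eqxx mulr1.
rewrite big1 ?addr0 // => j ji.
by rewrite (zz_phiZ zz) (zz_phi_c zz) -(inj_eq val_inj) in ji *; rewrite (eq_sym (i : nat)) (negbTE ji) andbF mulr0.
Qed.

Lemma ev_surj t (b : nat -> k) : exists q, ev q = kin t + \sum_(0 <= i < N) kin (b i) * loop i.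
Proof.
exists (t *: 1 + \sum_(i < N) b i *: 'X_i).
rewrite evD evZ ev1 mulr1 (add_fun_sum evD) big_mkord; congr (_ + _); apply: eq_bigr => i _.
by rewrite evZ evX.
Qed.

Section EvenClassesOf.
Variables (F : forall n, {linear P n -> E^o}) (g : forall n, P n).
Hypotheses (Fp : forall n x, (F n x : E) * p n = F n x)
  (F1 : forall x, (F 0%N x : E) *: (1 : M) = res_aug P x)
  (Fd : forall n x, F n (res_d P n x) = (F n.+1 x : E) * D n).
Hypotheses (pg : forall n, p n *: g n = g n) (ag : res_aug P (g 0%N) = 1)
  (dg : forall n, res_d P n (g n.+1) = D n *: g n).
Local Notation c := (eval_class Fd).

Lemma class_unit : c 0%N (1 : M) = ext_unit P.
Proof.
rewrite (eval_classE Fd (ir_D1 ir 0)); congr ext_class; apply: val_inj.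
by apply: funext => x; apply: F1.
Qed.

(** The right factor is a central element acting on 1, so [yoneda_eval] applies with z = ev q' (x)
    1; the truncation by p_(2a) that it leaves is absorbed by the one by p_(2a+2b). *)
Lemma class_mul a b q q' :
  yoneda (c a.*2 (ev q)) (c b.*2 (ev q')) = c (a.*2 + b.*2)%N (ev (q * q')).
Proof.
rewrite (ev_tens q').
rewrite (yoneda_eval ir Fp F1 Fd pg ag dg b (tens_ev_central q') (ev_cocycle q (negbT (odd_double a)))).
rewrite -(eval_class_p ir Fp) -[RHS](eval_class_p ir Fp); congr eval_class.
have pp1 : (p (a.*2 + b.*2)%N * p a.*2) *: (1 : M) = p (a.*2 + b.*2)%N *: (1 : M).
  by rewrite -doubleD; apply: (ir_pp1 ir).
have h := central_scale (tens_ev_central q) (tens_ev_central q') pp1.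
have e : (ev (q * q') : M) = tens (ev q') 1 *: (ev q : M).
  by rewrite evM ev_central [RHS](act_tens en) mulr1.
by rewrite e; move: h; rewrite -(ev_tens q).
Qed.

Lemma class_loop j i : c j.+1.*2 (loop i : M) = 0.
Proof.
have [w ew] := loop_coboundary zz en j i.
rewrite -(eval_class_p ir Fp); transitivity (c j.+1.*2 (0 + D j.*2.+1 *: (w : M))).
  by rewrite add0r; congr eval_class; apply: ew.
by rewrite (eval_class_coboundary ir Fd) ?scaler0 // eval_class0.
Qed.

Lemma class_top j : (N < j)%N -> c j.*2 (1 : M) = 0.
Proof.
move=> Nj; rewrite -(eval_class_p ir Fp) [p _ *: _](pp_act_unit v en 1 Nj).
exact: eval_class0.
Qed.

Lemma class_inj0 q : c 0%N (ev q) = 0 -> ev q = 0.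
Proof.
move=> /(eval_class_eq0_0 ir Fp F1 ag (@ev_cocycle 0 q isT)) <-.
rewrite {2}(ev_tens q) [RHS]scalerA -tens_ev_central -scalerA (ir_p1 ir); exact: ev_tens.
Qed.

Lemma class_inj j q : (j <= N)%N -> c j.*2 (ev q) = 0 -> q@_0%MM = 0.
Proof.
case: j => [|j] jN; first by move=> /class_inj0 e; rewrite -phi_ev e (phi0 zz).
move=> /(eval_class_eq0_S ir Fp F1 ag dg (@ev_cocycle j.+1.*2 q (negbT (odd_double _))))[u eu].
have := congr1 (phi N N 0) eu.
by rewrite [LHS](phi_top_pp zz en _ jN) [RHS](phi_top_dd zz en) phi_ev.
Qed.

Lemma class_surj m (u : Ext P M m.*2) : exists q, u = c m.*2 (ev q).
Proof.
have [w [pw dw ->]] := hom_classE F1 Fd pg ag dg u.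
have [q qE] := ev_surj (phi N N 0 w) (fun i => phi i i 2 w).
exists q; rewrite -[RHS](eval_class_p ir Fp); congr eval_class.
by rewrite qE; apply: (cocycle_even zz en pw dw).
Qed.

End EvenClassesOf.

Lemma even_ext_exists : exists f : forall n, {mpoly k[N]} -> Ext P M n, even_ext f.
Proof.
have [F [Fp F1 Fd]] : exists F : forall n, {linear P n -> E^o},
    [/\ forall n x, (F n x : E) * p n = F n x,
      forall x, (F 0%N x : E) *: (1 : M) = res_aug P x
    & forall n x, F n (res_d P n x) = (F n.+1 x : E) * D n].
  exact: (comparison_to P ir).
have [g [pg ag dg]] : exists g : forall n, P n, [/\ forall n, p n *: g n = g n,
    res_aug P (g 0%N) = 1 & forall n, res_d P n (g n.+1) = D n *: g n].
  exact: (comparison_from P ir).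
pose c n q := eval_class Fd n (ev q : M).
(* The value 0 in odd degrees makes [f] a family over all degrees, which can serve directly as the
   components of an element of the direct sum. *)
pose f n q : Ext P M n := if odd n then 0 else c n q.
have fE n q : ~~ odd n -> f n q = c n q by rewrite /f => /negbTE ->.
have fE2 j q : f j.*2 q = c j.*2 q by rewrite fE // odd_double.
have f_odd n q : odd n -> f n q = 0 by rewrite /f => ->.
have f1 : f 0%N 1 = ext_unit P.
  by rewrite fE // /c ev1; exact: (class_unit F1 Fd).
have fM i j q q' : ~~ odd i -> ~~ odd j -> yoneda (f i q) (f j q') = f (i + j)%N (q * q').
  move=> ei ej; rewrite !fE ?oddD ?(negbTE ei) ?(negbTE ej) //.
  move: (i./2) (j./2) (even_halfK ei) (even_halfK ej) => a b {ei ej} ea eb; subst i j.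
  exact: (class_mul Fp F1 Fd pg ag dg a b q q').
have fX j i : f j.+1.*2 'X_i = 0 by rewrite fE2 /c evX; exact: (class_loop Fp Fd j i).
have f_top j : (N < j)%N -> f j.*2 1 = 0.
  by move=> Nj; rewrite fE2 /c ev1; exact: (class_top Fp Fd Nj).
have f_inj0 q : f 0%N q = 0 -> q@_0%MM = 0 /\ forall i : 'I_N, q@_(U_(i))%MM = 0.
  rewrite fE // => /(class_inj0 Fp F1 (Fd := Fd) ag) e; rewrite -phi_ev e (phi0 zz); split=> // i.
  by rewrite -phi_ev2 e (phi0 zz).
have f_inj j q : (j <= N)%N -> f j.*2 q = 0 -> q@_0%MM = 0.
  by move=> jN; rewrite fE2; exact: (class_inj Fp F1 (Fd := Fd) ag dg jN).
have f_surj n (u : Ext P M n) : ~~ odd n -> exists q, u = f n q.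
  move=> en'; have [q e] : exists q, u = c n q; last by exists q; rewrite fE.
  move: (n./2) (even_halfK en') => m {en'} em; subst n.
  exact: (class_surj Fp F1 Fd pg ag dg u).
have fD n q q' : f n (q + q') = f n q + f n q'.
  have [on|en'] := boolP (odd n).
    by rewrite (f_odd n q on) (f_odd n q' on) (f_odd n (q + q') on); exact: (esym (addr0 _)).
  rewrite !fE // /c evD; exact: (eval_classD Fd (ev_cocycle q en') (ev_cocycle q' en')).
have fZ n t q : f n (t *: q) = t *: f n q.
  have [on|en'] := boolP (odd n).
    by rewrite (f_odd n q on) (f_odd n (t *: q) on); exact: (esym (scaler0 _ _)).
  rewrite !fE // /c evZ -kin_act; exact: (eval_classZ Fd t (ev_cocycle q en')).
have fXX i j : f 0%N ('X_i * 'X_j) = 0.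
  rewrite fE // /c evM !evX (loop_loop zz); exact: (eval_class0 Fd 0).
exists f; exact: (EvenExt fD fZ f_odd f1 fM fXX fX f_top f_inj0 f_inj f_surj).
Qed.

End EvenClasses.

(** * Polynomials as sums over the powers of y *)

Local Notation widen := (widen_ord (leqnSn _)).

Section LastVariable.
Variables (k : fieldType) (N : nat).
Implicit Types (q : {mpoly k[N]}) (p : {mpoly k[N.+1]}).
Local Notation y := (y_ k N.+1).
Local Notation z := (@z_ k N.+1).

Lemma y_exp j : y ^+ j = 'X_[(U_(ord_max) *+ j)%MM].
Proof. by rewrite /y_ mpolyXn. Qed.

Lemma z_mwiden (i : 'I_N) : z i = mwiden 'X_i.
Proof.
rewrite mwidenX mnmwiden1 /z_; congr ('X__); apply: val_inj; exact: lift_max.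
Qed.

Lemma muniX m : muni 'X_[m] = 'X_[[multinom (m (widen i)) | i < N]] *: 'X^(m ord_max) :> {poly {mpoly k[N]}}.
Proof. by rewrite muniE msuppX big_seq1 mcoeffX eqxx scale1r. Qed.

Lemma mnm_restrict_widen (m : 'X_{1..N}) : [multinom (mnmwiden m (widen i)) | i < N] = m.
Proof. by apply/mnmP => i; rewrite mnmE mnmwiden_widen. Qed.

Lemma muni_mwiden q : muni (mwiden q) = q%:P.
Proof.
have mD (q1 q2 : {mpoly k[N]}) : muni (mwiden (q1 + q2)) = muni (mwiden q1) + muni (mwiden q2).
  by rewrite mwidenD muniD.
rewrite (mpolyE q) [LHS](add_fun_sum mD) [RHS](add_fun_sum (@polyCD _)); apply: eq_bigr => m _.
rewrite mwidenZ mwidenX muniZ muniX mnm_restrict_widen mnmwiden_ordmax expr0 alg_polyC.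
by rewrite -mul_polyC -polyCM mul_mpolyC.
Qed.

Lemma muni_y : muni y = 'X.
Proof.
rewrite /y_ muniX mnmE eqxx expr1 (_ : [multinom _ | _ < N] = 0%MM) ?mpolyX0 ?scale1r //.
by apply/mnmP => i; rewrite !mnmE (_ : _ == _ = false) //; apply/negbTE; rewrite -val_eqE /= gtn_eqF.
Qed.

Lemma muni_graded q j : muni (mwiden q * y ^+ j) = q *: 'X^j.
Proof. by rewrite rmorphM rmorphXn /= muni_mwiden muni_y mul_polyC. Qed.

Lemma mcoeff_graded q j (m : 'X_{1..N.+1}) : m ord_max != j -> (mwiden q * y ^+ j)@_m = 0.
Proof.
move=> mj; rewrite (mpolyE q) raddf_sum mulr_suml raddf_sum big1 //= => m' _.
rewrite mwidenZ mwidenX y_exp -scalerAl -mpolyXD mcoeffZ mcoeffX.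
case: (_ =P m) mj => [<-|_]; rewrite ?mulr0 //.
by rewrite mnmDE mnmwiden_ordmax mulmnE mnm1E eqxx mul1n add0n eqxx.
Qed.

Lemma muni_expand p B : (forall m, m \in msupp p -> (m ord_max < B)%N) ->
  p = \sum_(j < B) mwiden ((muni p)`_j) * y ^+ j.
Proof.
move=> pB; pose T p' := \sum_(j < B) mwiden ((muni p')`_j) * y ^+ j.
have TD p1 p2 : T (p1 + p2) = T p1 + T p2.
  by rewrite -big_split; apply: eq_bigr => j _; rewrite raddfD coefD raddfD mulrDl.
have TZ c p' : T (c *: p') = c *: T p'.
  rewrite scaler_sumr; apply: eq_bigr => j _.
  by rewrite muniZ coefZ mul_mpolyC mwidenZ scalerAl.
rewrite -[RHS]/(T p) {2}(mpolyE p) (add_fun_sum TD) {1}(mpolyE p) !big_seq.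
apply: eq_bigr => m mp; rewrite TZ; congr (_ *: _).
rewrite /T muniX (bigD1 (Ordinal (pB m mp))) //= big1 ?addr0 => [|j jm].
  rewrite coefZ coefXn eqxx mulr1 mwidenX y_exp -mpolyXD; congr ('X_[_]).
  apply/mnmP => i; rewrite mnmDE mulmnE mnm1E.
  case: (unliftP ord_max i) => [i'|] ->.
    have -> : lift ord_max i' = widen i' by apply: val_inj; exact: lift_max.
    by rewrite mnmwiden_widen mnmE (_ : _ == _ = false) ?mul0n ?addn0 //; apply/negbTE; rewrite -val_eqE /= gtn_eqF.
  by rewrite mnmwiden_ordmax eqxx mul1n.
rewrite coefZ coefXn (_ : _ == _ = false) ?mulr0 ?raddf0 ?mul0r //.
by apply/negbTE; rewrite -val_eqE in jm.
Qed.

Local Notation I := (ideal_gen (@zy_rel k N.+1)).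

Lemma ideal_rel p : @zy_rel k N.+1 p -> I p.
Proof. by move=> pr; rewrite -[p]mul1r -[_ * p]mulr1; apply: IdealGen. Qed.

Lemma ideal_scale c p : I p -> I (c *: p).
Proof. by move=> Ip; rewrite -mul_mpolyC; apply: ideal_genMl. Qed.

Lemma ideal_sum (T : eqType) (r : seq T) (F : T -> {mpoly k[N.+1]}) :
  (forall i, i \in r -> I (F i)) -> I (\sum_(i <- r) F i).
Proof.
by move=> IF; rewrite big_seq; apply: big_ind => //; [exact: Ideal0|exact: IdealD].
Qed.

Lemma mnm_factor (m : 'X_{1..N}) : m != 0%MM -> exists i, exists m', m = (U_(i) + m')%MM.
Proof.
move=> m0; have [i mi] : exists i, m i != 0%N.
  apply/existsP; apply: contraR m0; rewrite negb_exists => /forallP m0.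
  by apply/eqP/mnmP => i; rewrite mnm0E; apply/eqP; have := m0 i; rewrite negbK.
by exists i, (m - U_(i))%MM; rewrite addmC submK // lep1mP.
Qed.

(** Every monomial left in q has degree at least 2, hence a factor z_i z_j. *)
Lemma ideal_mwiden q : q@_0%MM = 0 -> (forall i, q@_(U_(i))%MM = 0) -> I (mwiden q).
Proof.
move=> q0 qU; rewrite (mpolyE q) raddf_sum /=; apply: ideal_sum => m mq.
rewrite mwidenZ; apply: ideal_scale; rewrite mcoeff_msupp in mq.
have [|i [m' em]] := @mnm_factor m; first by apply: contraNneq mq => ->; rewrite q0.
have [|j [m'' em']] := @mnm_factor m'.
  by apply: contraNneq mq => m0; rewrite em m0 addm0 qU.
rewrite em em' !mpolyXD !rmorphM /= -!z_mwiden mulrA.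
by apply/ideal_genMr/ideal_rel; apply: (@zy_rel_zz k N.+1).
Qed.

(** Every monomial left in q contains some z_i, which meets a factor y. *)
Lemma ideal_mwiden_y q j : q@_0%MM = 0 -> I (mwiden q * y ^+ j.+1).
Proof.
move=> q0; rewrite exprS mulrA; apply: ideal_genMr.
rewrite (mpolyE q) raddf_sum mulr_suml /=; apply: ideal_sum => m mq.
rewrite mwidenZ -scalerAl; apply: ideal_scale; rewrite mcoeff_msupp in mq.
have [|i [m' em]] := @mnm_factor m; first by apply: contraNneq mq => ->; rewrite q0.
rewrite em mpolyXD rmorphM /= -z_mwiden mulrAC.
by apply/ideal_genMr/ideal_rel; apply: (@zy_rel_zy k N.+1).
Qed.

Lemma ideal_y_top q j : (N < j)%N -> I (mwiden q * y ^+ j).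
Proof.
move=> Nj; apply: ideal_genMl; rewrite -(subnK Nj) exprD.
by apply/ideal_genMl/ideal_rel; apply: (@zy_rel_y k N.+1).
Qed.

End LastVariable.

(** * The isomorphism with the quotient of the polynomial ring *)

Lemma sum_evens (V : nmodType) (m : nat) (G : nat -> V) : (forall i, odd i -> G i = 0) ->
  \sum_(i < m.*2.+1) G i = \sum_(i < m.+1) G i.*2.
Proof.
move=> G0; elim: m => [|m IH]; first by rewrite !big_ord1.
rewrite doubleS 2!big_ord_recr /= IH [RHS]big_ord_recr /= doubleS G0 ?addr0 //=.
by rewrite odd_double.
Qed.

Section EvenIsomorphism.
Variables (k : fieldType) (N : nat) (E : kalgType k) (M : lmodType E) (P : proj_resolution M).
Variables (f : forall n, {mpoly k[N]} -> Ext P M n) (ee : even_ext f).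
Local Notation R := {mpoly k[N.+1]}.
Local Notation y := (y_ k N.+1).
Local Notation z := (@z_ k N.+1).
Local Notation I := (ideal_gen (@zy_rel k N.+1)).

Lemma f0 n : f n 0 = 0.
Proof. exact: (add_fun0 (eeD ee n)). Qed.

(** The coefficient of y^j, a polynomial in the z_i, goes to degree 2j. At odd n the rounded half is
    harmless, as [f] vanishes there. *)
Definition ev_comp (p : R) : dprod (fun i => Ext P M i) := fun n => f n (muni p)`_(n./2).

Lemma ev_comp_bounded p : bounded (ev_comp p).
Proof.
exists (size (muni p)).*2 => n sn; rewrite /ev_comp nth_default ?f0 //.
by rewrite -(half_double (size _)) half_leq.
Qed.

Lemma ev_comp_even p : is_even (mk_dsum (ev_comp_bounded p)).
Proof. by move=> n on; apply: (ee_odd ee). Qed.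

Definition ev_of (p : R) : ext_ev P := mk_even (ev_comp_even p).

Lemma ev_ofE p n : component (val (ev_of p)) n = f n (muni p)`_(n./2).
Proof. by []. Qed.

Lemma ext_ev_eq (x w : ext_ev P) : (forall n, component (val x) n = component (val w) n) -> x = w.
Proof. by move=> xw; apply/val_inj/val_inj/functional_extensionality_dep. Qed.

Lemma component0 n : component (val (0 : ext_ev P)) n = 0. Proof. by []. Qed.
Lemma dsum_componentD (x w : ext_total P) n : component (x + w) n = component x n + component w n.
Proof. by []. Qed.
Lemma dsum_componentZ c (x : ext_total P) n : component (c *: x) n = c *: component x n.
Proof. by []. Qed.
Lemma val_evD (x w : ext_ev P) : val (x + w) = val x + val w.
Proof. exact: (raddfD (val : ext_ev P -> ext_total P)). Qed.
Lemma val_evZ c (x : ext_ev P) : val (c *: x) = c *: val x.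
Proof. exact: (linearZ_LR (val : ext_ev P -> ext_total P)). Qed.
Lemma componentD (x w : ext_ev P) n :
  component (val (x + w)) n = component (val x) n + component (val w) n.
Proof. by rewrite val_evD dsum_componentD. Qed.
Lemma componentZ c (x : ext_ev P) n : component (val (c *: x)) n = c *: component (val x) n.
Proof. by rewrite val_evZ dsum_componentZ. Qed.

Lemma ev_ofD p q : ev_of (p + q) = ev_of p + ev_of q.
Proof. by apply: ext_ev_eq => n; rewrite componentD !ev_ofE raddfD coefD (eeD ee). Qed.

Lemma ev_ofZ c p : ev_of (c *: p) = c *: ev_of p.
Proof. by apply: ext_ev_eq => n; rewrite componentZ !ev_ofE muniZ coefZ mul_mpolyC (eeZ ee). Qed.

Lemma ev_of0 : ev_of 0 = 0.
Proof. exact: (add_fun0 ev_ofD). Qed.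

Lemma ev_of1 : ev_of 1 = ev_one P.
Proof.
apply: ext_ev_eq => n; rewrite ev_ofE muni1 coef1.
case: n => [|[|n]]; first by rewrite (ee1 ee).
  by rewrite (ee_odd ee).
by rewrite /= f0.
Qed.

Lemma ecast_f m n (e : m = n) q : ecast m (Ext P M m) e (f m q) = f n q.
Proof. by case: _ / e. Qed.

Lemma ev_ofM p q : ev_of (p * q) = ev_mul (ev_of p) (ev_of q).
Proof.
apply: ext_ev_eq => n; have [on|en] := boolP (odd n); first by rewrite !ext_evP.
move: (n./2) (even_halfK en) => m {en} em; subst n.
rewrite ev_ofE muniM coefM doubleK (add_fun_sum (eeD ee m.*2)).
(* [G] puts all summands in the one type of degree 2m, which absorbs the casts. Its odd terms
   vanish, and the even ones form the Cauchy product of the coefficients in y. *)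
pose G i : Ext P M m.*2 := if odd i then 0 else f m.*2 ((muni p)`_(i./2) * (muni q)`_((m.*2 - i)./2)).
have eG (i : 'I_m.*2.+1) : ecast j (Ext P M j) (subnKC (leq_ord i))
    (yoneda (f i (muni p)`_(i./2)) (f (m.*2 - i) (muni q)`_((m.*2 - i)./2))) = G i.
  rewrite /G; case: (boolP (odd i)) => oi.
    by rewrite (ee_odd ee _ oi) yoneda0l ecast_ext0.
  by rewrite (eeM ee) ?ecast_f // oddB ?leq_ord // odd_double.
rewrite [RHS](eq_bigr (fun i : 'I_m.*2.+1 => G i)) => [|i _]; last exact: eG.
rewrite sum_evens => [|i oi]; last by rewrite /G oi.
by apply: eq_bigr => i _; rewrite /G odd_double doubleK -doubleB doubleK.
Qed.

Lemma ev_mul0r x : ev_mul x (0 : ext_ev P) = 0.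
Proof.
apply: ext_ev_eq => n; rewrite component0 [LHS]big1 // => i _.
by rewrite component0 yoneda0r ecast_ext0.
Qed.

Lemma ev_mul0l x : ev_mul (0 : ext_ev P) x = 0.
Proof.
apply: ext_ev_eq => n; rewrite component0 [LHS]big1 // => i _.
by rewrite component0 yoneda0l ecast_ext0.
Qed.

Lemma ev_of_graded (q : {mpoly k[N]}) j : f j.*2 q = 0 -> ev_of (mwiden q * y ^+ j) = 0.
Proof.
move=> fq; apply: ext_ev_eq => n; rewrite component0 ev_ofE muni_graded coefZ coefXn.
have [on|en] := boolP (odd n); first exact: (ee_odd ee).
case: eqP => [nj|_]; last by rewrite mulr0 f0.
by rewrite mulr1; rewrite -nj even_halfK in fq.
Qed.

Lemma ev_of_ideal p : I p -> ev_of p = 0.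
Proof.
elim=> {p}[a s b rs||p q _ ep _ eq]; last 2 first.
- exact: ev_of0.
- by rewrite ev_ofD ep eq addr0.
rewrite !ev_ofM (_ : ev_of s = 0) ?ev_mul0r ?ev_mul0l //.
case: rs => [i j|i|].
- have := @ev_of_graded ('X_i * 'X_j) 0 (eeXX ee i j).
  by rewrite expr0 mulr1 mwidenM -!z_mwiden.
- by have := @ev_of_graded 'X_i 1 (eeX ee 0 i); rewrite expr1 -z_mwiden.
- by have := @ev_of_graded 1 N.+1 (ee_big ee (ltnSn N)); rewrite mwiden1 mul1r.
Qed.

Lemma ev_of_inj p : ev_of p = 0 -> I p.
Proof.
move=> p0; have fp j : f j.*2 (muni p)`_j = 0.
  by have := ev_ofE p j.*2; rewrite p0 component0 doubleK => <-.
rewrite (@muni_expand k N p (msize p)) => [|m mp]; last first.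
  apply: leq_ltn_trans (msize_mdeg_lt mp).
  by rewrite mdegE (bigD1 ord_max) //= leq_addr.
(* Each range of the exponent of y uses one kind of relation: at 0 the coefficient has no constant
   or linear term, from 1 to N it has no constant term, and above N the power of y is itself in the
   ideal. *)
apply: ideal_sum => -[[|j] jp] _ /=.
  rewrite expr0 mulr1; have [] := ee_inj0 ee (fp 0%N); exact: ideal_mwiden.
have [jN|Nj] := leqP j.+1 N; last exact: ideal_y_top.
by apply: ideal_mwiden_y; apply: (ee_inj ee jN (fp j.+1)).
Qed.

Lemma ev_of_surj x : exists p, ev_of p = x.
Proof.
have [B xB] := component_bounded (val x).
have /choice [q qE] : forall j, exists q, component (val x) j.*2 = f j.*2 q.
  by move=> j; apply: (ee_surj ee); rewrite odd_double.
exists (\sum_(j < B) mwiden (q j) * y ^+ j); apply: ext_ev_eq => n.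
have [on|en] := boolP (odd n); first by rewrite !ext_evP.
move: (n./2) (even_halfK en) => m {en} em; subst n.
rewrite ev_ofE doubleK rmorph_sum coef_sum /=.
under eq_bigr do rewrite muni_graded coefZ coefXn.
have [mB|Bm] := ltnP m B.
  rewrite (bigD1 (Ordinal mB)) //= eqxx mulr1 big1 => [|j jm]; first by rewrite addr0 qE.
  by rewrite (_ : _ == _ = false) ?mulr0 // eq_sym; apply/negbTE; rewrite -val_eqE in jm.
rewrite big1 ?f0 => [|j _]; last first.
  by rewrite gtn_eqF ?mulr0 // (leq_trans (ltn_ord j) Bm).
by rewrite xB // -addnn (leq_trans Bm) // leq_addr.
Qed.

Definition ev_quot (u : zy_alg k N.+1) : ext_ev P := ev_of (qa_repr u).

Lemma ev_quotE p : ev_quot (qa_class _ p) = ev_of p.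
Proof.
have : ev_of (qa_repr (qa_class (@zy_rel k N.+1) p) - p) = 0.
  by apply/ev_of_ideal/qa_eqP/qa_reprK.
by rewrite (add_funB ev_ofD) => /eqP; rewrite subr_eq0 => /eqP.
Qed.

Fact ev_quot_linear : linear (ev_quot : resk (zy_alg k N.+1)^o -> ext_ev P).
Proof.
move=> c u w; rewrite -(qa_reprK u) -(qa_reprK w).
have -> : c *: (qa_class _ (qa_repr u) : resk (zy_alg k N.+1)^o) + qa_class _ (qa_repr w)
    = qa_class (@zy_rel k N.+1) (c *: qa_repr u + qa_repr w).
  by rewrite qa_classD -mul_mpolyC qa_classM.
by rewrite !ev_quotE ev_ofD ev_ofZ.
Qed.

Lemma ev_quotM u w : ev_quot (u * w) = ev_mul (ev_quot u) (ev_quot w).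
Proof. by rewrite -(qa_reprK u) -(qa_reprK w) -qa_classM !ev_quotE ev_ofM. Qed.

Lemma ev_quot1 : ev_quot 1 = ev_one P.
Proof. by rewrite -ev_of1 -ev_quotE. Qed.

Lemma ev_quot_bij : bijective ev_quot.
Proof.
have /choice[h hK] : forall x, exists u, ev_quot u = x.
  by move=> x; have [p <-] := ev_of_surj x; exists (qa_class _ p); apply: ev_quotE.
exists h => // u; have := hK (ev_quot u).
rewrite -(qa_reprK u) -(qa_reprK (h _)) !ev_quotE => e; apply/qa_eqP/ev_of_inj.
by rewrite (add_funB ev_ofD) e subrr.
Qed.

Lemma ev_quot_homog d u : zy_homog d u <-> ext_homog d (val (ev_quot u)).
Proof.
split=> [[p <- pd] n nd|].
  rewrite ev_quotE ev_ofE; have [on|en] := boolP (odd n); first exact: (ee_odd ee).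
  rewrite muniE coef_sum big_seq big1 ?f0 // => m /pd md.
  rewrite !coefZ coefXn (_ : _ == _ = false) ?mulr0 //; apply: contraNF nd => /eqP nm.
  by rewrite -md -nm mul2n even_halfK.
move=> ud; pose p := qa_repr u; have uE : u = qa_class _ p by rewrite qa_reprK.
have pd n : n != d -> f n (muni p)`_(n./2) = 0.
  by move=> nd; rewrite -(ud n nd) uE ev_quotE.
(* A class whose image is homogeneous of degree d is represented by the part of any representative
   with exponent d/2 in y; for odd d it is 0. *)
pose p' := if odd d then 0 else mwiden (muni p)`_(d./2) * y ^+ d./2.
exists p' => [|m].
  rewrite uE; apply/qa_eqP/ev_of_inj; rewrite (add_funB ev_ofD); apply/eqP; rewrite subr_eq0; apply/eqP.
  apply: ext_ev_eq => n; have [on|en] := boolP (odd n); first by rewrite !ext_evP.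
  rewrite !ev_ofE /p'; case: ifP => od.
    by rewrite muni0 coef0 f0 pd //; apply: contraNneq en => ->.
  rewrite muni_graded coefZ coefXn; have [nd|nd] := eqVneq n d; first by rewrite nd eqxx mulr1.
  rewrite (pd n nd) (_ : _ == _ = false) ?mulr0 ?f0 //.
  by apply: contraNF nd => /eqP e; rewrite -(even_halfK en) e even_halfK // od.
rewrite /p'; case: ifP => od; first by rewrite msupp0.
rewrite mcoeff_msupp; have [->|/mcoeff_graded ->] := eqVneq (m ord_max) d./2; last by rewrite eqxx.
by rewrite mul2n even_halfK // od.
Qed.

Lemma even_isomorphism :
  exists h : {linear resk (zy_alg k N.+1)^o -> ext_ev P},
    [/\ bijective h, h 1 = ev_one P,
        forall u w : zy_alg k N.+1, h (u * w) = ev_mul (h u) (h w)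
      & forall (d : nat) (u : zy_alg k N.+1), zy_homog d u <-> ext_homog d (val (h u))].
Proof.
pose h : {linear resk (zy_alg k N.+1)^o -> ext_ev P} :=
  HB.pack (ev_quot : resk (zy_alg k N.+1)^o -> ext_ev P)
  (GRing.isLinear.Build k (resk (zy_alg k N.+1)^o) (ext_ev P) *:%R _ ev_quot_linear).
exists h; split; [exact: ev_quot_bij|exact: ev_quot1|exact: ev_quotM|exact: ev_quot_homog].
Qed.

End EvenIsomorphism.

Theorem corollary3p12 (k : fieldType) (q : k) (e : nat)
    (q_neq0 : q != 0) (qe : quantum_char q e)
    (P : proj_resolution (bimod (A_ k e))) :
  exists f : {linear resk (zy_alg k e)^o -> HHev P},
    [/\ bijective f,
        f 1 = ev_one P,
        forall u v : zy_alg k e, f (u * v) = ev_mul (f u) (f v)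
      & forall (d : nat) (u : zy_alg k e), zy_homog d u <-> ext_homog d (val (f u))].
Proof.
(* [quantum_char] includes 0 < e, so e = N + 1. *)
case: e qe P => [[]//|N] _ P.
have [f ee] := even_ext_exists (A_zigzag k N) P.
exact: (even_isomorphism ee).
Qed.
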